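(* Let $n,N\ge1$, $q\in[0,1)$, $u_1,\dots,u_N>0$, and type counts $(N_1,\dots,N_n)$ with $N_i\ge1$. Let $\mathbf y=(y_1,\dots,y_n)$ and $\mathbf s^{(v)}=(s_1,\dots,s_n)$ be real parameters with $$0\le s_m^2<u_jy_m,\qquad j=1,\dots,N,\ m=1,\dots,n.$$ For $\mathbf V=(\mathbf V(1),\dots,\mathbf V(N))$, $\mathbf V(j)\in\mathbb Z_{\ge0}^n$, let $F(\mathbf V)=\langle\emptyset|\mathfrak Q^{\mathrm{qBos}}(\mathbf u;\mathbf y;\mathbf s^{(v)})|\mathbf V\rangle$ be the cylinder partition function with empty left boundary and right boundary $\mathbf V$, with weight $\mathbb W^{(-m),\mathrm{qBos}}_{s_m,\,u_jy_m}$ at the vertex $(-m,j)$. Then there is a constant $Z$, depending on the parameters and the type counts but not on $\mathbf V$, such that for all $\mathbf V$ in the sector $(N_1,\dots,N_n)$ the unique stationary distribution of the colored $q$-Boson process with parameters $u_1,\dots,u_N$ in this sector is $$\mathrm{Prob}^{\mathrm{qBos}}_{N_1,\dots,N_n}(\mathbf V)=\frac{F(\mathbf V)}{Z}.$$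
   Context: **Colored $q$-Boson process on the ring.** State: $\mathbf V=(\mathbf V(1),\dots,\mathbf V(N))$, $\mathbf V(j)_i$ = number of particles of color $i\in\{1,\dots,n\}$ at site $j\in\mathbb Z/N\mathbb Z$. In continuous time, for each site $k$ and color $i$, a particle of color $i$ hops from $k$ to $k-1$ (mod $N$) at rate $u_k^{-1}(1-q^{\mathbf V(k)_i})q^{\mathbf V(k)_{i+1}+\dots+\mathbf V(k)_n}$. The type counts $N_i=\sum_j\mathbf V(j)_i$ are conserved; in each sector (fixed type counts) the chain is irreducible on a finite set. **Weights.** $(a;q)_k=\prod_{i=0}^{k-1}(1-aq^i)$, $|\mathbf A|=\sum A_i$, $0^0=1$. For $1\le m\le n$, $\mathbf B,\mathbf D\in\mathbb Z_{\ge0}^n$ (entering from the left, exiting right), and tuples $\mathbf A,\mathbf C$ (entering from below, exiting above) with $A_m=C_m=+\infty$ and other coordinates in $\mathbb Z_{\ge0}$, $$\begin{aligned}\mathbb W^{(-m),\mathrm{qBos}}_{s,u}(\mathbf A,\mathbf B;\mathbf C,\mathbf D)={}&\mathbf 1_{\mathbf A+\mathbf B=\mathbf C+\mathbf D}\mathbf 1_{D_1=\dots=D_{m-1}=0}\sum_{\mathbf P}(s^2/u;q)_{|\mathbf P|}(s^2)^{|\mathbf B|-|\mathbf P|}u^{|\mathbf D|-|\mathbf B|+|\mathbf P|}q^{\sum_{1\le i<j\le n}(B_i-P_i)P_j}\prod_{i=1}^n\frac{(q;q)_{B_i}}{(q;q)_{P_i}(q;q)_{B_i-P_i}}\\&\times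 q^{\sum_{m\le i<j\le n}D_i(C_j-P_j)}\frac1{(q;q)_{D_m}}\prod_{i=m+1}^n\frac{(q;q)_{C_i-P_i+D_i}}{(q;q)_{C_i-P_i}(q;q)_{D_i}},\end{aligned}$$ sum over $\mathbf P\in\mathbb Z^n_{\ge0}$ with $0\le P_i\le\min(B_i,C_i)$; $\mathbf 1_{\mathbf A+\mathbf B=\mathbf C+\mathbf D}$ imposes equality in coordinates $i\ne m$. **Cylinder partition function with empty left boundary.** Vertices are $(-m,j)$, $1\le m\le n$, $j\in\mathbb Z/N\mathbb Z$. For right boundary $\mathbf V$ in which each color occurs at least once, it is the (convergent) sum of $\prod_{m,j}\mathbb W_{m,j}(\mathbf A^{(m,j)},\mathbf H^{(m+1,j)};\mathbf A^{(m,j+1)},\mathbf H^{(m,j)})$, where $\mathbb W_{m,j}$ is the weight at $(-m,j)$, over all $\mathbf H^{(m,j)}\in\mathbb Z_{\ge0}^n$ with $\mathbf H^{(n+1,j)}=\mathbf 0$, $\mathbf H^{(1,j)}=\mathbf V(j)$, and all vertical tuples $\mathbf A^{(m,j)}$ ($j$ cyclic mod $N$) with $(\mathbf A^{(m,j)})_m=+\infty$, $(\mathbf A^{(m,j)})_i=0$ for $i<m$, $(\mathbf A^{(m,j)})_i\in\mathbb Z_{\ge0}$ for $i>m$. *)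

(* Defs.v *)
(* Indices are shifted by one: the colors (and the columns)
   1, ..., n are the elements 0, ..., n-1 of 'I_n, and the sites of Z/NZ are the
   elements of 'I_N, with cyclic successor ordS and predecessor ord_pred. *)
From HB Require Import structures.
From mathcomp Require Import all_boot all_order all_algebra.
From mathcomp Require Import all_classical all_reals all_analysis.
Set Implicit Arguments.
Unset Strict Implicit.
Unset Printing Implicit Defensive.
Import Order.TTheory GRing.Theory Num.Theory.
Local Open Scope classical_set_scope.
Local Open Scope ring_scope.

Definition color_counts (n : nat) := {ffun 'I_n -> nat}.
Definition config (N n : nat) := {ffun 'I_N -> color_counts n}.

Definition csum (n : nat) (A : 'I_n -> nat) : nat := (\sum_(i < n) A i)%N.

Definition sector (N n : nat) (cnt : 'I_n -> nat) : set (config N n) :=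
  [set V : config N n | forall i : 'I_n, (\sum_(j < N) V j i)%N = cnt i].

Section QBosonProcess.
Variables (R : realType) (N n : nat) (q : R) (u : 'I_N -> R).
Implicit Types (V W : config N n) (k : 'I_N) (i : 'I_n).

Definition hop_rate V k i : R :=
  (u k)^-1 * (1 - q ^+ V k i) * q ^+ (\sum_(j < n | (i < j)%N) V k j)%N.

(* When V k i = 0 the truncated subtraction is harmless: the rate vanishes. *)
Definition hop V k i : config N n :=
  [ffun l => [ffun c =>
    (V l c - ((l == k) && (c == i)) + ((l == ord_pred k) && (c == i)))%N]].

(* The entry (V, W) of the Q-matrix: the total rate of the jumps from V to W,
   minus, on the diagonal, the total rate of the jumps out of V; a jump from V
   to V (which occurs when N = 1) contributes 0. *)
Definition generator V W : R :=
  \sum_(k < N) \sum_(i < n)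
    hop_rate V k i * ((hop V k i == W)%:R - (V == W)%:R).

(* A probability vector p on the (finite) sector with p Q = 0. *)
Definition stationary_distribution (cnt : 'I_n -> nat) (p : config N n -> R) :=
  [/\ forall V, sector cnt V -> 0 <= p V,
      \sum_(V \in sector cnt) p V = 1
    & forall W, sector cnt W ->
        \sum_(V \in sector cnt) p V * generator V W = 0].

Definition unique_stationary_distribution (cnt : 'I_n -> nat)
    (p : config N n -> R) :=
  stationary_distribution cnt p /\
  forall p', stationary_distribution cnt p' ->
    forall V, sector cnt V -> p' V = p V.

End QBosonProcess.

Section Weights.
Variables (R : realType) (n : nat) (q : R).

Definition qpoch (a : R) (k : nat) : R := \prod_(i < k) (1 - a * q ^+ i).

(* The weight at a vertex of column m.  The m-th coordinates of A and C stand
   for +oo and are never read.  Since P_i <= B_i <= |B|, the tuples P summed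
   over form a finite type; for i = m the bound P_i <= min(B_i, C_i) is just
   P_i <= B_i.  The exponent |D| - |B| + |P| of u may be negative. *)
Definition qbos_weight (m : 'I_n) (s u : R) (A B C D : color_counts n) : R :=
  (([forall i : 'I_n, (i != m) ==> (A i + B i == C i + D i)%N] &&
    [forall i : 'I_n, (i < m)%N ==> (D i == 0%N)])%:R) *
  (\sum_(P : {ffun 'I_n -> 'I_(csum B).+1} |
      [forall i : 'I_n, (P i <= B i)%N && ((i != m) ==> (P i <= C i)%N)])
    (qpoch (s ^+ 2 / u) (csum (fun i => P i))
     * (s ^+ 2) ^+ (csum B - csum (fun i => P i))
     * u ^ ((csum D)%:Z - (csum B)%:Z + (csum (fun i => P i))%:Z)
     * q ^+ (\sum_(i < n) \sum_(j < n | (i < j)%N) (B i - P i) * P j)%N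
     * (\prod_(i < n) (qpoch q (B i) / (qpoch q (P i) * qpoch q (B i - P i)%N)))
     * q ^+ (\sum_(i < n | (m <= i)%N) \sum_(j < n | (i < j)%N)
               D i * (C j - P j))%N
     * (qpoch q (D m))^-1
     * (\prod_(i < n | (m < i)%N)
          (qpoch q (C i - P i + D i)%N
           / (qpoch q (C i - P i)%N * qpoch q (D i)))))).

End Weights.

Section Cylinder.
Variables (R : realType) (N n : nat) (q : R).
Variables (u : 'I_N -> R) (y s : 'I_n -> R).

(* An edge labelling (H, A) of the cylinder: the edges leaving the vertex of
   column m and row j to the right carry H (widen_ord _ m) j, those entering it
   from the left carry H (lift ord0 m) j, i.e. index m + 1; the edge entering
   it from below carries A m j and the one leaving it above A m (ordS j). *)
Definition labelling := ({ffun 'I_n.+1 -> config N n} *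
                         {ffun 'I_n -> config N n})%type.

(* Empty left boundary, right boundary V.  The coordinate A m j m stands for
   +oo; it is set to 0 so that each labelling is counted once. *)
Definition cylinder_labellings (V : config N n) : set labelling :=
  [set HA : labelling | [/\ forall (j : 'I_N) (i : 'I_n), HA.1 ord_max j i = 0%N,
                HA.1 ord0 = V
              & forall (m : 'I_n) (j : 'I_N) (i : 'I_n),
                  (i <= m)%N -> HA.2 m j i = 0%N]].

Definition labelling_weight (HA : labelling) : R :=
  \prod_(m < n) \prod_(j < N)
    qbos_weight q m (s m) (u j * y m)
      (HA.2 m j) (HA.1 (lift ord0 m) j)
      (HA.2 m (ordS j)) (HA.1 (widen_ord (leqnSn n) m) j).

(* For 0 <= q < 1 and 0 <= s_m ^ 2 < u_j y_m all the weights are nonnegative,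
   so that esum is the sum of the series, +oo if it diverges. *)
Definition cylinder_partition_function (V : config N n) : \bar R :=
  \esum_(HA in cylinder_labellings V) (labelling_weight HA)%:E.

End Cylinder.

(* Main.v *)
(* The partition function is a product of column kernels Q_m: the sum over the
   vertical labels A of column m, in which color m is in infinite supply, sends
   a configuration B of the colors > m to a configuration D of the colors >= m.
   Each Q_m intertwines the generators of the two configurations, so applying
   Q_{n-1}, ..., Q_0 to the empty configuration gives a stationary vector.

   The intertwining is local.  Write W(A, B; C, D) for the vertex weight and e_i
   for one particle of color i.  Three relations hold, in which every term has
   the same total content: one rewrites the deposit W(A, B + e_i; C, D) of a
   particle, one its pickup W(A, B; C, D + e_i), through weights where the
   particle is carried by the vertical line, and one compares q^|B| W with
   q^|D| W.  (They are the first order terms, in the spectral parameter of the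
   transfer matrix, of the Yang-Baxter equation.)  A hop k -> k - 1 of B is a
   pickup at row k and a deposit at row k - 1; summed over A and over k around
   the ring, the terms with particles on the vertical line cancel and the hops
   of D remain.

   The weight itself factors: of the B particles entering, P go straight up and
   B - P join A, then D particles are drawn from A + B - P.  The relations follow
   from q-Pascal identities for the two factors and telescoping over colors. *)
Require Import Defs.
From HB Require Import structures.
From mathcomp Require Import all_boot all_order all_algebra.
From mathcomp Require Import all_classical all_reals all_analysis.
From mathcomp Require Import ring lra zify.
Set Implicit Arguments.
Unset Strict Implicit.
Unset Printing Implicit Defensive.
Import Order.TTheory GRing.Theory Num.Theory.
Local Open Scope classical_set_scope.
Local Open Scope ring_scope.

(** Three obstacles shape the proof. The sums over vertical labels are infinite. They are taken in
    the extended reals, where every term is nonnegative, and terms are cancelled only after their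
    sums have been shown finite. Finiteness comes from each color being present: at a row where
    color m leaves, the weight carries q to the power D_m times the number of particles left on the
    vertical line, and conservation recovers all vertical labels from the label of that row. Next, q
    and s_m may be 0, so the identities avoid dividing by q or by t = s^2/u, or treat t = 0 apart.
    Finally, on a ring with one site the rows k and k - 1 coincide and the local argument breaks
    down, but there every hop returns to the same configuration and the generator vanishes.
    Uniqueness rests on the accessibility of a single configuration, all particles at site 0, from
    every other one; the partition function is positive at this configuration, which also makes Z
    positive. *)

Section ColorCounts.
Variable n : nat.
Implicit Types (A B : color_counts n) (i j : 'I_n).

Definition cinc A i : color_counts n := [ffun j => (A j + (j == i))%N].
Definition cdec A i : color_counts n := [ffun j => (A j - (j == i))%N].

Lemma cincK i : cancel (cinc^~ i) (cdec^~ i).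
Proof. by move=> A; apply/ffunP => j; rewrite !ffunE addnK. Qed.

Lemma cdecK A i : (0 < A i)%N -> cinc (cdec A i) i = A.
Proof.
move=> Ai; apply/ffunP => j; rewrite !ffunE.
by case: eqVneq => [->|_]; rewrite ?subn0 ?addn0// subnK.
Qed.

Lemma cincE A i : cinc A i i = (A i).+1.
Proof. by rewrite ffunE eqxx addn1. Qed.

Lemma csum_cinc A i : csum (cinc A i) = (csum A).+1.
Proof.
rewrite /csum -[RHS]addn1 (eq_bigr (fun j => A j + (j == i)))%N; last by move=> j; rewrite ffunE.
rewrite big_split/=; congr (_ + _)%N.
by rewrite (bigD1 i)//= eqxx big1 ?addn0// => j /negbTE ->.
Qed.

End ColorCounts.

Lemma big_ord_split3 (R : comPzSemiRingType) n (c : 'I_n) (F : 'I_n -> R) :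
  \prod_(j < n) F j
  = \prod_(j < n | (j < c)%N) F j * F c * \prod_(j < n | (c < j)%N) F j.
Proof.
rewrite (bigD1 c)//= (bigID (fun j : 'I_n => j < c)%N)/= mulrA; congr (_ * _).
  rewrite mulrC; congr (_ * _); apply: eq_bigl => j.
  by rewrite -val_eqE/=; case: ltngtP.
by apply: eq_bigl => j; rewrite -val_eqE/=; case: ltngtP.
Qed.

(* With x = 1 or y = 1 this is the usual telescoping of sum_c (1 - x_c) prod_(j < c) x_j. *)
Lemma telescope_prod (R : comPzRingType) n (x y : 'I_n -> R) :
  \sum_(c < n) \prod_(j < n | (c < j)%N) x j * \prod_(j < n | (j < c)%N) y j
     * (x c - y c)
  = \prod_(j < n) x j - \prod_(j < n) y j.
Proof.
elim: n x y => [|n IH] x y; first by rewrite !big_ord0 subrr.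
rewrite !big_ord_recl/= [X in X * _ * _ + _]big_mkcond big_ord_recl/= mul1r.
rewrite [X in _ * X * _ + _]big_pred0 ?mulr1; last by move=> j; rewrite ltn0.
rewrite [X in _ + X = _](eq_bigr (fun c : 'I_n => y ord0 *
    (\prod_(j < n | (c < j)%N) x (lift ord0 j)
     * \prod_(j < n | (j < c)%N) y (lift ord0 j)
     * (x (lift ord0 c) - y (lift ord0 c))))); last first.
  move=> c _; rewrite [X in X * _ * _]big_mkcond [X in _ * X * _]big_mkcond.
  rewrite !big_ord_recl/= mul1r -!big_mkcond/=.
  have E1 (F : 'I_n -> R) : \prod_(j < n | (lift ord0 c < lift ord0 j)%N) F j
     = \prod_(j < n | (c < j)%N) F j by apply: eq_bigl => j; rewrite /= /bump/= !add1n ltnS.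
  have E2 (F : 'I_n -> R) : \prod_(j < n | (lift ord0 j < lift ord0 c)%N) F j
     = \prod_(j < n | (j < c)%N) F j by apply: eq_bigl => j; rewrite /= /bump/= !add1n ltnS.
  rewrite E1 E2; ring.
rewrite -mulr_sumr IH; ring.
Qed.

(** * q-binomial coefficients *)

Section QBinomial.
Variables (R : realType) (q : R).
Hypotheses (q_ge0 : 0 <= q) (q_lt1 : q < 1).

Lemma qpoch0 a : qpoch q a 0 = 1.
Proof. by rewrite /qpoch big_ord0. Qed.

Lemma qpochS a k : qpoch q a k.+1 = qpoch q a k * (1 - a * q ^+ k).
Proof. by rewrite /qpoch big_ord_recr. Qed.

Lemma expr_lt1 k : q ^+ k.+1 < 1.
Proof. by rewrite exprn_ilt1. Qed.

Lemma qpoch_gt0 a k : a < 1 -> 0 <= a -> 0 < qpoch q a k.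
Proof.
move=> a1 a0; apply: prodr_gt0 => i _; rewrite subr_gt0.
by apply: le_lt_trans a1; rewrite ler_piMr// exprn_ile1// ltW.
Qed.

Lemma qfact_neq0 k : qpoch q q k != 0.
Proof. by rewrite gt_eqF// qpoch_gt0. Qed.

Lemma onem_expr_neq0 k : 1 - q ^+ k.+1 != 0.
Proof. by rewrite gt_eqF// subr_gt0 expr_lt1. Qed.

Definition qbin (a b : nat) : R :=
  if (b <= a)%N then qpoch q q a / (qpoch q q b * qpoch q q (a - b)) else 0.

Lemma qbin0 a : qbin a 0 = 1.
Proof. by rewrite /qbin leq0n qpoch0 subn0 mul1r divff// qfact_neq0. Qed.

Lemma qbinn a : qbin a a = 1.
Proof. by rewrite /qbin leqnn subnn qpoch0 mulr1 divff// qfact_neq0. Qed.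

Lemma qbin_small a b : (a < b)%N -> qbin a b = 0.
Proof. by rewrite ltnNge /qbin => /negbTE ->. Qed.

Lemma qbin_ge0 a b : 0 <= qbin a b.
Proof.
rewrite /qbin; case: ifP => // _.
by rewrite divr_ge0 ?mulr_ge0// ltW// qpoch_gt0.
Qed.

Lemma qbin_addE b d : qbin (b + d) b = qpoch q q (b + d) / (qpoch q q b * qpoch q q d).
Proof. by rewrite /qbin leq_addr addKn. Qed.

Lemma qbin_absorb_diff a b :
  (1 - q ^+ b.+1) * qbin a b.+1 = (1 - q ^+ (a - b)) * qbin a b.
Proof.
case: (ltnP b a) => [ba|ab]; last first.
  rewrite qbin_small// mulr0; move: ab; rewrite -subn_eq0 => /eqP ->.
  by rewrite expr0 subrr mul0r.
have [d ->] : exists d, a = (b.+1 + d)%N by exists (a - b.+1)%N; lia.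
rewrite qbin_addE addSnnS qbin_addE addKn !qpochS -!exprS.
by field; rewrite !qfact_neq0 !onem_expr_neq0.
Qed.

Lemma qbin_absorb_upper a b :
  (1 - q ^+ (a.+1 - b)) * qbin a.+1 b = (1 - q ^+ a.+1) * qbin a b.
Proof.
case: (leqP b a) => [ba|ab]; last first.
  rewrite (qbin_small ab) mulr0; move: ab; rewrite -subn_eq0 => /eqP ->.
  by rewrite expr0 subrr mul0r.
have [d ->] : exists d, a = (b + d)%N by exists (a - b)%N; lia.
rewrite -addnS !qbin_addE addKn addnS !qpochS -!exprS.
by field; rewrite !qfact_neq0 !onem_expr_neq0.
Qed.

Lemma qbin_pascal a b : qbin a.+1 b.+1 = q ^+ b.+1 * qbin a b.+1 + qbin a b.
Proof.
have [ba|ab|->] := ltngtP b a.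
- have [d ->] : exists d, a = (b.+1 + d)%N by exists (a - b.+1)%N; lia.
  rewrite -addnS !qbin_addE (addSnnS b d) qbin_addE -!(addSnnS b d) addnS addSn.
  rewrite !qpochS -!exprS.
  rewrite !exprS exprD.
  by field; rewrite -!exprS !qfact_neq0 !onem_expr_neq0.
- by rewrite !qbin_small ?mulr0 ?addr0//; lia.
- by rewrite !qbinn qbin_small// mulr0 add0r.
Qed.

End QBinomial.

(** * The two factors of the vertex weight *)

Section Local.
Variables (R : realType) (n : nat) (q : R).
Hypotheses (q_ge0 : 0 <= q) (q_lt1 : q < 1).
Implicit Types (A B C D P : color_counts n) (a b : 'I_n -> nat) (c i j m : 'I_n).

Definition qlt a c : R := \prod_(j < n | (j < c)%N) q ^+ a j.
Definition qgt a c : R := \prod_(j < n | (c < j)%N) q ^+ a j.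

Lemma qlt_cinc D c j : qlt (cinc D c) j = qlt D j * (if (c < j)%N then q else 1).
Proof.
rewrite /qlt; under eq_bigr => k _ do rewrite ffunE exprD.
rewrite big_split/=; congr (_ * _); case: ifP => cj.
  rewrite (bigD1 c)//= eqxx big1 ?mulr1// => k /andP[_ /negbTE ->].
  by rewrite expr0.
rewrite big1// => k kj; case: eqVneq => [kc|]; last by rewrite expr0.
by rewrite -kc kj in cj.
Qed.

Lemma qgt_cinc D c j : qgt (cinc D c) j = qgt D j * (if (j < c)%N then q else 1).
Proof.
rewrite /qgt; under eq_bigr => k _ do rewrite ffunE exprD.
rewrite big_split/=; congr (_ * _); case: ifP => cj.
  rewrite (bigD1 c)//= eqxx big1 ?mulr1// => k /andP[_ /negbTE ->].
  by rewrite expr0.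
rewrite big1// => k kj; case: eqVneq => [kc|]; last by rewrite expr0.
by rewrite -kc kj in cj.
Qed.

Lemma qcsum a c : q ^+ csum a = qlt a c * q ^+ a c * qgt a c.
Proof. by rewrite /csum expr_sum (big_ord_split3 c). Qed.

Lemma telescope_qgt a : \sum_(c < n) qgt a c * (1 - q ^+ a c) = 1 - q ^+ csum a.
Proof.
have := telescope_prod (fun j => q ^+ a j) (fun=> 1).
rewrite -expr_sum big1_eq => /(congr1 -%R); rewrite opprB => <-.
rewrite -sumrN; apply: eq_bigr => c _; rewrite big1_eq mulr1 -mulrN opprB.
by [].
Qed.

Lemma telescope_qlt a : \sum_(c < n) qlt a c * (1 - q ^+ a c) = 1 - q ^+ csum a.
Proof.
have := telescope_prod (fun=> 1) (fun j => q ^+ a j).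
by rewrite -expr_sum big1_eq => <-; apply: eq_bigr => c _; rewrite big1_eq mul1r.
Qed.

Lemma telescope_qlt_below a i :
  \sum_(c < n | (c < i)%N) qlt a c * (1 - q ^+ a c) = 1 - qlt a i.
Proof.
pose a' := fun j : 'I_n => if (j < i)%N then a j else 0%N.
have := telescope_qlt a'; have -> : q ^+ csum a' = qlt a i.
  rewrite /csum expr_sum /qlt [RHS]big_mkcond; apply: eq_bigr => j _.
  by rewrite /a'; case: ifP.
move=> <-; rewrite big_mkcond; apply: eq_bigr => c _; rewrite {2}/a'.
case: ifP => [ci|]; last by rewrite expr0 subrr mulr0.
congr (_ * _); apply: eq_bigr => j jc; rewrite /a' ifT//.
exact: ltn_trans jc ci.
Qed.

Lemma telescope_qgt_above a i :
  \sum_(c < n | (i < c)%N) qgt a c * (1 - q ^+ a c) = 1 - qgt a i.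
Proof.
pose a' := fun j : 'I_n => if (i < j)%N then a j else 0%N.
have := telescope_qgt a'; have -> : q ^+ csum a' = qgt a i.
  rewrite /csum expr_sum /qgt [RHS]big_mkcond; apply: eq_bigr => j _.
  by rewrite /a'; case: ifP.
move=> <-; rewrite big_mkcond; apply: eq_bigr => c _; rewrite {2}/a'.
case: ifP => [ci|]; last by rewrite expr0 subrr mulr0.
congr (_ * _); apply: eq_bigr => j jc; rewrite /a' ifT//.
exact: ltn_trans ci jc.
Qed.

Lemma telescope_qgt_qlt a b i :
  \sum_(c < n | (c < i)%N) qgt a c * qlt b c * (q ^+ a c - q ^+ b c)
  = q ^+ csum a - q ^+ a i * qgt a i * qlt b i.
Proof.
(* [b'] agrees with [b] below [i] and with [a] from [i] on, so the summands of [telescope_prod] with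
   c >= i vanish. *)
pose b' := fun j : 'I_n => if (j < i)%N then b j else a j.
have := telescope_prod (fun j => q ^+ a j) (fun j => q ^+ b' j).
rewrite -expr_sum (big_ord_split3 i (fun j => q ^+ b' j)).
have bi : b' i = a i by rewrite /b' ltnn.
have blt : \prod_(j < n | (j < i)%N) q ^+ b' j = qlt b i.
  by apply: eq_bigr => j ji; rewrite /b' ji.
have bgt : \prod_(j < n | (i < j)%N) q ^+ b' j = qgt a i.
  by apply: eq_bigr => j ji; rewrite /b' ltnNge (ltnW ji).
rewrite bi blt bgt => E.
transitivity (q ^+ csum a - qlt b i * q ^+ a i * qgt a i); last by ring.
rewrite -{}E big_mkcond; apply: eq_bigr => c _.
have -> : b' c = if (c < i)%N then b c else a c by [].
case: ifP => ci; last by rewrite subrr mulr0.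
congr (_ * _ * _); apply: eq_bigr => j jc; rewrite /b' ifT//.
exact: ltn_trans jc ci.
Qed.

(* A m stands for +oo, and q ^ oo = 0. *)
Definition qinf m a c : R := if c == m then 0 else q ^+ a c.

(* The weight of drawing D out of A; the case D j > A j has weight 0 by qbin. *)
Definition lower (u : R) m A D : R :=
  u ^+ csum D / qpoch q q (D m)
  * \prod_(j < n | (m < j)%N) (qbin q (A j) (D j) * qlt D j ^+ (A j - D j)).

(** * Drawing D out of the vertical line *)

Section Column.
Variables (u : R) (m : 'I_n).
Local Notation low := (lower u m).

Definition above D := forall j, (j < m)%N -> D j = 0%N.

Lemma above_qlt D c : above D -> (c <= m)%N -> qlt D c = 1.
Proof.
by move=> Dm cm; apply: big1 => j jc; rewrite Dm// (leq_trans jc).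
Qed.

Lemma lower_cinc_m A D : low (cinc A m) D = low A D.
Proof.
congr (_ * _); apply: eq_bigr => j mj; rewrite ffunE.
by rewrite -val_eqE/= gtn_eqF// addn0.
Qed.

Lemma big_ord_split3_above c (F : 'I_n -> R) : (m < c)%N ->
  \prod_(j < n | (m < j)%N) F j
  = \prod_(j < n | (m < j)%N && (j < c)%N) F j * F c
    * \prod_(j < n | (c < j)%N) F j.
Proof.
move=> mc; rewrite big_mkcond (big_ord_split3 c) mc; congr (_ * _ * _).
  by rewrite -big_mkcondl.
by apply: eq_bigr => j cj; rewrite (ltn_trans mc cj).
Qed.

(** Isolates color c. Raising A_c changes only the factor of color c, whereas raising D_c also
    multiplies the factor of each color j > c by q^(A_j - D_j); these powers make up [G]. *)
Lemma lower_split A D c (G := qgt (fun j => (A j - D j)%N) c)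
    (F := fun k l : nat => qbin q k l * qlt D c ^+ (k - l)) : (m < c)%N ->
  exists K : R, [/\ low A D = K * F (A c) (D c),
    low (cinc A c) D = K * F (A c).+1 (D c),
    low A (cinc D c) = u * K * G * F (A c) (D c).+1 &
    low (cinc A c) (cinc D c) = u * K * G * F (A c).+1 (D c).+1].
Proof.
move=> mc; pose f A D j := qbin q (A j) (D j) * qlt D j ^+ (A j - D j).
pose lo (A D : color_counts n) := \prod_(j < n | (m < j)%N && (j < c)%N) f A D j.
pose hi (A D : color_counts n) := \prod_(j < n | (c < j)%N) f A D j.
have incD j (x : color_counts n) : j != c -> cinc x c j = x j.
  by move=> jc; rewrite ffunE (negbTE jc) addn0.
have ltc j : (j < c)%N -> j != c by rewrite -val_eqE/=; case: ltngtP.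
have gtc j : (c < j)%N -> j != c by rewrite -val_eqE/=; case: ltngtP.
have loA A' D' : lo (cinc A' c) D' = lo A' D'.
  by apply: eq_bigr => j /andP[_ /ltc jc]; rewrite /f incD.
have hiA A' D' : hi (cinc A' c) D' = hi A' D'.
  by apply: eq_bigr => j /gtc jc; rewrite /f incD.
have loD A' D' : lo A' (cinc D' c) = lo A' D'.
  apply: eq_bigr => j /andP[_ jc]; rewrite /f incD ?ltc// qlt_cinc.
  by rewrite ltnNge (ltnW jc)/= mulr1.
have hiD : hi A (cinc D c) = hi A D * G.
  rewrite /G /qgt -big_split; apply: eq_bigr => j cj.
  by rewrite /f incD ?gtc// qlt_cinc cj exprMn mulrA.
exists (u ^+ csum D / qpoch q q (D m) * lo A D * hi A D).
have lowE A' D' : low A' D'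
    = u ^+ csum D' / qpoch q q (D' m) * (lo A' D' * f A' D' c * hi A' D').
  by rewrite /lower (big_ord_split3_above _ mc).
have mE x : cinc x c m = x m by rewrite ffunE -val_eqE/= ltn_eqF// addn0.
rewrite !lowE !loA !hiA !loD !hiD !csum_cinc mE !exprS /f !cincE.
rewrite !qlt_cinc ltnn mulr1 /F.
by split; ring.
Qed.

(** q-Pascal in color c. For c = m the supply is infinite and q-Pascal becomes 1 = q^(D_m + 1) + (1
    - q^(D_m + 1)), whose second part cancels the last factor of (q;q)_(D_m + 1). *)
Lemma lower_cinc A D c : above D -> (m <= c)%N ->
  low (cinc A c) (cinc D c)
  = qlt D c * q ^+ (D c).+1 * low A (cinc D c)
    + u * qgt (fun j => (A j - D j)%N) c * low A D.
Proof.
move=> Dm; rewrite leq_eqVlt => /predU1P[/val_inj <-|mc].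
  rewrite lower_cinc_m /lower csum_cinc cincE qpochS -exprS exprS.
  rewrite above_qlt// mul1r.
  rewrite (eq_bigr (fun j => (qbin q (A j) (D j) * qlt D j ^+ (A j - D j))
      * q ^+ (A j - D j))); last first.
    move=> j mj; rewrite qlt_cinc mj exprMn ffunE -val_eqE/= gtn_eqF// addn0.
    by rewrite mulrA.
  rewrite big_split/= -/(qgt (fun j => (A j - D j)%N) m).
  by field; rewrite qfact_neq0// onem_expr_neq0.
have [K [-> _ -> ->]] := lower_split A D mc.
rewrite subSS qbin_pascal//.
have [DA|AD] := ltnP (D c) (A c); last first.
  by rewrite qbin_small//; ring.
have -> : (A c - D c = (A c - (D c).+1).+1)%N by lia.
rewrite !exprS; ring.
Qed.

(** Completes [lower_cinc], which only reaches labels containing color c. *)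
Lemma lower_cinc0 A D c : above D -> D c = 0%N ->
  low (cinc A c) D = qlt D c * low A D.
Proof.
move=> Dm Dc; have [mc|cm] := ltnP m c; last first.
  rewrite (above_qlt Dm cm) mul1r; congr (_ * _); apply: eq_bigr => j mj.
  by rewrite ffunE -val_eqE/= gtn_eqF ?addn0// (leq_ltn_trans cm).
have [K [-> -> _ _]] := lower_split A D mc.
by rewrite Dc !qbin0// !subn0 exprS; ring.
Qed.

(** The absorption identity [qbin_absorb_diff] in color c; the infinite supply of color m enters as
    q^oo = 0. *)
Lemma lower_absorb A D c : above D -> (m <= c)%N ->
  qlt D c * (1 - q ^+ (D c).+1) * low A (cinc D c)
  = u * qgt (fun j => (A j - D j)%N) c
    * (1 - qinf m (fun j => (A j - D j)%N) c) * low A D.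
Proof.
move=> Dm; rewrite leq_eqVlt => /predU1P[/val_inj mc|mc].
  have := lower_cinc A Dm (leqnn m); rewrite lower_cinc_m -mc /qinf eqxx subr0.
  rewrite above_qlt// !mul1r => E.
  by rewrite mulrBl mul1r {1}E; ring.
have [K [-> _ -> _]] := lower_split A D mc.
rewrite /qinf ifF/=; last by rewrite -val_eqE/= gtn_eqF.
have := qbin_absorb_diff q_ge0 q_lt1 (A c) (D c).
have [DA|AD] := ltnP (D c) (A c); last first.
  rewrite (qbin_small _ (b := (D c).+1))// => E.
  transitivity (u * K * qgt (fun j => (A j - D j)%N) c * qlt D c ^+ (A c - D c)
     * ((1 - q ^+ (A c - D c)) * qbin q (A c) (D c))); last by ring.
  by rewrite -E; ring.
move=> E.
transitivity (u * K * qgt (fun j => (A j - D j)%N) c * qlt D c ^+ (A c - D c)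
     * ((1 - q ^+ (A c - D c)) * qbin q (A c) (D c))); last by ring.
rewrite -E; have -> : (A c - D c = (A c - (D c).+1).+1)%N by lia.
rewrite !exprS; ring.
Qed.

Lemma lower_eq0 A D j : (m < j)%N -> (A j < D j)%N -> low A D = 0.
Proof.
by move=> mj Aj; rewrite /lower (bigD1 j)//= qbin_small// mul0r mul0r mulr0.
Qed.

(** The color part (1 - q^(A_c)) q^(A_(c+1) + ... + A_n) of a hop rate, read on the vertical line
    instead of at a site. *)
Definition qbeta A c : R := (1 - qinf m A c) * qgt A c.

Lemma qgt_cinc_same A c : qgt (cinc A c) c = qgt A c.
Proof. by rewrite qgt_cinc ltnn mulr1. Qed.

Lemma qlt_cinc_same A c : qlt (cinc A c) c = qlt A c.
Proof. by rewrite qlt_cinc ltnn mulr1. Qed.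

Lemma lower_neq0 A D j : low A D != 0 -> (m < j)%N -> (D j <= A j)%N.
Proof. by move=> + mj; apply: contraNT; rewrite -ltnNge => /(lower_eq0 mj) ->. Qed.

(** A nonzero weight makes the truncated differences A_j - D_j exact, so exponents can be added. The
    proofs using it first dispose of weight 0. *)
Lemma qgt_sub A D a b c : low A D != 0 -> (m <= c)%N ->
  (forall j, (c < j)%N -> (a j + D j = A j + b j)%N) ->
  qgt a c = qgt b c * qgt (fun j => (A j - D j)%N) c.
Proof.
move=> AD mc abc; rewrite /qgt -big_split/=; apply: eq_bigr => j cj.
rewrite -exprD; congr (_ ^+ _).
have := lower_neq0 AD (leq_ltn_trans mc cj); have := abc _ cj; lia.
Qed.

(** Shaped for a sum over c: the first term on the right telescopes, over all c, to q^|P| - q^|D|,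
    and the second is absorbed by shifting P to P + e_c in the weight of the split. *)
Lemma lower_cdec A D P C c : above D ->
  (forall j, (m < j)%N -> (C j + D j = A j + P j)%N) ->
  (if (m <= c)%N && (0 < D c)%N then u * qbeta (cinc C c) c * low A (cdec D c) else 0)
  = qgt P c * qlt D c * (q ^+ P c - q ^+ D c) * low A D
    + qgt P c * (1 - q ^+ P c) * low (cinc A c) D.
Proof.
move=> Dm CDAP; case: ifP => [/andP[mc Dc]|cD]; last first.
  have Dc : D c = 0%N.
    by case: (leqP m c) cD => [_ /= /negbT|/Dm//]; rewrite -leqNgt; lia.
  by rewrite (lower_cinc0 _ Dm Dc) Dc expr0; ring.
have := cdecK Dc; set D' := cdec D c => DE.
have D'm : above D'.
  by move=> j jm; have := Dm j jm; rewrite -DE ffunE => /eqP; rewrite addn_eq0 => /andP[/eqP].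
have := lower_absorb A D'm mc; have := lower_cinc A D'm mc.
rewrite -{1}DE qlt_cinc_same -DE cincE.
set x := low A D'; set y := low A _; set z := low (cinc A c) _.
set G := qgt (fun j => _) c; move=> -> E.
transitivity (u * G * x * (1 - q ^+ P c * qinf m (fun j => (A j - D' j)%N) c) * qgt P c); last first.
  transitivity (qgt P c * (q ^+ P c * (qlt D' c * (1 - q ^+ (D' c).+1) * y)
     + (1 - q ^+ P c) * (u * G * x))); last by ring.
  by rewrite E; ring.
have [->|x0] := eqVneq x 0; first by ring.
rewrite /qbeta qgt_cinc_same.
have CE j : (c < j)%N -> (C j + D' j = A j + P j)%N.
  move=> cj; have := CDAP j (leq_ltn_trans mc cj); rewrite -DE ffunE.
  by rewrite -val_eqE/= gtn_eqF// addn0.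
rewrite (qgt_sub x0 mc CE) -/G /qinf; case: eqVneq => [cm|cm].
  by ring.
have mc' : (m < c)%N by rewrite ltn_neqAle mc andbT eq_sym.
rewrite cincE -exprD.
have -> : (C c).+1 = (P c + (A c - D' c))%N.
  have := lower_neq0 x0 mc'; have := CDAP c mc'; rewrite -DE cincE; lia.
by ring.
Qed.

(** The counterpart of [lower_cdec] for the color of a deposited particle, which C and D together
    hold in excess of A and P. *)
Lemma lower_cdec_same A D P C c : above D -> (m < c)%N ->
  (C c + D c = (A c + P c).+1)%N ->
  (forall j, (c < j)%N -> (C j + D j = A j + P j)%N) ->
  (if (0 < D c)%N then u * (q ^+ C c * qgt C c) * low A (cdec D c) else 0)
  = q ^+ P c * qgt P c * (low (cinc A c) D - qlt D c * low A D).
Proof.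
move=> Dm mc CDc CDAP; case: ifP => [Dc|/negbT cD]; last first.
  have Dc : D c = 0%N by move: cD; rewrite -leqNgt leqn0 => /eqP.
  by rewrite (lower_cinc0 _ Dm Dc); ring.
have := cdecK Dc; set D' := cdec D c => DE.
have D'm : above D'.
  by move=> j jm; have := Dm j jm; rewrite -DE ffunE => /eqP; rewrite addn_eq0 => /andP[/eqP].
have := lower_absorb A D'm (ltnW mc); have := lower_cinc A D'm (ltnW mc).
rewrite -DE qlt_cinc_same.
set x := low A D'; set y := low A _; set z := low (cinc A c) _.
set G := qgt (fun j => _) c; move=> -> E.
transitivity (u * G * x * (q ^+ P c * qinf m (fun j => (A j - D' j)%N) c) * qgt P c); last first.
  transitivity (q ^+ P c * qgt P c *
     (u * G * x - qlt D' c * (1 - q ^+ (D' c).+1) * y)); last by ring.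
  by rewrite E; ring.
have [->|x0] := eqVneq x 0; first by ring.
have CE j : (c < j)%N -> (C j + D' j = A j + P j)%N.
  move=> cj; have := CDAP j cj; rewrite -DE ffunE.
  by rewrite -val_eqE/= gtn_eqF// addn0.
rewrite (qgt_sub x0 (ltnW mc) CE) -/G /qinf -val_eqE/= gtn_eqF// -exprD.
have -> : C c = (P c + (A c - D' c))%N.
  have := lower_neq0 x0 mc; have := CDc; rewrite -DE cincE; lia.
by ring.
Qed.

(** For i > m, [lower_cinc] and [lower_absorb] contribute 1 - q^(D_i + 1) and q^(D_i + 1) (1 -
    q^(A_i - 1 - D_i)), which add up to 1 - q^(A_i). *)
Lemma lower_cinc_r A D i : u != 0 -> above D -> (m <= i)%N ->
  low A (cinc D i) * ((1 - q ^+ (D i).+1) * qgt D i) / u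
  = qbeta A i * low (cdec A i) D.
Proof.
move=> u0 Dm; rewrite leq_eqVlt => /predU1P[/val_inj mi|mi].
  have := lower_absorb A Dm (leqnn m).
  rewrite -mi above_qlt// mul1r /qinf eqxx subr0 mulr1 => E.
  transitivity ((1 - q ^+ (D m).+1) * low A (cinc D m) * qgt D m / u); first by ring.
  have -> : low (cdec A m) D = low A D.
    congr (_ * _); apply: eq_bigr => j mj; rewrite ffunE.
    by rewrite -val_eqE/= gtn_eqF// subn0.
  have [x0|x0] := eqVneq (low A D) 0; first by rewrite E x0; ring.
  rewrite {}E /qbeta /qinf eqxx (@qgt_sub A D A D m x0)//.
  by field.
have [Ai|Ai] := posnP (A i).
  rewrite /qbeta /qinf -val_eqE/= gtn_eqF// Ai expr0 subrr !mul0r.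
  by rewrite (lower_eq0 mi) ?mul0r// Ai cincE.
have := cdecK Ai; set X := cdec A i => AE.
have := lower_absorb X Dm (ltnW mi); have := lower_cinc X Dm (ltnW mi).
rewrite AE; set x := low X D; set y := low X _; set z := low A _.
set G := qgt (fun j => _) i; move=> -> E.
transitivity ((q ^+ (D i).+1 * (qlt D i * (1 - q ^+ (D i).+1) * y)
   + (1 - q ^+ (D i).+1) * (u * G * x)) * qgt D i / u); first by ring.
rewrite {}E.
have [->|x0] := eqVneq x 0; first by ring.
rewrite -AE /qbeta qgt_cinc_same /qinf -val_eqE/= gtn_eqF// cincE.
rewrite (@qgt_sub X D X D i x0 (ltnW mi)) => [|j _]; last by lia.
have -> : (X i).+1 = ((D i).+1 + (X i - D i))%N.
  by have := lower_neq0 x0 mi; lia.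
by rewrite exprD -/G; field.
Qed.

End Column.

(** * Splitting B into particles going up and particles joining the line *)

Section SplitWeight.
Variable t : R.

Definition csub B P : color_counts n := [ffun j => (B j - P j)%N].
Definition cplus A B : color_counts n := [ffun j => (A j + B j)%N].

(* The weight of sending P of the B particles straight up. *)
Definition splitw B P : R :=
  qpoch q t (csum P) *
  \prod_(j < n) (qbin q (B j) (P j) * t ^+ (B j - P j) * qlt (csub B P) j ^+ P j).

Lemma csub_cinc2 B P i : csub (cinc B i) (cinc P i) = csub B P.
Proof. by apply/ffunP => j; rewrite !ffunE subnDr. Qed.

Lemma splitw_eq0 B P j : (B j < P j)%N -> splitw B P = 0.
Proof. by move=> BP; rewrite /splitw (bigD1 j)//= qbin_small// !mul0r mulr0. Qed.

Lemma splitw_le B P : splitw B P != 0 -> forall j, (P j <= B j)%N.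
Proof. by move=> w0 j; rewrite leqNgt; apply: contraNN w0 => /splitw_eq0 ->. Qed.

(** Isolates color i. Raising B_i - P_i multiplies the factors of the colors above i by [qgt P i];
    in the last relation, where B_i - P_i drops, this factor stays on the left because it may vanish
    when q = 0. *)
Lemma splitw_split B P i (F := fun b p d r : nat =>
    qbin q b p * t ^+ d * qlt (csub B P) i ^+ r) :
  exists K : R, [/\ splitw B P = K * F (B i) (P i) (B i - P i)%N (P i),
    splitw (cinc B i) (cinc P i)
      = K * (1 - t * q ^+ csum P) * F (B i).+1 (P i).+1 (B i - P i)%N (P i).+1,
    (P i <= B i)%N ->
      splitw (cinc B i) P
      = K * qgt P i * F (B i).+1 (P i) (B i - P i).+1 (P i) &
    (P i < B i)%N -> splitw B (cinc P i) * qgt P i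
      = K * (1 - t * q ^+ csum P) * F (B i) (P i).+1 (B i - P i).-1 (P i).+1].
Proof.
pose f B P j := qbin q (B j) (P j) * t ^+ (B j - P j) * qlt (csub B P) j ^+ P j.
pose lo B P := \prod_(j < n | (j < i)%N) f B P j.
pose hi B P := \prod_(j < n | (i < j)%N) f B P j.
have wE B' P' : splitw B' P' = qpoch q t (csum P') * (lo B' P' * f B' P' i * hi B' P').
  by rewrite /splitw (big_ord_split3 i).
have incN j (x : color_counts n) : j != i -> cinc x i j = x j.
  by move=> jc; rewrite ffunE (negbTE jc) addn0.
have lti j : (j < i)%N -> j != i by rewrite -val_eqE/=; case: ltngtP.
have gti j : (i < j)%N -> j != i by rewrite -val_eqE/=; case: ltngtP.
have subNP B' P' j : (j <= i)%N ->
    qlt (csub B' (cinc P' i)) j = qlt (csub B' P') j.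
  move=> ji; apply: eq_bigr => k kj; rewrite !ffunE -val_eqE/= ltn_eqF ?addn0//.
  exact: leq_trans kj ji.
have subNB B' P' j : (j <= i)%N ->
    qlt (csub (cinc B' i) P') j = qlt (csub B' P') j.
  move=> ji; apply: eq_bigr => k kj; rewrite !ffunE -val_eqE/= ltn_eqF ?addn0//.
  exact: leq_trans kj ji.
have loP B' P' : lo B' (cinc P' i) = lo B' P'.
  by apply: eq_bigr => j ji; rewrite /f incN ?lti// subNP// ltnW.
have loB B' P' : lo (cinc B' i) P' = lo B' P'.
  by apply: eq_bigr => j ji; rewrite /f incN ?lti// subNB// ltnW.
have hi2 B' P' : hi (cinc B' i) (cinc P' i) = hi B' P'.
  by apply: eq_bigr => j ji; rewrite /f !incN ?gti// csub_cinc2.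
have hiB B' P' : (P' i <= B' i)%N -> hi (cinc B' i) P' = hi B' P' * qgt P' i.
  move=> PB; rewrite /qgt -big_split/=; apply: eq_bigr => j ij.
  rewrite /f incN ?gti//.
  have -> : csub (cinc B' i) P' = cinc (csub B' P') i.
    by apply/ffunP => k; rewrite !ffunE; case: eqVneq => [->|_]; lia.
  by rewrite qlt_cinc ij exprMn mulrA.
exists (qpoch q t (csum P) * (lo B P * hi B P)).
rewrite !wE csum_cinc qpochS.
split.
- by rewrite /f /F; ring.
- rewrite loP loB hi2 /f !cincE subSS csub_cinc2 /F; ring.
- by move=> PB; rewrite hiB// loB /f cincE subNB// subSn// /F; ring.
- move=> PB; have := hiB B (cinc P i); rewrite cincE hi2 => /(_ PB) ->.
  rewrite loP /f cincE subNP// qgt_cinc_same subnS /F; ring.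
Qed.

(** q-Pascal in color i: the added particle either joins the vertical line with B - P (first term)
    or goes straight up (second term). *)
Lemma splitw_cinc2 B P i :
  splitw (cinc B i) (cinc P i)
  = t * q ^+ (P i).+1 * qgt P i * splitw B (cinc P i)
    + (1 - t * q ^+ csum P) * qlt (csub B P) i * splitw B P.
Proof.
have [K [-> -> _]] := splitw_split B P i; rewrite qbin_pascal//.
have [PB /(_ isT) E|BP _] := ltnP (P i) (B i).
  rewrite -[t * _ * qgt P i * _]mulrA [qgt P i * _]mulrC E.
  have -> : (B i - P i = (B i - P i).-1.+1)%N by lia.
  by rewrite /= !exprS; ring.
rewrite (splitw_eq0 (B := B) (P := cinc P i) (j := i)) ?cincE//.
by rewrite qbin_small// !exprS; ring.
Qed.

Lemma splitw_cinc0 B P i : P i = 0%N ->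
  splitw (cinc B i) P = t * q ^+ P i * qgt P i * splitw B P.
Proof.
move=> Pi; have [K [-> _ + _]] := splitw_split B P i.
by rewrite Pi => -> //; rewrite !qbin0// !exprS subn0; ring.
Qed.

(** Absorption for one particle moving between P and B - P. The factor t on the left keeps the
    identity valid at t = 0. *)
Lemma splitw_shift B P i :
  t * (splitw B (cinc P i) * qgt P i * (1 - q ^+ (P i).+1))
  = splitw B P * (1 - t * q ^+ csum P) * qlt (csub B P) i
    * (1 - q ^+ csub B P i).
Proof.
have [K [-> _ _]] := splitw_split B P i; rewrite [csub B P i]ffunE.
have E := qbin_absorb_diff q_ge0 q_lt1 (B i) (P i).
have [PB /(_ isT) ->|BP _] := ltnP (P i) (B i).
  transitivity (K * (1 - t * q ^+ csum P) * t ^+ (B i - P i).-1.+1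
     * qlt (csub B P) i ^+ (P i).+1
     * ((1 - q ^+ (P i).+1) * qbin q (B i) (P i).+1)); first by rewrite !exprS; ring.
  rewrite E; have -> : (B i - P i = (B i - P i).-1.+1)%N by lia.
  by rewrite !exprS; ring.
rewrite (splitw_eq0 (B := B) (P := cinc P i) (j := i)) ?cincE//.
move: BP; rewrite -subn_eq0 => /eqP ->; rewrite expr0; ring.
Qed.

Lemma splitw_cdec B P c : (forall j, (P j <= B j)%N) ->
  t * ((1 - q ^+ B c) * qgt P c * splitw (cdec B c) P)
  = (1 - q ^+ csub B P c) * splitw B P.
Proof.
move=> PB; have [Bc|Bc] := posnP (B c).
  by rewrite ffunE Bc sub0n expr0; ring.
have := cdecK Bc; set B' := cdec B c => BE; rewrite -BE [csub _ _ c]ffunE cincE.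
have [K [-> _]] := splitw_split B' P c.
have [PB' /(_ isT) -> _|BP _ _] := leqP (P c) (B' c).
  have E := qbin_absorb_upper q_ge0 q_lt1 (B' c) (P c).
  transitivity (K * t ^+ (B' c - P c).+1 * qlt (csub B' P) c ^+ P c * qgt P c
    * ((1 - q ^+ (B' c).+1) * qbin q (B' c) (P c))); first by rewrite !exprS; ring.
  by rewrite -E subSn// !exprS; ring.
have := BP; rewrite -subn_eq0 => /eqP ->.
by rewrite qbin_small// expr0; ring.
Qed.

(* Unlike splitw_shift and splitw_cdec this does not divide by t. *)
Lemma splitw_cdec_cinc B P c : (forall j, (P j <= B j)%N) ->
  splitw B (cinc P c) * (1 - q ^+ (P c).+1)
  = (1 - q ^+ B c) * (1 - t * q ^+ csum P) * qlt (csub B P) c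
    * splitw (cdec B c) P.
Proof.
move=> PB; have [Bc|Bc] := posnP (B c).
  rewrite (splitw_eq0 (B := B) (P := cinc P c) (j := c)) ?cincE ?Bc//.
  by rewrite expr0; ring.
have := cdecK Bc; set B' := cdec B c => BE; rewrite -BE cincE.
have -> : qlt (csub (cinc B' c) P) c = qlt (csub B' P) c.
  by apply: eq_bigr => k kj; rewrite !ffunE -val_eqE/= ltn_eqF ?addn0.
have [K [-> -> _ _]] := splitw_split B' P c.
have E : (1 - q ^+ (P c).+1) * qbin q (B' c).+1 (P c).+1
       = (1 - q ^+ (B' c).+1) * qbin q (B' c) (P c).
  by rewrite qbin_absorb_diff// qbin_absorb_upper.
rewrite mulrC -mulrA [RHS]mulrC.
transitivity (K * (1 - t * q ^+ csum P) * t ^+ (B' c - P c)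
   * qlt (csub B' P) c ^+ (P c).+1
   * ((1 - q ^+ (P c).+1) * qbin q (B' c).+1 (P c).+1)); first by ring.
by rewrite E !exprS; ring.
Qed.

Lemma splitw_t0 B P : t = 0 -> splitw B P != 0 -> P = B.
Proof.
move=> t0 w0; apply/ffunP => j; apply/eqP; rewrite eqn_leq (splitw_le w0)/=.
apply: contraNT w0; rewrite -ltnNge -subn_gt0 => BP.
rewrite /splitw (bigD1 j)//= t0; case: (B j - P j)%N BP => // k _.
by rewrite exprS; apply/eqP; ring.
Qed.

(** Put b = B - P. For t != 0 every summand is a multiple of [splitw B P], and the two sums
    telescope to (1 - q^|b|)/t and (1 - t q^|P|)(1 - q^|b|)/t times it. For t = 0 only full splits
    survive and the sides agree term by term. *)
Lemma splitw_balance B P : (forall j, (P j <= B j)%N) ->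
  q ^+ csum B * splitw B P
    + \sum_(c < n) (1 - q ^+ B c) * qgt B c * splitw (cdec B c) P
  = q ^+ csum P * splitw B P
    + \sum_(c < n) splitw B (cinc P c) * qgt P c * (1 - q ^+ (P c).+1).
Proof.
move=> PB; pose b := csub B P.
have qB : q ^+ csum B = q ^+ csum b * q ^+ csum P.
  rewrite -exprD /csum -big_split/=; congr (_ ^+ _); apply: eq_bigr => j _.
  by rewrite ffunE subnK.
have gB c : qgt B c = qgt b c * qgt P c.
  rewrite /qgt -big_split/=; apply: eq_bigr => j _.
  by rewrite -exprD ffunE subnK.
(* Both sums are written through [z] without dividing by t, so that this form serves t = 0 as
   well. *)
pose z c := (1 - q ^+ B c) * qgt P c * splitw (cdec B c) P.
have zE c : t * z c = (1 - q ^+ b c) * splitw B P by rewrite splitw_cdec.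
rewrite (eq_bigr (fun c => z c * qgt b c)); last first.
  by move=> c _; rewrite gB /z; ring.
rewrite [X in _ = _ + X](eq_bigr (fun c => z c * (1 - t * q ^+ csum P) * qlt b c)); last first.
  by move=> c _; rewrite mulrAC splitw_cdec_cinc// /z; ring.
have [t0|t0] := eqVneq t 0; last first.
  have {}zE c : z c = t^-1 * ((1 - q ^+ b c) * splitw B P) by rewrite -zE mulKf.
  have g := telescope_qgt b; have l := telescope_qlt b.
  rewrite (eq_bigr (fun c => t^-1 * splitw B P * (qgt b c * (1 - q ^+ b c)))); last first.
    by move=> c _; rewrite zE; ring.
  rewrite [X in _ = _ + X](eq_bigr (fun c => t^-1 * splitw B P * (1 - t * q ^+ csum P)
      * (qlt b c * (1 - q ^+ b c)))); last first.
    by move=> c _; rewrite zE; ring.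
  by rewrite -!mulr_sumr g l qB; field.
congr (_ + _).
  have [->|/(splitw_t0 t0) ->//] := eqVneq (splitw B P) 0.
  by rewrite !mulr0.
(* A nonzero [z c] forces P = B - e_c; then b is supported on color c, and both [qgt b c] and
   [qlt b c] are 1. *)
apply: eq_bigr => c _; rewrite t0 mul0r subr0 mulr1.
have [->|z0] := eqVneq (z c) 0; first by rewrite !mul0r.
have w0 : splitw (cdec B c) P != 0.
  by apply: contraNneq z0 => w0; rewrite /z w0 mulr0.
have PE := splitw_t0 t0 w0.
have b0 j : j != c -> q ^+ b j = 1.
  by move=> /negbTE jc; rewrite /b PE !ffunE jc subn0 subnn expr0.
congr (_ * _); rewrite /qgt /qlt !big1// => j jc; apply: b0.
  by rewrite -val_eqE/= ltn_eqF.
by rewrite -val_eqE/= gtn_eqF.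
Qed.

Definition box B : set (color_counts n) := [set P | forall j, (P j <= B j)%N].

Lemma finite_box B : finite_set (box B).
Proof.
pose f (g : {ffun 'I_n -> 'I_(csum B).+1}) : color_counts n := [ffun j => val (g j)].
apply: (@sub_finite_set _ _ (f @` setT)); last exact/finite_image/finite_finset.
move=> P PB; exists [ffun j => inord (P j)] => //.
apply/ffunP => j; rewrite !ffunE /= inordK// ltnS (leq_trans (PB j))//.
by rewrite /csum (bigD1 j)//= leq_addr.
Qed.

Lemma fsum_finite S (F : color_counts n -> R) : finite_set S ->
  (forall P, F P != 0 -> S P) ->
  \sum_(P \in [set: color_counts n]) F P = \sum_(P \in S) F P.
Proof.
move=> _ FS; apply/esym/fsbig_widen => // P [_ SP] /=.
by apply/eqP; apply: contra_notT SP => /FS.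
Qed.

Lemma fsum_cinc c (F : color_counts n -> R) : (forall P, P c = 0%N -> F P = 0) ->
  \sum_(P \in [set: color_counts n]) F P
  = \sum_(P \in [set: color_counts n]) F (cinc P c).
Proof.
move=> F0; transitivity (\sum_(P \in [set P : color_counts n | (0 < P c)%N]) F P).
  apply/esym/fsbig_widen => // P [_ /= /negP]; rewrite -leqNgt leqn0 => /eqP.
  exact: F0.
apply: (@reindex_fsbig _ _ _ _ _ (fun P => cinc P c)); split => /=.
- by move=> P _ /=; rewrite cincE.
- by move=> P P' _ _; exact: (can_inj (@cincK n c)).
- by move=> P /= Pc; exists (cdec P c) => //; exact: cdecK.
Qed.

(** Summing over all labels makes the shift P to P + e_c a plain reindexing; the weight confines the
    support to the finite [box B]. *)
Definition splitsum B (f : color_counts n -> R) : R :=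
  \sum_(P \in [set: color_counts n]) splitw B P * f P.

Lemma splitsum_box B S f : finite_set S -> box B `<=` S ->
  splitsum B f = \sum_(P \in S) splitw B P * f P.
Proof.
move=> Sfin BS; apply: fsum_finite => // P; rewrite mulf_eq0 negb_or => /andP[].
by move=> /splitw_le PB _; exact: BS.
Qed.

Lemma eq_splitsum B f g : (forall P, box B P -> f P = g P) ->
  splitsum B f = splitsum B g.
Proof.
move=> fg; rewrite !(splitsum_box _ (finite_box B))//.
by apply: eq_fsbigr => P; rewrite inE => /fg ->.
Qed.

Lemma splitsumD B f g :
  splitsum B (fun P => f P + g P) = splitsum B f + splitsum B g.
Proof.
rewrite !(splitsum_box _ (finite_box B))//.
rewrite -fsbig_split/=; last exact: finite_box.
by apply: eq_fsbigr => P _; rewrite mulrDr.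
Qed.

Lemma splitsumZ B k f : splitsum B (fun P => k * f P) = k * splitsum B f.
Proof.
rewrite !(splitsum_box _ (finite_box B))// mulr_fsumr.
by apply: eq_fsbigr => P _; rewrite mulrCA.
Qed.

Lemma splitsum_sum B (I : finType) (p : pred I) (f : I -> color_counts n -> R) :
  splitsum B (fun P => \sum_(i | p i) f i P) = \sum_(i | p i) splitsum B (f i).
Proof.
rewrite !(splitsum_box _ (finite_box B))// fsbig_finite; last exact: finite_box.
under [RHS]eq_bigr => i _.
  rewrite (splitsum_box _ (finite_box B))// fsbig_finite; last exact: finite_box.
  over.
by rewrite exchange_big; apply: eq_bigr => P _; rewrite mulr_sumr.
Qed.

Lemma splitsum_cinc B i f :
  splitsum (cinc B i) f = splitsum B (fun P =>
    t * (q ^+ P i * qgt P i) * f P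
    + (1 - t * q ^+ csum P) * qlt (csub B P) i * f (cinc P i)).
Proof.
rewrite splitsumD; set s1 := splitsum B _; set s2 := splitsum B _.
have Bsub : box B `<=` box (cinc B i).
  by move=> P PB j; rewrite ffunE (leq_trans (PB j))// leq_addr.
(* What is left once the first term of [splitw_cinc2] is removed. It vanishes at P_i = 0 by
   [splitw_cinc0], so P can be replaced by P + e_i. *)
pose G P := splitw (cinc B i) P * f P - splitw B P * (t * (q ^+ P i * qgt P i) * f P).
have finB := finite_box (cinc B i).
have -> : splitsum (cinc B i) f = \sum_(P \in [set: color_counts n]) G P + s1.
  rewrite /s1 !(splitsum_box _ finB)// (fsum_finite finB); last first.
    move=> P G0 j; rewrite leqNgt; apply: contraNN G0 => PB.
    rewrite /G (splitw_eq0 (j := j) PB) (splitw_eq0 (j := j) (B := B)); first by apply/eqP; ring.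
    by apply: leq_trans PB; rewrite ltnS ffunE leq_addr.
  rewrite -fsbig_split//; apply: eq_fsbigr => P _; rewrite /G /=; ring.
rewrite addrC; congr (_ + _); rewrite (@fsum_cinc i).
  apply: eq_fsbigr => P _; rewrite /G splitw_cinc2 cincE qgt_cinc_same; ring.
by move=> P Pi; rewrite /G splitw_cinc0//; ring.
Qed.

Lemma splitsum_shift0 B c f :
  splitsum B (fun P => qgt P c * (1 - q ^+ P c) * f P)
  = \sum_(P \in box B)
     splitw B (cinc P c) * qgt P c * (1 - q ^+ (P c).+1) * f (cinc P c).
Proof.
rewrite /splitsum (@fsum_cinc c); last first.
  by move=> P ->; rewrite expr0; ring.
rewrite (fsum_finite (finite_box B)); last first.
  move=> P; rewrite mulf_eq0 negb_or => /andP[/splitw_le PB _] j.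
  by have := PB j; rewrite ffunE => /(leq_trans _)->//; exact: leq_addr.
by apply: eq_fsbigr => P _; rewrite cincE qgt_cinc_same; ring.
Qed.

Lemma splitsum_shift B c f :
  t * splitsum B (fun P => qgt P c * (1 - q ^+ P c) * f P)
  = splitsum B (fun P => (1 - t * q ^+ csum P)
     * (qlt (csub B P) c * (1 - q ^+ csub B P c)) * f (cinc P c)).
Proof.
rewrite splitsum_shift0 (splitsum_box _ (finite_box B))// mulr_fsumr.
by apply: eq_fsbigr => P _; rewrite mulrA splitw_shift; ring.
Qed.

Lemma splitsum_cdec B c f :
  t * ((1 - q ^+ B c) * qgt B c) * splitsum (cdec B c) f
  = splitsum B (fun P => qgt (csub B P) c * (1 - q ^+ csub B P c) * f P).
Proof.
have sub : box (cdec B c) `<=` box B.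
  by move=> P PB j; apply: leq_trans (PB j) _; rewrite ffunE leq_subr.
rewrite !(splitsum_box _ (finite_box B))// mulr_fsumr.
apply: eq_fsbigr => P; rewrite inE => PB.
have -> : qgt B c = qgt (csub B P) c * qgt P c.
  rewrite /qgt -big_split/=; apply: eq_bigr => j _.
  by rewrite -exprD ffunE subnK.
transitivity (t * ((1 - q ^+ B c) * qgt P c * splitw (cdec B c) P)
   * (qgt (csub B P) c * f P)); first by ring.
by rewrite splitw_cdec//; ring.
Qed.

(** * The three local relations, before the conservation indicator *)

Section Weight.
Variables (u : R) (m : 'I_n).
Hypothesis u_neq0 : u != 0.
Local Notation low := (lower u m).
Local Notation beta := (qbeta m).

(** The vertex weight on conserved labels; C is absent because conservation turns C_j - P_j into A_j
    + B_j - P_j - D_j. *)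
Definition vweight A B D : R :=
  splitsum B (fun P => low (cplus A (csub B P)) D).

Lemma lower_ext A A' D : (forall j, (m < j)%N -> A j = A' j) -> low A D = low A' D.
Proof. by move=> AA; congr (_ * _); apply: eq_bigr => j mj; rewrite AA. Qed.

(* C is the upper label of the term vweight A (cinc B i) D; the upper labels of
   the other terms are determined by conservation. *)
Lemma vweight_cinc A B C D i :
  above m D -> (m < i)%N ->
  (forall j, (m < j)%N -> (C j + D j = A j + B j + (j == i))%N) ->
  vweight A (cinc B i) D
  + t * u * (\sum_(c < n | (c < i)%N && ((m <= c)%N && (0 < D c)%N))
      beta (cinc (cdec C i) c) c * vweight A B (cdec D c))
  = vweight A B D
    + (if (0 < D i)%N then t * u * (q ^+ C i * qgt C i) * vweight A B (cdec D i)
       else 0).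
Proof.
move=> Dm mi cons.
pose T P := cplus A (csub B P).
have consT P j : box B P -> (m < j)%N -> (C j + D j = T P j + P j + (j == i))%N.
  by move=> PB mj; rewrite cons// !ffunE -[(_ + (_ - _) + _)%N]addnA subnK.
have -> : vweight A (cinc B i) D = splitsum B (fun P =>
    t * (q ^+ P i * qgt P i * low (cinc (T P) i) D)
    + (1 - t * q ^+ csum P) * qlt (csub B P) i * low (T P) D).
  rewrite /vweight splitsum_cinc; apply: eq_splitsum => P PB; rewrite csub_cinc2.
  have -> : cplus A (csub (cinc B i) P) = cinc (T P) i.
    by apply/ffunP => j; rewrite !ffunE; have := PB j; lia.
  by ring.
have -> : (if (0 < D i)%N then t * u * (q ^+ C i * qgt C i) * vweight A B (cdec D i)
       else 0) = splitsum B (fun P => t * (q ^+ P i * qgt P i)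
          * (low (cinc (T P) i) D - qlt D i * low (T P) D)).
  under [RHS]eq_splitsum => P PB.
    rewrite -mulrA -(@lower_cdec_same u m (T P) D P C i Dm mi); last 2 first.
    - by rewrite (consT P)// eqxx addn1.
    - by move=> j ij; rewrite (consT P) ?(ltn_trans mi)// -val_eqE/= gtn_eqF ?addn0.
    over.
  rewrite splitsumZ; case: ifP => _; last first.
    by rewrite (@eq_splitsum _ _ (fun=> 0 * 0)) ?splitsumZ ?mul0r ?mulr0// => P _; rewrite mul0r.
  by rewrite splitsumZ /vweight; ring.
(* [lower_cdec] is summed over c < i. Its first term telescopes by [telescope_qgt_qlt]; its second,
   after the shift of P in [splitsum_shift], by [telescope_qlt_below]. *)
have -> : t * u * (\sum_(c < n | (c < i)%N && ((m <= c)%N && (0 < D c)%N))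
      beta (cinc (cdec C i) c) c * vweight A B (cdec D c))
  = splitsum B (fun P => t * (q ^+ csum P - q ^+ P i * qgt P i * qlt D i) * low (T P) D)
    + splitsum B (fun P => (1 - t * q ^+ csum P) * (1 - qlt (csub B P) i) * low (T P) D).
  transitivity (t * \sum_(c < n | (c < i)%N) splitsum B (fun P =>
     qgt P c * qlt D c * (q ^+ P c - q ^+ D c) * low (T P) D
    + qgt P c * (1 - q ^+ P c) * low (cinc (T P) c) D)).
    rewrite big_mkcondr -mulrA mulr_sumr; congr (_ * _).
    apply: eq_bigr => c ci; transitivity (splitsum B (fun P =>
      if (m <= c)%N && (0 < D c)%N then
        u * beta (cinc (cdec C i) c) c * low (T P) (cdec D c) else 0)).
      case: ifP => _; first by rewrite splitsumZ mulrA.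
      by rewrite mulr0 (@eq_splitsum _ _ (fun=> 0 * 0)) ?splitsumZ ?mul0r// => P _; rewrite mul0r.
    apply: eq_splitsum => P PB.
    have [Ci|Ci] := posnP (C i); last first.
      apply: lower_cdec => // j mj; rewrite [cdec C i j]ffunE; have := consT P j PB mj.
      by case: eqVneq => [->|_]; lia.
    (* When C_i = 0 the truncated [cdec C i] breaks conservation, but then every term draws more
       particles of color i than there are. *)
    have Di : (T P i < D i)%N by have := consT P i PB mi; rewrite Ci eqxx; lia.
    have ic : (i == c) = false by rewrite -val_eqE/= gtn_eqF.
    have -> : low (T P) D = 0 by exact: lower_eq0 mi Di.
    have -> : low (cinc (T P) c) D = 0.
      by apply: lower_eq0 mi _; rewrite ffunE ic addn0.
    have -> : low (T P) (cdec D c) = 0.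
      by apply: lower_eq0 mi _; rewrite [cdec D c i]ffunE ic subn0.
    by rewrite !mulr0 addr0; case: ifP.
  under eq_bigr => c _ do rewrite splitsumD.
  rewrite big_split/= mulrDr; congr (_ + _).
    rewrite -splitsum_sum -splitsumZ; apply: eq_splitsum => P _.
    by rewrite -mulr_suml telescope_qgt_qlt mulrA.
  rewrite mulr_sumr; under eq_bigr => c _ do rewrite splitsum_shift.
  rewrite -splitsum_sum; apply: eq_splitsum => P PB.
  rewrite -telescope_qlt_below mulr_sumr mulr_suml; apply: eq_bigr => c _.
  have [Pc|Pc] := ltnP (P c) (B c).
    congr (_ * low _ _); apply/ffunP => j; rewrite !ffunE.
    by case: eqVneq => [->|_]; lia.
  have -> : csub B P c = 0%N by rewrite ffunE; lia.
  by rewrite expr0; ring.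
rewrite /vweight -!splitsumD; apply: eq_splitsum => P _ /=.
ring.
Qed.

(** Put b = B - P. The extra particle emitted is drawn from A or from b: 1 - q^(A_i + b_i) = (1 -
    q^(A_i)) + q^(A_i) (1 - q^(b_i)). The first part keeps the factor [qgt b i], which is 1 minus
    the telescoping sum over the colors c > i. *)
Lemma vweight_cdec A B D i : above m D -> (m <= i)%N -> A m = 0%N -> B m = 0%N ->
  vweight A B (cinc D i) * ((1 - q ^+ (D i).+1) * qgt D i) / u
  + t * \sum_(c < n | (i < c)%N) (1 - q ^+ B c) * qgt B c * beta A i
      * vweight (cinc (cdec A i) c) (cdec B c) D
  = beta A i * vweight (cdec A i) B D
    + t * ((1 - q ^+ B i) * qgt B i) * (qinf m A i * qgt A i)
      * vweight A (cdec B i) D.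
Proof.
move=> Dm mi Am Bm; pose T P := cplus A (csub B P).
have qgtT P : qgt (T P) i = qgt A i * qgt (csub B P) i.
  rewrite /qgt -big_split/=; apply: eq_bigr => j _.
  by rewrite -exprD ffunE.
have -> : vweight A B (cinc D i) * ((1 - q ^+ (D i).+1) * qgt D i) / u
    = splitsum B (fun P => beta (T P) i * low (cdec (T P) i) D).
  rewrite -mulrA mulrC -splitsumZ; apply: eq_splitsum => P _.
  by rewrite -lower_cinc_r// mulrC -!mulrA.
have beta0 : beta A i != 0 -> (m < i)%N -> (0 < A i)%N.
  move=> + im; rewrite lt0n; apply: contraNN => /eqP Ai.
  by rewrite /qbeta /qinf -val_eqE/= gtn_eqF// Ai expr0 subrr mul0r.
have -> : t * \sum_(c < n | (i < c)%N) (1 - q ^+ B c) * qgt B c * beta A i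
      * vweight (cinc (cdec A i) c) (cdec B c) D
    = splitsum B (fun P => beta A i * (1 - qgt (csub B P) i) * low (cdec (T P) i) D).
  have [->|b0] := eqVneq (beta A i) 0.
    rewrite big1 => [|c _]; last by rewrite mulr0 mul0r.
    by rewrite mulr0 (@eq_splitsum _ _ (fun=> 0 * 0)) ?splitsumZ ?mul0r// => P _; rewrite !mul0r.
  under [RHS]eq_splitsum => P _ do rewrite -mulrA -telescope_qgt_above mulr_suml.
  rewrite splitsumZ splitsum_sum 2!mulr_sumr; apply: eq_bigr => c ic.
  rewrite -splitsum_cdec.
  transitivity (beta A i * (t * ((1 - q ^+ B c) * qgt B c)
    * vweight (cinc (cdec A i) c) (cdec B c) D)); first by ring.
  have [Bc|Bc] := posnP (B c); first by rewrite Bc expr0; ring.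
  congr (_ * (_ * _)); apply: eq_splitsum => P PB; apply: lower_ext => j mj.
  rewrite !ffunE; have := PB j; have := beta0 b0; rewrite ffunE.
  by case: (eqVneq j c) ic mj => [->|jc]; case: (eqVneq _ i) => [->|ji] //=; lia.
have -> : t * ((1 - q ^+ B i) * qgt B i) * (qinf m A i * qgt A i)
      * vweight A (cdec B i) D
  = splitsum B (fun P => qinf m A i * qgt A i
      * (qgt (csub B P) i * (1 - q ^+ csub B P i)) * low (cdec (T P) i) D).
  transitivity (qinf m A i * qgt A i * (t * ((1 - q ^+ B i) * qgt B i)
      * vweight A (cdec B i) D)); first by ring.
  under [RHS]eq_splitsum => P _ do rewrite -mulrA.
  rewrite splitsumZ -splitsum_cdec.
  have [Bi|Bi] := posnP (B i); first by rewrite Bi expr0; ring.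
  congr (_ * (_ * _)); apply: eq_splitsum => P PB; congr lower.
  apply/ffunP => j; rewrite !ffunE; have := PB j; rewrite ffunE.
  by case: eqVneq => [->|_]; lia.
have -> : beta A i * vweight (cdec A i) B D
  = splitsum B (fun P => beta A i * low (cdec (T P) i) D).
  rewrite splitsumZ; have [->|b0] := eqVneq (beta A i) 0; first by rewrite !mul0r.
  congr (_ * _); apply: eq_splitsum => P PB; apply: lower_ext => j mj.
  rewrite !ffunE; have := PB j; have := beta0 b0.
  by case: eqVneq mj => [->|_]; lia.
rewrite -!splitsumD; apply: eq_splitsum => P PB.
rewrite /qbeta qgtT /qinf; case: eqVneq => [->|im].
  by rewrite [csub B P m]ffunE Bm sub0n expr0; ring.
have -> : T P i = (A i + csub B P i)%N by rewrite ffunE.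
by rewrite exprD; ring.
Qed.

(** For fixed P, [splitw_balance] trades the removal of a particle from B for a shift of P, and
    [lower_cdec] summed over c does the same for D; its telescoped part q^|P| - q^|D| supplies the
    diagonal terms. *)
Lemma vweight_flux A B C D : above m D ->
  (forall j, (m < j)%N -> (C j + D j = A j + B j)%N) ->
  q ^+ csum B * vweight A B D
  + \sum_(c < n) (1 - q ^+ B c) * qgt B c * vweight (cinc A c) (cdec B c) D
  = q ^+ csum D * vweight A B D
    + u * \sum_(c < n | (m <= c)%N && (0 < D c)%N)
        beta (cinc C c) c * vweight A B (cdec D c).
Proof.
move=> Dm cons; pose T P := cplus A (csub B P).
have consT P j : box B P -> (m < j)%N -> (C j + D j = T P j + P j)%N.
  by move=> PB mj; rewrite cons// !ffunE -[(_ + (_ - _) + _)%N]addnA subnK.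
have finB := finite_box B.
have -> : q ^+ csum B * vweight A B D
  + \sum_(c < n) (1 - q ^+ B c) * qgt B c * vweight (cinc A c) (cdec B c) D
  = \sum_(P \in box B) (q ^+ csum P * splitw B P
    + \sum_(c < n) splitw B (cinc P c) * qgt P c * (1 - q ^+ (P c).+1)) * low (T P) D.
  under [RHS]eq_fsbigr => P.
    rewrite inE => PB; rewrite -splitw_balance// mulrDl mulr_suml.
    over.
  rewrite fsbig_split//=; congr (_ + _).
    rewrite /vweight (splitsum_box _ finB)// mulr_fsumr.
    by apply: eq_fsbigr => P _; rewrite mulrA.
  rewrite fsbig_finite//= exchange_big/=; apply: eq_bigr => c _.
  rewrite -fsbig_finite//=.
  have sub : box (cdec B c) `<=` box B.
    by move=> P PB j; apply: leq_trans (PB j) _; rewrite ffunE leq_subr.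
  rewrite /vweight (splitsum_box _ finB)// mulr_fsumr.
  apply: eq_fsbigr => P; rewrite inE => PB; rewrite mulrA.
  have [->|w0] := eqVneq (splitw (cdec B c) P) 0; first by rewrite mulr0 !mul0r.
  have [Bc|Bc] := posnP (B c); first by rewrite Bc expr0 subrr !mul0r.
  congr (_ * low _ _); apply/ffunP => j; rewrite !ffunE.
  have := splitw_le w0 j; rewrite ffunE; have := PB j.
  by case: eqVneq => [->|_]; lia.
have -> : u * \sum_(c < n | (m <= c)%N && (0 < D c)%N)
        beta (cinc C c) c * vweight A B (cdec D c)
  = splitsum B (fun P => (q ^+ csum P - q ^+ csum D) * low (T P) D)
    + \sum_(c < n) splitsum B (fun P => qgt P c * (1 - q ^+ P c) * low (cinc (T P) c) D).
  transitivity (\sum_(c < n) splitsum B (fun P =>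
     qgt P c * qlt D c * (q ^+ P c - q ^+ D c) * low (T P) D
    + qgt P c * (1 - q ^+ P c) * low (cinc (T P) c) D)).
    rewrite big_mkcond mulr_sumr; apply: eq_bigr => c _.
    under [RHS]eq_splitsum => P PB.
      rewrite -(@lower_cdec u m (T P) D P C c)//; last by move=> j; exact: consT.
      over.
    case: ifP => _; first by rewrite splitsumZ mulrA.
    by rewrite mulr0 (@eq_splitsum _ _ (fun=> 0 * 0)) ?splitsumZ ?mul0r// => P _; rewrite mul0r.
  under eq_bigr => c _ do rewrite splitsumD.
  rewrite big_split/=; congr (_ + _); rewrite -splitsum_sum.
  apply: eq_splitsum => P _; rewrite -mulr_suml; congr (_ * _).
  have := telescope_prod (fun j => q ^+ P j) (fun j => q ^+ D j).
  by rewrite -!expr_sum.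
have -> : q ^+ csum D * vweight A B D = splitsum B (fun P => q ^+ csum D * low (T P) D).
  by rewrite splitsumZ.
rewrite addrA -splitsumD.
under eq_fsbigr => P _ do rewrite mulrDl.
rewrite fsbig_split//=; congr (_ + _).
  rewrite (splitsum_box _ finB)//; apply: eq_fsbigr => P _; ring.
under [RHS]eq_bigr => c _ do rewrite splitsum_shift0 fsbig_finite//=.
rewrite exchange_big/= -fsbig_finite//=.
apply: eq_fsbigr => P; rewrite inE => PB; rewrite mulr_suml; apply: eq_bigr => c _.
have [Pc|Pc] := ltnP (P c) (B c).
  congr (_ * low _ _); apply/ffunP => j; rewrite !ffunE.
  case: eqVneq => [->|_]; last by rewrite !addn0.
  by rewrite -addnA !addn1 -subSn // subSS.
by rewrite (splitw_eq0 (B := B) (P := cinc P c) (j := c)) ?cincE ?ltnS// !mul0r.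
Qed.
End Weight.
End SplitWeight.
End Local.

(** * Local relations for the vertex weight *)

Section VertexWeight.
Variables (R : realType) (n : nat) (q : R).
Hypotheses (q_ge0 : 0 <= q) (q_lt1 : q < 1).
Variables (m : 'I_n) (s u : R).
Hypotheses (u_gt0 : 0 < u).
Implicit Types (A B C D P : color_counts n) (c i j : 'I_n).

Local Notation t := (s ^+ 2 / u).
Local Notation W := (qbos_weight q m s u).
Local Notation vw := (vweight q t u m).
Local Notation beta := (qbeta q m).
Local Notation qgt := (qgt q).

Let u_neq0 : u != 0. Proof. by rewrite gt_eqF. Qed.

Definition conserved A B C D : bool :=
  [forall i : 'I_n, (i != m) ==> (A i + B i == C i + D i)%N] &&
  [forall i : 'I_n, (i < m)%N ==> (D i == 0%N)].

Lemma conservedP A B C D :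
  reflect ((forall i, i != m -> (A i + B i = C i + D i)%N) /\ above m D)
          (conserved A B C D).
Proof.
apply: (iffP andP) => -[H1 H2]; split.
- by move=> i im; apply/eqP; move/forallP: H1 => /(_ i); rewrite im.
- by move=> i im; apply/eqP; move/forallP: H2 => /(_ i); rewrite im.
- by apply/forallP => i; apply/implyP => im; rewrite H1.
- by apply/forallP => i; apply/implyP => im; rewrite H2.
Qed.

Lemma sum_ffun_box B M (F : color_counts n -> R) : (csum B <= M)%N ->
  \sum_(P \in box B) F P
  = \sum_(g : {ffun 'I_n -> 'I_M.+1} | [forall i, (g i <= B i)%N])
      F [ffun i => val (g i)].
Proof.
move=> BM; rewrite (bigfs _ (index_enum_uniq _))/=; last first.
  by move=> g _; rewrite mem_index_enum.
apply: (reindex_fsbig (fun g : {ffun 'I_n -> 'I_M.+1} => [ffun i => val (g i)] : color_counts n)).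
split=> /=.
- by move=> g /= /forallP gB i; rewrite ffunE.
- move=> g g' _ _ /ffunP gg; apply/ffunP => i; apply: val_inj.
  by have := gg i; rewrite !ffunE.
- move=> P PB; exists [ffun i => inord (P i)]; last first.
    apply/ffunP => i; rewrite !ffunE /= inordK// ltnS (leq_trans (PB i))//.
    by rewrite (leq_trans _ BM)// /csum (bigD1 i)//= leq_addr.
  apply/forallP => i; rewrite !ffunE inordK// ltnS (leq_trans (PB i))//.
  by rewrite (leq_trans _ BM)// /csum (bigD1 i)//= leq_addr.
Qed.

Lemma expr_sum_qlt (a b : 'I_n -> nat) (p : pred 'I_n) :
  q ^+ (\sum_(i < n | p i) \sum_(j < n | (i < j)%N) a i * b j)%N
  = \prod_(j < n) (\prod_(i < n | p i && (i < j)%N) q ^+ a i) ^+ b j.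
Proof.
rewrite expr_sum (eq_bigr (fun i : 'I_n => \prod_(j < n | (i < j)%N) q ^+ (a i * b j))).
  rewrite (exchange_big_dep xpredT)//=; apply: eq_bigr => j _.
  by rewrite -prodrXl; apply: eq_bigr => i _; rewrite exprM.
by move=> i _; rewrite expr_sum.
Qed.

Lemma qbos_weightE A B C D : W A B C D = (conserved A B C D)%:R * vw A B D.
Proof.
rewrite /qbos_weight -/(conserved A B C D).
have [/conservedP[cons Dm]|_] := boolP (conserved _ _ _ _); last by rewrite !mul0r.
rewrite !mul1r /vweight (splitsum_box _ _ _ (finite_box B))//.
rewrite (sum_ffun_box (M := csum B))//.
rewrite big_mkcond [RHS]big_mkcond; apply: eq_bigr => g _.
set P : color_counts n := [ffun i => val (g i)].
have gP i : g i = P i :> nat by rewrite ffunE.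
have -> : [forall i, (g i <= B i)%N && ((i != m) ==> (g i <= C i)%N)]
   = [forall i, (g i <= B i)%N] && [forall i, (i != m) ==> (g i <= C i)%N].
  apply/forallP/andP => [H|[/forallP H1 /forallP H2] i]; last by rewrite H1 H2.
  by split; apply/forallP => i; have /andP[] := H i.
have [/forallP PB|//] := boolP [forall i, (g i <= B i)%N]; rewrite /=.
have {}PB i : (P i <= B i)%N by rewrite -gP.
(* The defining sum excludes P_i > C_i. In [splitsum] such a P has weight 0: by conservation fewer
   than D_i particles of color i would remain to draw from. *)
case: ifPn => [/forallP PC|]; last first.
  rewrite negb_forall => /existsP[i]; rewrite negb_imply -ltnNge gP => /andP[im Ci].
  have mi : (m < i)%N.
    rewrite ltn_neqAle eq_sym im/= leqNgt; apply/negP => im'.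
    by have := cons i im; rewrite (Dm i im'); have := PB i; lia.
  rewrite (lower_eq0 q u (j := i) mi) ?mulr0// ffunE [csub _ _ _]ffunE.
  by have := cons i im; have := PB i; lia.
have {}PC i : i != m -> (P i <= C i)%N by move=> im; have := PC i; rewrite im gP.
have csumg : csum (fun i => g i) = csum P by apply: eq_bigr => i _; rewrite gP.
have csB : csum B = (csum (csub B P) + csum P)%N.
  by rewrite /csum -big_split; apply: eq_bigr => i _; rewrite [csub _ _ _]ffunE/= subnK.
have AE i : cplus A (csub B P) i = (A i + (B i - P i))%N.
  by rewrite ffunE [csub _ _ _]ffunE.
have E1 : \prod_(i < n) (qpoch q q (B i) / (qpoch q q (g i) * qpoch q q (B i - g i)))
    = \prod_(i < n) qbin q (B i) (P i).
  by apply: eq_bigr => i _; rewrite gP /qbin PB.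
have E2 : q ^+ (\sum_(i < n) \sum_(j < n | (i < j)%N) (B i - g i) * g j)
    = \prod_(i < n) qlt q (csub B P) i ^+ P i.
  rewrite (expr_sum_qlt (fun i => B i - g i)%N (fun i => g i) xpredT); apply: eq_bigr => i _.
  by rewrite gP; congr (_ ^+ _); apply: eq_bigr => j _; rewrite gP [csub _ _ _]ffunE.
have E3 : q ^+ (\sum_(i < n | (m <= i)%N) \sum_(j < n | (i < j)%N) D i * (C j - g j))
    = \prod_(i < n | (m < i)%N) qlt q D i ^+ (cplus A (csub B P) i - D i).
  rewrite (expr_sum_qlt D (fun j => C j - g j)%N (fun i => (m <= i)%N)).
  rewrite [RHS]big_mkcond; apply: eq_bigr => j _; case: ifPn => mj.
    congr (_ ^+ _).
      rewrite /qlt big_mkcondl; apply: eq_bigr => i _.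
      by case: ltnP => // /Dm ->; rewrite expr0.
    have jm : j != m by rewrite -val_eqE/= gtn_eqF.
    by rewrite AE gP; have := cons j jm; have := PB j; have := PC j jm; lia.
  rewrite big_pred0 ?expr1n// => i; apply/negbTE; rewrite negb_and -!ltnNge.
  by case: ltnP => //= mi; rewrite ltnS (leq_trans _ mi)// leqNgt.
have E4 : \prod_(i < n | (m < i)%N) (qpoch q q (C i - g i + D i)
      / (qpoch q q (C i - g i) * qpoch q q (D i)))
    = \prod_(i < n | (m < i)%N) qbin q (cplus A (csub B P) i) (D i).
  apply: eq_bigr => i mi; have im : i != m by rewrite -val_eqE/= gtn_eqF.
  have -> : cplus A (csub B P) i = (D i + (C i - g i))%N.
    by rewrite AE gP; have := cons i im; have := PB i; have := PC i im; lia.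
  by rewrite qbin_addE addnC [X in _ / X]mulrC.
have E5 : \prod_(i < n) t ^+ (B i - P i) = t ^+ csum (csub B P).
  by rewrite /csum expr_sum; apply: eq_bigr => i _; rewrite [csub _ _ _]ffunE.
have E6 : (s ^+ 2) ^+ (csum B - csum P) *
    u ^ ((csum D)%:Z - (csum B)%:Z + (csum P)%:Z)
    = t ^+ csum (csub B P) * u ^+ csum D.
  rewrite csB addnK; have -> : (csum D)%:Z - (csum (csub B P) + csum P)%N%:Z + (csum P)%:Z
     = (csum D)%:Z + (- (csum (csub B P))%:Z) by lia.
  by rewrite expfzDr// -exprnN expr_div_n -exprnP -exprVn; ring.
rewrite csumg E1 E2 E3 E4 /splitw /lower !big_split/= E5.
rewrite -[qpoch q t _ * _ * _]mulrA E6; ring.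
Qed.

(** Adding a particle of color m to an infinite supply leaves the label as it is. *)
Definition cincm A c : color_counts n := if c == m then A else cinc A c.
Definition cdecm A c : color_counts n := if c == m then A else cdec A c.

Lemma conserved_eq A B C D A' B' C' D' :
  (forall j, j != m -> (A j + B j = C j + D j)%N <-> (A' j + B' j = C' j + D' j)%N) ->
  (forall j, (j < m)%N -> D j = 0%N <-> D' j = 0%N) ->
  conserved A B C D = conserved A' B' C' D'.
Proof.
move=> H1 H2; apply/conservedP/conservedP => -[K1 K2]; split=> j jm.
- by apply/H1/K1.
- by apply/H2/K2.
- by apply/H1/K1.
- by apply/H2/K2.
Qed.

Lemma splitsum0 B f : (forall P, box B P -> f P = 0) -> splitsum q t B f = 0.
Proof.
move=> f0; rewrite (@eq_splitsum _ _ _ _ _ _ (fun=> 0 * 0)) ?splitsumZ ?mul0r//.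
Qed.

Lemma vweight_eq0 A B D i : (m < i)%N -> (A i + B i < D i)%N -> vw A B D = 0.
Proof.
move=> mi ABD; apply: splitsum0 => P _; apply: (lower_eq0 q u mi).
by rewrite ffunE [csub _ _ _]ffunE; lia.
Qed.

Lemma qbeta_cincm A c : beta (cincm A c) c = beta (cinc A c) c.
Proof.
rewrite /qbeta /cincm /qinf; case: eqVneq => // ->.
by rewrite qgt_cinc_same.
Qed.

(** [vweight_cinc] with its common indicator restored and t u = s^2. The guards keep the decrements
    that are not truncated; at C_i = 0 the terms dropped from [vweight_cinc] are 0, because D_i
    exceeds A_i + B_i. *)
Lemma qbos_weight_cinc A B C D i : (m < i)%N ->
  W A (cinc B i) C D
  + \sum_(c < n) (if [&& (m <= c)%N, (c < i)%N, (0 < D c)%N & (0 < C i)%N] then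
      s ^+ 2 * beta (cincm (cdec C i) c) c
        * W A B (cincm (cdec C i) c) (cdec D c) else 0)
  = (if (0 < C i)%N then W A B (cdec C i) D else 0)
    + (if (0 < D i)%N then
         s ^+ 2 * (q ^+ C i * qgt C i) * W A B C (cdec D i) else 0).
Proof.
move=> mi; set b := conserved A (cinc B i) C D.
have im : i != m by rewrite -val_eqE/= gtn_eqF.
have tu : s ^+ 2 = t * u by rewrite divfK.
have bE c : [&& (m <= c)%N, (c < i)%N, (0 < D c)%N & (0 < C i)%N] ->
    W A B (cincm (cdec C i) c) (cdec D c) = b%:R * vw A B (cdec D c).
  move=> /and4P[mc ci Dc Ci]; rewrite qbos_weightE; congr ((nat_of_bool _)%:R * _).
  have ic : (i == c) = false by rewrite -val_eqE/= gtn_eqF.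
  symmetry; apply: conserved_eq => j jm; last first.
    rewrite ffunE; have : (j == c) = false by rewrite -val_eqE/= ltn_eqF// (leq_trans jm).
    by move=> ->; rewrite subn0.
  rewrite /cincm; case: (eqVneq c m) => [cm|cm]; rewrite !ffunE.
    by rewrite cm (negbTE jm); case: eqVneq => [->|_]; clear -Dc Ci; lia.
  by case: (eqVneq j c) => [->|jc]; [rewrite eq_sym ic|case: eqVneq => [->|_]]; clear -Dc Ci; lia.
have bE1 : (0 < C i)%N -> W A B (cdec C i) D = b%:R * vw A B D.
  move=> Ci; rewrite qbos_weightE; congr ((nat_of_bool _)%:R * _); apply: conserved_eq => // j jm.
  by rewrite !ffunE; case: eqVneq => [->|_]; clear -Ci; lia.
have bE2 : (0 < D i)%N -> W A B C (cdec D i) = b%:R * vw A B (cdec D i).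
  move=> Di; rewrite qbos_weightE; congr ((nat_of_bool _)%:R * _); apply: conserved_eq => j jm.
    by rewrite !ffunE; case: eqVneq => [->|_]; clear -Di; lia.
  rewrite ffunE; have : (j == i) = false by rewrite -val_eqE/= ltn_eqF// (ltn_trans jm).
  by move=> ->; rewrite subn0.
rewrite qbos_weightE -/b.
rewrite (eq_bigr (fun c => b%:R *
  (if [&& (m <= c)%N, (c < i)%N, (0 < D c)%N & (0 < C i)%N] then
      s ^+ 2 * beta (cinc (cdec C i) c) c * vw A B (cdec D c) else 0))); last first.
  by move=> c _; case: ifP => [/bE ->|_]; rewrite ?qbeta_cincm; ring.
rewrite -mulr_sumr.
have -> : (if (0 < C i)%N then W A B (cdec C i) D else 0)
   = b%:R * (if (0 < C i)%N then vw A B D else 0).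
  by case: ifP => [/bE1 ->//|_]; rewrite mulr0.
have -> : (if (0 < D i)%N then s ^+ 2 * (q ^+ C i * qgt C i) * W A B C (cdec D i) else 0)
   = b%:R * (if (0 < D i)%N then s ^+ 2 * (q ^+ C i * qgt C i) * vw A B (cdec D i) else 0).
  by case: ifP => [/bE2 ->|_]; ring.
rewrite -!mulrDr; have [/conservedP[cons Dm]|_] := boolP b; last by rewrite !mul0r.
congr (_ * _).
have consi j : (m < j)%N -> (C j + D j = A j + B j + (j == i))%N.
  move=> mj; have jm : j != m by rewrite -val_eqE/= gtn_eqF.
  by rewrite -cons// ffunE addnA.
have := vweight_cinc q_ge0 q_lt1 t u_neq0 Dm mi consi; rewrite -tu.
have [Ci|Ci] := posnP (C i); last first.
  move=> <-; congr (_ + _); rewrite mulr_sumr [RHS]big_mkcond; apply: eq_bigr => c _.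
  by rewrite andbT andbCA; case: ifP => _; ring.
have ABD : (A i + B i < D i)%N by have := consi i mi; rewrite Ci eqxx; lia.
rewrite (vweight_eq0 mi ABD) => <-; congr (_ + _).
rewrite big1; last by move=> c _; rewrite !andbF.
rewrite big1 ?mulr0// => c /andP[ci _]; rewrite (vweight_eq0 mi) ?mulr0//.
by rewrite [cdec _ _ _]ffunE -val_eqE/= gtn_eqF// subn0.
Qed.

(** [vweight_cdec] with its common indicator restored. Where the guard on A_i fails, [beta A i] is
    0. *)
Lemma qbos_weight_cdec A B C D i : (m <= i)%N -> A m = 0%N -> B m = 0%N ->
  W A B C (cinc D i) * ((1 - q ^+ (D i).+1) * qgt D i) / u
  + \sum_(c < n) (if [&& (i < c)%N, (0 < B c)%N & (i == m) || (0 < A i)%N] then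
      t * ((1 - q ^+ B c) * qgt B c) * beta A i
        * W (cinc (cdecm A i) c) (cdec B c) C D else 0)
  = (if (i == m) || (0 < A i)%N then beta A i * W (cdecm A i) B C D else 0)
    + (if (0 < B i)%N then
         t * ((1 - q ^+ B i) * qgt B i) * (qinf q m A i * qgt A i)
           * W A (cdec B i) C D else 0).
Proof.
move=> mi Am Bm; set b := conserved A B C (cinc D i).
have cdecmE : cdecm A i = cdec A i.
  rewrite /cdecm; case: eqVneq => // ->; apply/ffunP => j; rewrite ffunE.
  by case: eqVneq => [->|_]; rewrite ?Am// subn0.
have aboveE j : (j < m)%N -> cinc D i j = D j.
  by move=> jm; rewrite ffunE -val_eqE/= ltn_eqF ?addn0// (leq_trans jm).
have bE c : [&& (i < c)%N, (0 < B c)%N & (i == m) || (0 < A i)%N] ->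
    W (cinc (cdecm A i) c) (cdec B c) C D = b%:R * vw (cinc (cdec A i) c) (cdec B c) D.
  move=> /and3P[ic Bc Ai]; rewrite cdecmE qbos_weightE; congr ((nat_of_bool _)%:R * _).
  symmetry; apply: conserved_eq => j jm; last by rewrite aboveE.
  have ci : (c == i) = false by rewrite -val_eqE/= gtn_eqF.
  rewrite !ffunE; case: (eqVneq j c) => [->|jc]; first by rewrite ci; clear -Bc; lia.
  case: (eqVneq j i) Ai jm => [->|_]; last by clear; lia.
  by move=> /orP[/eqP ->|]; rewrite ?eqxx//; clear; lia.
have bE1 : (i == m) || (0 < A i)%N -> W (cdecm A i) B C D = b%:R * vw (cdec A i) B D.
  move=> Ai; rewrite cdecmE qbos_weightE; congr ((nat_of_bool _)%:R * _).
  symmetry; apply: conserved_eq => j jm; last by rewrite aboveE.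
  rewrite !ffunE; case: (eqVneq j i) Ai jm => [->|_]; last by clear; lia.
  by move=> /orP[/eqP ->|]; rewrite ?eqxx//; clear; lia.
have bE2 : (0 < B i)%N -> W A (cdec B i) C D = b%:R * vw A (cdec B i) D.
  move=> Bi; rewrite qbos_weightE; congr ((nat_of_bool _)%:R * _).
  symmetry; apply: conserved_eq => j jm; last by rewrite aboveE.
  by rewrite !ffunE; case: eqVneq => [->|_]; clear -Bi; lia.
rewrite qbos_weightE -/b.
rewrite (eq_bigr (fun c => b%:R *
  (if [&& (i < c)%N, (0 < B c)%N & (i == m) || (0 < A i)%N] then
      t * ((1 - q ^+ B c) * qgt B c) * beta A i * vw (cinc (cdec A i) c) (cdec B c) D
      else 0))); last by move=> c _; case: ifP => [/bE ->|_]; ring.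
rewrite -mulr_sumr.
have -> : (if (i == m) || (0 < A i)%N then beta A i * W (cdecm A i) B C D else 0)
   = b%:R * (if (i == m) || (0 < A i)%N then beta A i * vw (cdec A i) B D else 0).
  by case: ifP => [/bE1 ->|_]; ring.
have -> : (if (0 < B i)%N then t * ((1 - q ^+ B i) * qgt B i) * (qinf q m A i * qgt A i)
           * W A (cdec B i) C D else 0)
   = b%:R * (if (0 < B i)%N then t * ((1 - q ^+ B i) * qgt B i)
           * (qinf q m A i * qgt A i) * vw A (cdec B i) D else 0).
  by case: ifP => [/bE2 ->|_]; ring.
rewrite -!mulrA -!mulrDr; have [/conservedP[_ Dm']|_] := boolP b; last by rewrite !mul0r.
congr (_ * _).
have Dm : above m D by move=> j jm; rewrite -aboveE// Dm'.
have beta0 : (i == m) || (0 < A i)%N = false -> beta A i = 0.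
  move=> /negbT; rewrite negb_or -eqn0Ngt => /andP[im /eqP Ai].
  by rewrite /qbeta /qinf (negbTE im) Ai expr0 subrr mul0r.
have := vweight_cdec q_ge0 q_lt1 t u_neq0 Dm mi Am Bm.
have -> : t * ((1 - q ^+ B i) * qgt B i) * (qinf q m A i * qgt A i) * vw A (cdec B i) D
  = (if (0 < B i)%N then t * ((1 - q ^+ B i) * qgt B i)
           * (qinf q m A i * qgt A i) * vw A (cdec B i) D else 0).
  by case: posnP => // ->; rewrite expr0; ring.
have -> : beta A i * vw (cdec A i) B D
   = (if (i == m) || (0 < A i)%N then beta A i * vw (cdec A i) B D else 0).
  by case: ifP => // /beta0 ->; rewrite mul0r.
rewrite !mulrA => <-; congr (_ + _).
rewrite mulr_sumr [RHS]big_mkcond; apply: eq_bigr => c _.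
case: (ltnP i c) => //= _; case: posnP => /= [->|_]; first by rewrite expr0; ring.
by case: ifP => [_|/beta0 ->]; ring.
Qed.

Lemma qbos_weight_flux A B C D :
  q ^+ csum B * W A B C D
  + \sum_(c < n) (if (0 < B c)%N then
      (1 - q ^+ B c) * qgt B c * W (cinc A c) (cdec B c) C D else 0)
  = q ^+ csum D * W A B C D
    + u * \sum_(c < n) (if (m <= c)%N && (0 < D c)%N then
        beta (cincm C c) c * W A B (cincm C c) (cdec D c) else 0).
Proof.
set b := conserved A B C D.
have bE c : (m <= c)%N && (0 < D c)%N ->
    W A B (cincm C c) (cdec D c) = b%:R * vw A B (cdec D c).
  move=> /andP[mc Dc]; rewrite qbos_weightE; congr ((nat_of_bool _)%:R * _).
  symmetry; apply: conserved_eq => j jm; last first.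
    rewrite ffunE; have : (j == c) = false by rewrite -val_eqE/= ltn_eqF// (leq_trans jm).
    by move=> ->; rewrite subn0.
  rewrite /cincm; case: (eqVneq c m) => [cm|cm]; rewrite !ffunE.
    by rewrite cm (negbTE jm); clear; lia.
  by case: (eqVneq j c) => [->|jc]; clear -Dc; lia.
have bE1 c : (0 < B c)%N ->
    W (cinc A c) (cdec B c) C D = b%:R * vw (cinc A c) (cdec B c) D.
  move=> Bc; rewrite qbos_weightE; congr ((nat_of_bool _)%:R * _).
  symmetry; apply: conserved_eq => j jm //.
  by rewrite !ffunE; case: (eqVneq j c) => [->|jc]; clear -Bc; lia.
rewrite qbos_weightE -/b.
rewrite (eq_bigr (fun c => b%:R *
    ((1 - q ^+ B c) * qgt B c * vw (cinc A c) (cdec B c) D))); last first.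
  by move=> c _; case: posnP => [->|/bE1 ->]; rewrite ?expr0; ring.
rewrite [X in _ = _ + u * X](eq_bigr (fun c => b%:R *
    (if (m <= c)%N && (0 < D c)%N then beta (cinc C c) c * vw A B (cdec D c) else 0)));
  last by move=> c _; case: ifP => [/bE ->|_]; rewrite ?qbeta_cincm; ring.
rewrite -!mulr_sumr mulrCA [u * _]mulrCA [X in _ = X + _]mulrCA -!mulrDr.
have [/conservedP[cons Dm]|_] := boolP b; last by rewrite !mul0r.
congr (_ * _); rewrite -big_mkcond; apply: vweight_flux => // j mj.
by rewrite -cons// -val_eqE/= gtn_eqF.
Qed.

(** * Positivity and decay of the vertex weight *)

Section Bounds.
Hypothesis s2_lt : s ^+ 2 < u.

Let t_ge0 : 0 <= t. Proof. by rewrite divr_ge0 ?sqr_ge0// ltW. Qed.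
Let t_lt1 : t < 1. Proof. by rewrite ltr_pdivrMr ?mul1r. Qed.

Lemma qlt_ge0 (a : 'I_n -> nat) c : 0 <= qlt q a c.
Proof. by apply: prodr_ge0 => j _; rewrite exprn_ge0. Qed.

Lemma qgt_ge0 (a : 'I_n -> nat) c : 0 <= qgt a c.
Proof. by apply: prodr_ge0 => j _; rewrite exprn_ge0. Qed.

Lemma qlt_le1 (a : 'I_n -> nat) c : qlt q a c <= 1.
Proof.
by apply: prodr_ile1 => j _; rewrite exprn_ge0//= exprn_ile1// ltW.
Qed.

Lemma splitw_ge0 B P : 0 <= splitw q t B P.
Proof.
rewrite mulr_ge0 ?(ltW (qpoch_gt0 _ _ _ _ _))//.
apply: prodr_ge0 => j _.
by rewrite !mulr_ge0 ?exprn_ge0 ?qlt_ge0// qbin_ge0.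
Qed.

Lemma lower_ge0 A D : 0 <= lower q u m A D.
Proof.
rewrite mulr_ge0 ?divr_ge0 ?exprn_ge0 ?(ltW u_gt0) ?(ltW (qpoch_gt0 _ _ _ _ _))//.
apply: prodr_ge0 => j _.
by rewrite mulr_ge0 ?exprn_ge0 ?qlt_ge0// qbin_ge0.
Qed.

Lemma vweight_ge0 A B D : 0 <= vw A B D.
Proof. by apply: fsumr_ge0 => P _; rewrite mulr_ge0 ?splitw_ge0 ?lower_ge0. Qed.

Lemma qbos_weight_ge0 A B C D : 0 <= W A B C D.
Proof. by rewrite qbos_weightE mulr_ge0 ?ler0n ?vweight_ge0. Qed.

Lemma qbin_le a d : qbin q a d <= (qpoch q q d)^-1.
Proof.
have qp k : 0 < qpoch q q k by exact: qpoch_gt0.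
rewrite /qbin; case: leqP => [da|_]; last by rewrite invr_ge0 ltW.
rewrite invfM mulrCA ler_piMr ?invr_ge0 ?(ltW (qp _))//.
rewrite ler_pdivrMr// mul1r -{1}(subnK da).
move: (a - d)%N => k; elim: d {da} => [|d IH]; first by rewrite addn0.
rewrite addnS qpochS (le_trans _ IH)// ler_piMr ?(ltW (qp _))//.
by rewrite gerBl mulr_ge0// exprn_ge0.
Qed.

(** For j > m the base [qlt D j] contains q^(D_m), so a single exiting particle of color m already
    forces geometric decay in A. The q-binomials are bounded independently of A by [qbin_le]. *)
Lemma lower_le A D (r : R) : q <= r -> r < 1 ->
  lower q u m A D <= u ^+ csum D / qpoch q q (D m)
     * (\prod_(j < n | (m < j)%N) (qpoch q q (D j))^-1)
     * (if (0 < D m)%N then r ^+ (\sum_(j < n | (m < j)%N) (A j - D j))%N else 1).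
Proof.
move=> qr r1; have qp k : 0 < qpoch q q k by exact: qpoch_gt0.
have r0 : 0 <= r by exact: le_trans qr.
rewrite /lower -[leRHS]mulrA ler_wpM2l//.
  by rewrite divr_ge0 ?exprn_ge0 ?(ltW u_gt0)// ltW.
have -> : (if (0 < D m)%N then r ^+ (\sum_(j < n | (m < j)%N) (A j - D j))%N else 1)
    = \prod_(j < n | (m < j)%N) (if (0 < D m)%N then r ^+ (A j - D j) else 1).
  by case: ifP => _; [rewrite expr_sum|rewrite big1].
rewrite -big_split/=; apply: ler_prod => j mj.
rewrite mulr_ge0 ?qbin_ge0 ?exprn_ge0 ?qlt_ge0//=.
rewrite ler_pM ?qbin_ge0 ?exprn_ge0 ?qlt_ge0 ?qbin_le//.
case: ifP => Dm; last by rewrite exprn_ile1 ?qlt_ge0 ?qlt_le1.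
rewrite lerXn2r ?nnegrE ?qlt_ge0// (le_trans _ qr)//.
rewrite /qlt (bigD1 m)//= -[leRHS]mulr1 ler_pM ?exprn_ge0//.
- by apply: prodr_ge0 => k _; rewrite exprn_ge0.
- case: (D m) Dm => // k _; by rewrite exprS ler_piMr ?exprn_ile1 ?(ltW q_lt1).
- by apply: prodr_ile1 => k _; rewrite exprn_ge0//= exprn_ile1// ltW.
Qed.

(** The constant is uniform in the vertical labels. Its factor r^(-|D|) compensates for decay in A -
    D rather than in A, which is why r has to be positive although q may be 0. *)
Lemma qbos_weight_le B D (r : R) : q <= r -> 0 < r -> r < 1 ->
  exists2 K, 0 <= K & forall A C, (forall j, (j <= m)%N -> A j = 0%N) ->
    W A B C D <= K * (if (0 < D m)%N then r ^+ csum A else 1).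
Proof.
move=> qr r0 r1.
pose K1 := \sum_(P \in box B) splitw q t B P.
pose K2 := u ^+ csum D / qpoch q q (D m)
     * (\prod_(j < n | (m < j)%N) (qpoch q q (D j))^-1).
have qp k : 0 < qpoch q q k by exact: qpoch_gt0.
have K1_ge0 : 0 <= K1 by apply: fsumr_ge0 => P _; exact: splitw_ge0.
have K2_ge0 : 0 <= K2.
  rewrite mulr_ge0 ?divr_ge0 ?exprn_ge0 ?(ltW u_gt0) ?(ltW (qp _))//.
  by apply: prodr_ge0 => j _; rewrite invr_ge0 ltW.
exists (K1 * (K2 * r ^- csum D)).
  by rewrite mulr_ge0// (mulr_ge0 K2_ge0)// invr_ge0 exprn_ge0// ltW.
move=> A C A0; rewrite qbos_weightE.
have W_le : vw A B D <= K1 * (K2 * (r ^- csum D * (if (0 < D m)%N then r ^+ csum A else 1))).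
  rewrite /vweight (splitsum_box _ _ _ (finite_box B))// /K1 mulr_fsuml.
  rewrite !fsbig_finite//; try exact: finite_box.
  apply: ler_sum => P _; rewrite ler_wpM2l ?splitw_ge0//.
  apply: le_trans (lower_le _ _ qr r1) _; rewrite ler_wpM2l//.
  have rD k : 0 < r ^+ k by rewrite exprn_gt0.
  case: ifP => Dm; last first.
    by rewrite mulr1 invf_ge1// exprn_ile1 ?ltW.
  rewrite ler_pdivlMl// -exprD ler_wiXn2l ?(ltW r0) ?(ltW r1)//.
  rewrite /csum (bigID (fun j : 'I_n => m < j)%N)/= [X in (_ + X)%N]big1 ?addn0; last first.
    by move=> j jm; apply: A0; rewrite leqNgt.
  apply: (@leq_trans (\sum_(j < n | (m < j)%N) (D j + (A j - D j)))%N).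
    by apply: leq_sum => j _; rewrite -leq_subLR.
  rewrite big_split/= leq_add//.
    by rewrite [leqRHS](bigID (fun j : 'I_n => m < j)%N)/= leq_addr.
  by apply: leq_sum => j _; rewrite ffunE leq_sub2r ?leq_addr.
have -> : K1 * (K2 / r ^+ csum D) * (if (0 < D m)%N then r ^+ csum A else 1)
  = K1 * (K2 * (r ^- csum D * (if (0 < D m)%N then r ^+ csum A else 1))) by ring.
apply: le_trans W_le.
by case: conserved; rewrite ?mul1r// mul0r vweight_ge0.
Qed.

(** The term P = B is already positive. The last hypothesis gives each power of q in [lower] base 1
    or exponent 0, so positivity survives q = 0. *)
Lemma qbos_weight_gt0 A B D : (forall j, (j <= m)%N -> B j = 0%N) -> above m D ->
  (forall j, (m < j)%N -> B j = D j) -> (forall j, (B j <= A j)%N) ->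
  (forall j, D j = 0%N) \/ (forall j, (m < j)%N -> A j = D j) ->
  0 < W A B A D.
Proof.
move=> B0 Dm BD BA AD; rewrite qbos_weightE.
have -> : conserved A B A D.
  apply/conservedP; split=> // j jm; congr addn.
  by case: (ltngtP j m) jm => // [jm _|/BD->//|/val_inj->]; rewrite ?eqxx// Dm// B0// ltnW.
rewrite mul1r /vweight (splitsum_box _ _ _ (finite_box B))//.
rewrite (fsbigD1 B)/=; [|exact: finite_box|by move=> j].
have term0 P : 0 <= splitw q t B P * lower q u m (cplus A (csub B P)) D.
  by rewrite mulr_ge0 ?splitw_ge0 ?lower_ge0.
apply: ltr_wpDr; first exact: fsumr_ge0.
have qp k : 0 < qpoch q q k by exact: qpoch_gt0.
rewrite mulr_gt0//.
  rewrite /splitw mulr_gt0 ?qpoch_gt0//; apply: prodr_gt0 => j _.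
  rewrite qbinn// subnn expr0 !mul1r exprn_gt0//; apply: prodr_gt0 => k _.
  by rewrite ffunE subnn expr0.
rewrite /lower mulr_gt0 ?divr_gt0 ?exprn_gt0//; apply: prodr_gt0 => j mj.
rewrite ffunE [csub _ _ _]ffunE subnn addn0 mulr_gt0//.
  rewrite /qbin -BD// BA divr_gt0// mulr_gt0//.
case: AD => [D0|->//]; last by rewrite subnn expr0.
rewrite exprn_gt0//; apply: prodr_gt0 => k _; by rewrite D0 expr0.
Qed.

End Bounds.
End VertexWeight.

(** * Sums over the vertical labels of a column *)

Section ESum.
Variables (R : realType).
Local Open Scope ereal_scope.

Lemma ge0_esumZl (T : choiceType) (D : set T) (k : \bar R) (f : T -> \bar R) :
  0 <= k -> (forall i, 0 <= f i) ->
  \esum_(i in D) (k * f i) = k * \esum_(i in D) f i.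
Proof.
case: k => [k k0 f0|_ f0|//]; last first.
  have [f1|/existsNP[x /not_implyP[Dx /eqP fx]]] := pselect (forall i, D i -> f i = 0).
    by rewrite !esum1 ?mule0// => i Di; rewrite f1 ?mule0.
  have {}fx : 0 < f x by rewrite lt0e fx f0.
  rewrite gt0_mulye; last first.
    apply: lt_le_trans fx _; apply: esum_ge; exists [set x]; last by rewrite fsbig_set1.
    by split; [exact: finite_set1|move=> _ ->].
  apply/eqP; rewrite -leye_eq; apply: esum_ge; exists [set x].
    by split; [exact: finite_set1|move=> _ ->].
  by rewrite fsbig_set1 gt0_mulye.
rewrite /esum -ereal_supZl//; last first.
  by apply/set0P; exists (\sum_(x \in set0) f x); exists set0 => //; exact: fsets_set0.
rewrite image_comp; congr ereal_sup; apply: eq_imagel => X [Xfin XD] /=.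
by rewrite ge0_mule_fsumr.
Qed.

Lemma esum_geometric_lty (n : nat) (r : R) : (0 <= r < 1)%R ->
  \esum_(a in [set: color_counts n]) (r ^+ csum a)%:E < +oo.
Proof.
move=> /andP[r0 r1]; apply: (@le_lt_trans _ _ ((1 - r)^-1 ^+ n)%:E); last exact: ltry.
apply: ge_ereal_sup => _ [X [Xfin _] <-].
rewrite fsumEFin// lee_fin.
(* A finite set of labels lies in some box [0, M]^n, over which the sum factors into n truncated
   geometric series, each at most 1/(1 - r). *)
have r1V : (0 < 1 - r)%R by rewrite subr_gt0.
have [M XM] : exists M, forall a, X a -> forall i, (a i <= M)%N.
  have /finite_seqP[l lX] := Xfin.
  exists (\max_(a <- l) csum a)%N => a Xa i.
  have al : a \in l by move: Xa; rewrite lX.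
  apply: leq_trans (leq_bigmax_seq _ al isT).
  by rewrite /csum (bigD1 i)//= leq_addr.
pose h (g : {ffun 'I_n -> 'I_M.+1}) : color_counts n := [ffun i => val (g i)].
have hinj : set_inj setT h.
  move=> g g' _ _ /ffunP gg; apply/ffunP => i; apply: val_inj.
  by have := gg i; rewrite !ffunE.
apply: (@le_trans _ _ (\sum_(a \in h @` setT) r ^+ csum a)%R).
  have hfin : finite_set (h @` setT) by exact/finite_image/finite_finset.
  have Xh : X `<=` h @` setT.
    move=> a Xa; exists [ffun i => inord (a i)] => //.
    by apply/ffunP => i; rewrite !ffunE /= inordK// ltnS XM.
  rewrite (fsbigID X _ _ hfin)/= setIidr// lerDl.
  by apply: fsumr_ge0 => a _; rewrite exprn_ge0.
rewrite fsbig_image//.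
have -> : (\sum_(i \in [set: {ffun 'I_n -> 'I_M.+1}]) r ^+ csum (h i)
    = \prod_(i < n) \sum_(k < M.+1) r ^+ k)%R.
  rewrite bigA_distr_bigA/= (bigfs _ (index_enum_uniq _))/=; last first.
    by move=> g _; rewrite mem_index_enum.
  rewrite set_true; apply: eq_fsbigr => g _; rewrite /csum expr_sum.
  by apply: eq_bigr => i _; rewrite ffunE.
rewrite -[leRHS](_ : (\prod_(i < n) (1 - r)^-1)%R = _); last by rewrite prodr_const card_ord.
apply: ler_prod => i _; rewrite sumr_ge0/=; last by move=> k _; rewrite exprn_ge0.
rewrite -(ler_pM2l r1V) divff ?gt_eqF// -opprB mulNr -subrX1 opprB.
by rewrite gerBl exprn_ge0.
Qed.
End ESum.

(** * Cyclic row indices *)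

Section CyclicIndices.
Variable N : nat.
Implicit Types j k l : 'I_N.

Lemma ord_pred_neq (N_gt1 : (1 < N)%N) k : ord_pred k != k.
Proof.
rewrite -val_eqE/=; have := ltn_ord k; case: (val k) => [|k'] kN.
  by rewrite add0n modn_small; lia.
by rewrite addSn/= modnDr modn_small; lia.
Qed.

Lemma ordS_neq (N_gt1 : (1 < N)%N) k : ordS k != k.
Proof. by have := ord_pred_neq N_gt1 (ordS k); rewrite ordSK eq_sym. Qed.

Lemma ordS_eq j k : (ordS j == k) = (j == ord_pred k).
Proof. by rewrite -(inj_eq (can_inj (@ord_predK N))) ordSK. Qed.

Lemma ordS_connected (Q : 'I_N -> Prop) l : Q l -> (forall j, Q j -> Q (ordS j)) ->
  forall j, Q j.
Proof.
move=> Ql QS j.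
have H p : Q (iter p (@ordS N) l) by elim: p => //= p; exact: QS.
have iterE p : iter p (@ordS N) l = ((l + p) %% N)%N :> nat.
  elim: p => [|p IH]; first by rewrite addn0 modn_small.
  by rewrite iterS/= IH addnS -addn1 modnDml addn1.
have -> : j = iter (j + (N - l))%N (@ordS N) l; last exact: H.
apply: val_inj; rewrite [RHS]iterE addnCA subnKC ?modnDr; last by rewrite ltnW.
by rewrite modn_small.
Qed.

End CyclicIndices.

(** * One column as a kernel between configurations *)

Section Column.
Variables (R : realType) (n N : nat) (q : R).
Hypotheses (q_ge0 : 0 <= q) (q_lt1 : q < 1).
Variables (U : 'I_N -> R) (m : 'I_n) (s : R).
Hypotheses (U_gt0 : forall j, 0 < U j).
Implicit Types (V A B C D X : config N n) (j k : 'I_N) (i c : 'I_n).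

Local Notation W j := (qbos_weight q m s (U j)).
Local Notation beta := (qbeta q m).
Local Notation qgt := (qgt q).

Definition upd V k (a : color_counts n) : config N n :=
  [ffun j => if j == k then a else V j].

Lemma upd_same V k a : upd V k a k = a.
Proof. by rewrite ffunE eqxx. Qed.

Lemma upd_neq V k a j : j != k -> upd V k a j = V j.
Proof. by rewrite ffunE => /negbTE ->. Qed.

Lemma upd_upd V k a b : upd (upd V k a) k b = upd V k b.
Proof. by apply/ffunP => j; rewrite !ffunE; case: (j == k). Qed.

Lemma upd_id V k : upd V k (V k) = V.
Proof. by apply/ffunP => j; rewrite ffunE; case: eqP => [->|]. Qed.

Definition ring_shift V : config N n := [ffun j => V (ordS j)].

Lemma ring_shiftE V j : ring_shift V j = V (ordS j). Proof. by rewrite ffunE. Qed.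

(** [C] is kept independent of [ring_shift A]: in the intermediate terms of the intertwining the two
    ends of one vertical edge carry different labels. *)
Definition ring_weight A B C D : R := \prod_(j < N) W j (A j) (B j) (C j) (D j).

Definition ring_weight_but k A B C D : R :=
  \prod_(j < N | j != k) W j (A j) (B j) (C j) (D j).

Lemma ring_weightE k A B C D : ring_weight A B C D
  = W k (A k) (B k) (C k) (D k) * ring_weight_but k A B C D.
Proof. by rewrite /ring_weight (bigD1 k). Qed.

Lemma eq_ring_weight_but k A B C D A' B' C' D' :
  (forall j, j != k -> [/\ A j = A' j, B j = B' j, C j = C' j & D j = D' j]) ->
  ring_weight_but k A B C D = ring_weight_but k A' B' C' D'.
Proof. by move=> E; apply: eq_bigr => j /E[-> -> -> ->]. Qed.

Definition emit (a : color_counts n) i : R := (1 - q ^+ a i) * qgt a i.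

(** Realigns the terms of a local relation so that the untouched rows carry the same labels in all
    of them and the relation holds for each A. The total does not change, since removing a particle
    maps the labels that have one bijectively onto all labels. *)
Definition lift_shift k c (f : config N n -> R) A : R :=
  if (c == m) || (0 < A k c)%N then f (upd A k (cdecm m (A k) c)) else 0.

Definition free_config : set (config N n) :=
  [set A : config N n | forall j i, (i <= m)%N -> A j i = 0%N].

Lemma esum_lift_shift k c (f : config N n -> R) : (m <= c)%N ->
  (\esum_(A in free_config) (lift_shift k c f A)%:E
   = \esum_(A in free_config) (f A)%:E)%E.
Proof.
move=> mc; have [cm|cm] := eqVneq c m.
  by apply: eq_esum => A _; rewrite /lift_shift /cdecm cm eqxx upd_id.
have {}mc : (m < c)%N by rewrite ltn_neqAle mc andbT eq_sym.
transitivity (\esum_(A in free_config `&` [set A : config N n | (0 < A k c)%N])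
    (f (upd A k (cdec (A k) c)))%:E)%E.
  rewrite esum_mkcondr; apply: eq_esum => A _.
  rewrite /lift_shift /cdecm (negbTE cm)/=.
  have -> : (A \in [set A : config N n | (0 < A k c)%N]) = (0 < A k c)%N.
    by apply/idP/idP; rewrite inE.
  by case: ifP.
rewrite (@reindex_esum R _ _ free_config _ (fun A => upd A k (cinc (A k) c))).
  by apply: eq_esum => A _; rewrite upd_same cincK upd_upd upd_id.
split=> /=.
- move=> A A0; split=> /=; last by rewrite upd_same cincE.
  move=> j i im; rewrite ffunE; case: eqVneq => _; last exact: A0.
  by rewrite ffunE -val_eqE/= ltn_eqF ?addn0 ?A0// (leq_ltn_trans im).
- move=> A A' _ _ /ffunP E; apply/ffunP => j; have := E j; rewrite !ffunE.
  by case: eqVneq => // -> /(congr1 (fun a => cdec a c)); rewrite !cincK.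
- move=> A /= [A0 Ac]; exists (upd A k (cdec (A k) c)).
    move=> j i im; rewrite ffunE; case: eqVneq => _; last exact: A0.
    by rewrite ffunE A0.
  by rewrite upd_same cdecK// upd_upd upd_id.
Qed.

Hypothesis s2_lt : forall j, s ^+ 2 < U j.

Lemma ring_weight_ge0 A B C D : 0 <= ring_weight A B C D.
Proof. by apply: prodr_ge0 => j _; exact: qbos_weight_ge0. Qed.

Lemma ring_weight_neq0 A B C D : ring_weight A B C D != 0 ->
  forall j, conserved m (A j) (B j) (C j) (D j).
Proof.
move=> w0 j; apply: contraNT w0 => /negbTE jc.
by rewrite (ring_weightE j) qbos_weightE// jc !mul0r.
Qed.

Lemma ring_weight_le (B D : config N n) (r : R) : q <= r -> 0 < r -> r < 1 ->
  exists2 K, 0 <= K & forall A C l, free_config A ->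
    ring_weight A B C D <= K * (if (0 < D l m)%N then r ^+ csum (A l) else 1).
Proof.
move=> qr r0 r1.
have H j : {K : R | 0 <= K & forall A C : color_counts n, (forall i, (i <= m)%N -> A i = 0%N) ->
    W j A (B j) C (D j) <= K * (if (0 < D j m)%N then r ^+ csum A else 1)}.
  apply: cid2; exact: qbos_weight_le.
pose K j := s2val (H j).
have K_ge0 j : 0 <= K j by rewrite /K; case: (H j).
have KP j (A C : color_counts n) : (forall i, (i <= m)%N -> A i = 0%N) ->
    W j A (B j) C (D j) <= K j * (if (0 < D j m)%N then r ^+ csum A else 1).
  by rewrite /K; case: (H j) => /= K' _; exact.
exists (\prod_(j < N) K j); first by apply: prodr_ge0 => j _.
move=> A C l A0; pose z j : R := if (0 < D j m)%N then r ^+ csum (A j) else 1.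
apply: (@le_trans _ _ (\prod_(j < N) (K j * z j))).
  apply: ler_prod => j _; rewrite qbos_weight_ge0//=.
  exact/KP/A0.
rewrite big_split/= ler_wpM2l//; first by apply: prodr_ge0 => j _.
have z01 j : 0 <= z j <= 1.
  by rewrite /z; case: ifP => _; rewrite ?ler01 ?lexx// exprn_ge0 ?exprn_ile1 ?(ltW r0) ?(ltW r1).
rewrite (bigD1 l)//= -[leRHS]mulr1 ler_wpM2l//.
  by case/andP: (z01 l).
by apply: prodr_ile1 => j _; exact: z01.
Qed.

Definition balanced B D A := forall j i, i != m -> (A j i + B j i = A (ordS j) i + D j i)%N.

(** Conservation gives each label from the preceding one around the ring; color m, which is not
    conserved, is 0 in [free_config]. *)
Lemma balanced_inj B D l : {in free_config `&` balanced B D &,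
  injective (fun A : config N n => A l)}.
Proof.
move=> A A'; rewrite !inE => -[A0 Ab] [A'0 A'b] E; apply/ffunP.
apply: (ordS_connected (l := l)) => // j jE; apply/ffunP => i.
have [->|im] := eqVneq i m; first by rewrite A0 ?A'0.
have := Ab j i im; rewrite jE (A'b j i im) => /eqP.
by rewrite eqn_add2r => /eqP ->.
Qed.

(** By [balanced_inj] the sum over all rows is dominated by a geometric series in the label of the
    single row [l]. *)
Lemma esum_free_lty B D (f : config N n -> R) K r l : 0 <= r < 1 -> 0 <= K ->
  (forall A, 0 <= f A) ->
  (forall A, free_config A -> f A <= K * r ^+ csum (A l)) ->
  (forall A, free_config A -> f A != 0 -> balanced B D A) ->
  (\esum_(A in free_config) (f A)%:E < +oo)%E.
Proof.
move=> r01 K0 f0 fK fb.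
have -> : (\esum_(A in free_config) (f A)%:E
    = \esum_(A in free_config `&` balanced B D) (f A)%:E)%E.
  rewrite esum_mkcondr; apply: eq_esum => A Afree; case: ifPn => //.
  rewrite notin_setE => Ab; congr EFin; apply/eqP; apply: contra_notT Ab; exact: fb.
apply: (@le_lt_trans _ _ (\esum_(A in free_config `&` balanced B D)
    (K * r ^+ csum (A l))%:E)%E).
  by apply: le_esum => A [Afree _]; rewrite lee_fin fK.
rewrite -(@esum_image R _ _ _ (fun A : config N n => A l)
    (fun a => (K * r ^+ csum a)%:E)); last exact: balanced_inj.
apply: (@le_lt_trans _ _ (\esum_(a in [set: color_counts n]) (K%:E * (r ^+ csum a)%:E))%E).
  rewrite esum_mkcond; apply: le_esum => a _; rewrite -EFinM; case: ifP => // _.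
  by rewrite lee_fin mulr_ge0// exprn_ge0; case/andP: r01.
rewrite ge0_esumZl ?lee_fin//.
  by rewrite lte_mul_pinfty// esum_geometric_lty.
by move=> a; rewrite lee_fin exprn_ge0//; case/andP: r01.
Qed.

Definition column B D : \bar R :=
  \esum_(A in free_config) (ring_weight A B (ring_shift A) D)%:E.

(** A decay rate between q and 1 that is positive even for q = 0. *)
Let r := (1 + q) / 2.
Let qr : q <= r. Proof. by rewrite /r ler_pdivlMr//; have := q_lt1; lra. Qed.
Let r_gt0 : 0 < r. Proof. by rewrite /r divr_gt0// ltr_wpDr. Qed.
Let r_lt1 : r < 1. Proof. by rewrite /r ltr_pdivrMr//; have := q_lt1; lra. Qed.

Lemma column_ge0 B D : (0 <= column B D)%E.
Proof. by apply: esum_ge0 => A _; rewrite lee_fin ring_weight_ge0. Qed.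

Lemma column_lty B D l : (0 < D l m)%N -> (column B D < +oo)%E.
Proof.
move=> Dl; have [K K0 HK] := ring_weight_le B D qr r_gt0 r_lt1.
apply: (esum_free_lty (B := B) (D := D) (K := K) (r := r) (l := l)) => //.
- by rewrite r_lt1 ltW.
- by move=> A; exact: ring_weight_ge0.
- by move=> A A0; have := HK A (ring_shift A) l A0; rewrite Dl.
- move=> A _ /ring_weight_neq0 cons j i im.
  by have /conservedP[/(_ i im) + _] := cons j; rewrite ring_shiftE.
Qed.

(** * Summing the local relations around a ring with at least two sites *)

Section Boundary.
Hypothesis N_gt1 : (1 < N)%N.

Variables (B D : config N n).

Definition hop_left V k i := upd (upd V k (cdec (V k) i)) (ord_pred k)
  (cinc (V (ord_pred k)) i).
Definition hop_right V k i := upd (upd V k (cinc (V k) i)) (ord_pred k)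
  (cdec (V (ord_pred k)) i).

Local Notation prev := (@ord_pred N).

(* The hops of color i from row k to row k - 1 in B (left_hop_term) and in D
   (right_hop_term).  In the other terms the vertical line between the two rows
   carries the particle picked up from B (lift_term), the one about to be emitted
   to D (drop_term), both (exchange_term), or exchanges them in place (pass_term);
   A k is the part of its content that is common to all the terms. *)
Definition left_hop_term k i A : R :=
  emit (B k) i / U k * ring_weight A (hop_left B k i) (ring_shift A) D.
Definition right_hop_term k c A : R :=
  if (0 < D (prev k) c)%N then
    ((1 - q ^+ (D k c).+1) * qgt (D k) c) / U k
    * ring_weight A B (ring_shift A) (hop_right D k c) else 0.
Definition lift_term k i A : R :=
  emit (B k) i / U k
  * ring_weight (upd A k (cinc (A k) i)) (upd B k (cdec (B k) i)) (ring_shift A) D.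
Definition drop_term k c A : R :=
  if (m <= c)%N && (0 < D (prev k) c)%N then
    beta (cincm m (A k) c) c
    * ring_weight A B (upd (ring_shift A) (prev k) (cincm m (A k) c))
        (upd D (prev k) (cdec (D (prev k)) c)) else 0.
Definition exchange_term k i c A : R :=
  if [&& (m <= c)%N, (c < i)%N, (0 < D (prev k) c)%N & (0 < B k i)%N] then
    s ^+ 2 / U k * emit (B k) i * beta (cincm m (A k) c) c
    * ring_weight (upd A k (cinc (A k) i)) (upd B k (cdec (B k) i))
        (upd (ring_shift A) (prev k) (cincm m (A k) c)) (upd D (prev k) (cdec (D (prev k)) c)) else 0.
Definition pass_term k i A : R :=
  if (0 < D (prev k) i)%N && (0 < B k i)%N then
    s ^+ 2 / U k * emit (B k) i * (q ^+ A k i * qgt (A k) i)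
    * ring_weight A (upd B k (cdec (B k) i)) (ring_shift A) (upd D (prev k) (cdec (D (prev k)) i))
  else 0.

Hypothesis B0 : forall j i, (i <= m)%N -> B j i = 0%N.
Hypothesis D0 : forall j i, (i < m)%N -> D j i = 0%N.

Lemma emit0 (a : color_counts n) i : a i = 0%N -> emit a i = 0.
Proof. by rewrite /emit => ->; rewrite expr0 subrr mul0r. Qed.

(** The deposit relation at row k - 1. All other rows, with the particle already removed from B at
    row k, form the common factor [co]. *)
Lemma hop_deposit k i A :
  left_hop_term k i A + \sum_(c < n) lift_shift k i (exchange_term k i c) A
  = lift_shift k i (lift_term k i) A + pass_term k i A.
Proof.
have kk := ord_pred_neq N_gt1 k; have kk' : k != (prev k) by rewrite eq_sym.
have [im|mi] := leqP i m.
  have Bi := B0 k im.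
  rewrite /left_hop_term emit0// /pass_term Bi andbF addr0 !mul0r add0r big1 => [|c _].
    by rewrite /lift_shift /lift_term emit0// !mul0r if_same.
  by rewrite /lift_shift /exchange_term Bi !andbF if_same.
have im : (i == m) = false by rewrite -val_eqE/= gtn_eqF.
have [Bi|Bi] := posnP (B k i).
  rewrite /left_hop_term emit0// /pass_term Bi andbF addr0 !mul0r add0r big1 => [|c _].
    by rewrite /lift_shift /lift_term emit0// !mul0r if_same.
  by rewrite /lift_shift /exchange_term Bi !andbF if_same.
set rest := ring_weight_but (prev k) A (upd B k (cdec (B k) i)) (ring_shift A) D.
have shiftk : ring_shift A (prev k) = A k by rewrite ring_shiftE ord_predK.
pose co := emit (B k) i / U k * rest.
have -> : left_hop_term k i A = co * W (prev k) (A (prev k)) (cinc (B (prev k)) i) (A k) (D (prev k)).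
  rewrite /left_hop_term (ring_weightE (prev k)) /hop_left upd_same shiftk.
  rewrite (@eq_ring_weight_but _ _ _ _ _ A (upd B k (cdec (B k) i)) (ring_shift A) D) => [|j jk].
    by rewrite /co -/rest; ring.
  by rewrite upd_neq.
have cdecmE : cdecm m (A k) i = cdec (A k) i by rewrite /cdecm im.
have -> : lift_shift k i (lift_term k i) A
    = co * (if (0 < A k i)%N then W (prev k) (A (prev k)) (B (prev k)) (cdec (A k) i) (D (prev k)) else 0).
  rewrite /lift_shift im/=; case: ifP => Ai; last by rewrite mulr0.
  rewrite /lift_term cdecmE upd_upd upd_same cdecK// upd_id (ring_weightE (prev k)).
  rewrite upd_neq// ring_shiftE ord_predK upd_same.
  rewrite (@eq_ring_weight_but _ _ _ _ _ A (upd B k (cdec (B k) i)) (ring_shift A) D) => [|j jk].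
    by rewrite /co -/rest; ring.
  by split=> //; rewrite !ring_shiftE upd_neq// ordS_eq.
have -> : pass_term k i A = co * (if (0 < D (prev k) i)%N then
    s ^+ 2 * (q ^+ A k i * qgt (A k) i) * W (prev k) (A (prev k)) (B (prev k)) (A k) (cdec (D (prev k)) i) else 0).
  rewrite /pass_term Bi andbT; case: ifP => Di; last by rewrite mulr0.
  rewrite (ring_weightE (prev k)) upd_neq// shiftk upd_same.
  rewrite (@eq_ring_weight_but _ _ _ _ _ A (upd B k (cdec (B k) i)) (ring_shift A) D) => [|j jk].
    by rewrite /co -/rest; ring.
  by rewrite [upd D _ _ _]upd_neq.
rewrite (eq_bigr (fun c => co *
  (if [&& (m <= c)%N, (c < i)%N, (0 < D (prev k) c)%N & (0 < A k i)%N] then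
      s ^+ 2 * beta (cincm m (cdec (A k) i) c) c
        * W (prev k) (A (prev k)) (B (prev k)) (cincm m (cdec (A k) i) c) (cdec (D (prev k)) c) else 0))); last first.
  move=> c _; rewrite /lift_shift im/=; case: ifP => Ai; last by rewrite !andbF mulr0.
  rewrite /exchange_term Bi; case: ifP => _; last by rewrite mulr0.
  rewrite cdecmE upd_upd upd_same cdecK// upd_id (ring_weightE (prev k)) !upd_same.
  rewrite [upd B _ _ _]upd_neq//.
  rewrite (@eq_ring_weight_but _ _ _ _ _ A (upd B k (cdec (B k) i)) (ring_shift A) D) => [|j jk].
    by rewrite /co -/rest; ring.
  by split=> //; rewrite upd_neq// !ring_shiftE upd_neq// ordS_eq.
by rewrite -mulr_sumr -!mulrDr qbos_weight_cinc.
Qed.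

(** The pickup relation at row k. The common factor [rest] holds the other rows, with the particle
    already removed from D at row k - 1. *)
Lemma hop_pickup k c A : free_config A ->
  right_hop_term k c A + \sum_(i < n) lift_shift k c (exchange_term k i c) A
  = lift_shift k c (drop_term k c) A + pass_term k c A.
Proof.
move=> A0; have kk := ord_pred_neq N_gt1 k; have kk' : k != (prev k) by rewrite eq_sym.
have [Dc|Dc] := posnP (D (prev k) c).
  rewrite /right_hop_term /pass_term Dc/= big1 => [|i _]; first by rewrite /lift_shift /drop_term Dc andbF if_same.
  by rewrite /lift_shift /exchange_term Dc !andbF if_same.
have mc : (m <= c)%N by rewrite leqNgt; apply: contraTN Dc => /D0 ->.
set rest := ring_weight_but k A B (ring_shift A) (upd D (prev k) (cdec (D (prev k)) c)).
have shiftk : ring_shift A (prev k) = A k by rewrite ring_shiftE ord_predK.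
have -> : right_hop_term k c A = rest * (W k (A k) (B k) (A (ordS k)) (cinc (D k) c)
    * ((1 - q ^+ (D k c).+1) * qgt (D k) c) / U k).
  rewrite /right_hop_term Dc (ring_weightE k) /hop_right upd_neq// upd_same ring_shiftE.
  rewrite (@eq_ring_weight_but _ _ _ _ _ A B (ring_shift A) (upd D (prev k) (cdec (D (prev k)) c))) => [|j jk].
    by rewrite -/rest; ring.
  split=> //; case: (eqVneq j (prev k)) => [->|jk']; first by rewrite !upd_same.
  by rewrite !upd_neq.
have recover : (c == m) || (0 < A k c)%N -> cincm m (cdecm m (A k) c) c = A k.
  by rewrite /cincm /cdecm; case: eqVneq => //= _; exact: cdecK.
have -> : lift_shift k c (drop_term k c) A
    = rest * (if (c == m) || (0 < A k c)%N then
        beta (A k) c * W k (cdecm m (A k) c) (B k) (A (ordS k)) (D k) else 0).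
  rewrite /lift_shift; case: ifPn => Ac; last by rewrite mulr0.
  rewrite /drop_term mc Dc/= upd_same recover// (ring_weightE k) upd_same.
  rewrite upd_neq// ring_shiftE upd_neq ?(ordS_neq N_gt1)// [upd D _ _ _]upd_neq//.
  rewrite (@eq_ring_weight_but _ _ _ _ _ A B (ring_shift A) (upd D (prev k) (cdec (D (prev k)) c))) => [|j jk].
    by rewrite -/rest; ring.
  split=> //; first by rewrite upd_neq.
  case: (eqVneq j (prev k)) => [->|jk']; first by rewrite upd_same.
  by rewrite upd_neq// !ring_shiftE upd_neq// ordS_eq.
have -> : pass_term k c A = rest * (if (0 < B k c)%N then
    s ^+ 2 / U k * ((1 - q ^+ B k c) * qgt (B k) c) * (qinf q m (A k) c * qgt (A k) c)
           * W k (A k) (cdec (B k) c) (A (ordS k)) (D k) else 0).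
  rewrite /pass_term Dc/=; case: ifP => Bc; last by rewrite mulr0.
  have cm : (c == m) = false.
    by apply/negP => /eqP E; move: Bc; rewrite B0// E.
  rewrite (ring_weightE k) [upd D _ _ _]upd_neq// upd_same ring_shiftE.
  rewrite (@eq_ring_weight_but _ _ _ _ _ A B (ring_shift A) (upd D (prev k) (cdec (D (prev k)) c))) => [|j jk].
    by rewrite -/rest /qinf cm /emit; ring.
  by rewrite upd_neq.
rewrite (eq_bigr (fun i => rest *
  (if [&& (c < i)%N, (0 < B k i)%N & (c == m) || (0 < A k c)%N] then
      s ^+ 2 / U k * ((1 - q ^+ B k i) * qgt (B k) i) * beta (A k) c
        * W k (cinc (cdecm m (A k) c) i) (cdec (B k) i) (A (ordS k)) (D k) else 0))); last first.
  move=> i _; rewrite /lift_shift; case: ifPn => Ac; last by rewrite !andbF mulr0.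
  rewrite /exchange_term mc Dc !andbT/=; case: ifP => _; last by rewrite mulr0.
  rewrite upd_same recover// (ring_weightE k) !upd_same.
  rewrite upd_neq// ring_shiftE upd_neq ?(ordS_neq N_gt1)// [upd D _ _ _]upd_neq//.
  rewrite (@eq_ring_weight_but _ _ _ _ _ A B (ring_shift A) (upd D (prev k) (cdec (D (prev k)) c))) => [|j jk].
    by rewrite -/rest /emit; ring.
  split=> //.
  - by rewrite !upd_neq.
  - by rewrite upd_neq.
  - case: (eqVneq j (prev k)) => [->|jk']; first by rewrite upd_same.
    by rewrite upd_neq// !ring_shiftE upd_neq// ordS_eq.
by rewrite -mulr_sumr -!mulrDr qbos_weight_cdec// ?A0// B0.
Qed.

Lemma hop_flux k A :
  q ^+ csum (B k) / U k * ring_weight A B (ring_shift A) D + \sum_(i < n) lift_term k i A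
  = q ^+ csum (D k) / U k * ring_weight A B (ring_shift A) D + \sum_(c < n) drop_term (ordS k) c A.
Proof.
set rest := ring_weight_but k A B (ring_shift A) D.
pose co := rest / U k.
have Uk : U k != 0 by rewrite gt_eqF.
rewrite (ring_weightE k) -/rest ring_shiftE.
rewrite (eq_bigr (fun i => co * (if (0 < B k i)%N then
      (1 - q ^+ B k i) * qgt (B k) i
      * W k (cinc (A k) i) (cdec (B k) i) (A (ordS k)) (D k) else 0))); last first.
  move=> i _; rewrite /lift_term; case: posnP => [Bi|Bi]; first by rewrite emit0// !mul0r mulr0.
  rewrite (ring_weightE k) !upd_same ring_shiftE.
  rewrite (@eq_ring_weight_but _ _ _ _ _ A B (ring_shift A) D) => [|j jk].
    by rewrite -/rest /co /emit; ring.
  by rewrite !upd_neq.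
rewrite [X in _ = _ + X](eq_bigr (fun c => co * (U k * (if (m <= c)%N && (0 < D k c)%N then
        beta (cincm m (A (ordS k)) c) c
        * W k (A k) (B k) (cincm m (A (ordS k)) c) (cdec (D k) c) else 0)))); last first.
  move=> c _; rewrite /drop_term ordSK; case: ifP => _; last by rewrite !mulr0.
  rewrite (ring_weightE k) !upd_same.
  rewrite (@eq_ring_weight_but _ _ _ _ _ A B (ring_shift A) D) => [|j jk].
    by rewrite -/rest /co; field.
  by rewrite !upd_neq.
rewrite -!mulr_sumr.
transitivity (co * (q ^+ csum (B k) * W k (A k) (B k) (A (ordS k)) (D k)
  + \sum_(c < n) (if (0 < B k c)%N then
      (1 - q ^+ B k c) * qgt (B k) c
      * W k (cinc (A k) c) (cdec (B k) c) (A (ordS k)) (D k) else 0))).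
  by rewrite /co; ring.
by rewrite qbos_weight_flux// /co; ring.
Qed.

Variable l : 'I_N.
Hypothesis Dl : (0 < D l m)%N.

Local Notation Sm f := (\esum_(A in free_config) (f A)%:E)%E.

Lemma emit_ge0 (a : color_counts n) i : 0 <= emit a i.
Proof. by rewrite mulr_ge0 ?qgt_ge0// subr_ge0 exprn_ile1// ltW. Qed.

Lemma qbeta_ge0 (a : color_counts n) c : 0 <= beta a c.
Proof.
rewrite mulr_ge0 ?qgt_ge0// /qinf; case: ifP => _; first by rewrite subr0.
by rewrite subr_ge0 exprn_ile1// ltW.
Qed.

Lemma left_hop_term_ge0 k i A : 0 <= left_hop_term k i A.
Proof. by rewrite mulr_ge0 ?ring_weight_ge0// divr_ge0 ?emit_ge0// ltW. Qed.

Lemma lift_term_ge0 k i A : 0 <= lift_term k i A.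
Proof. by rewrite mulr_ge0 ?ring_weight_ge0// divr_ge0 ?emit_ge0// ltW. Qed.

Lemma right_hop_term_ge0 k c A : 0 <= right_hop_term k c A.
Proof.
rewrite /right_hop_term; case: ifP => // _; rewrite mulr_ge0 ?ring_weight_ge0//.
by rewrite divr_ge0 ?(ltW (U_gt0 _))// mulr_ge0 ?qgt_ge0// subr_ge0 exprn_ile1// ltW.
Qed.

Lemma drop_term_ge0 k c A : 0 <= drop_term k c A.
Proof.
by rewrite /drop_term; case: ifP => // _; rewrite mulr_ge0 ?ring_weight_ge0 ?qbeta_ge0.
Qed.

Lemma exchange_term_ge0 k i c A : 0 <= exchange_term k i c A.
Proof.
rewrite /exchange_term; case: ifP => // _; rewrite mulr_ge0 ?ring_weight_ge0//.
by rewrite mulr_ge0 ?qbeta_ge0// mulr_ge0 ?emit_ge0// divr_ge0 ?sqr_ge0 ?ltW.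
Qed.

Lemma pass_term_ge0 k i A : 0 <= pass_term k i A.
Proof.
rewrite /pass_term; case: ifP => // _; rewrite mulr_ge0 ?ring_weight_ge0//.
rewrite mulr_ge0//; last by rewrite mulr_ge0 ?exprn_ge0 ?qgt_ge0.
by rewrite mulr_ge0 ?emit_ge0// divr_ge0 ?sqr_ge0 ?ltW.
Qed.

Lemma lift_shift_ge0 k c (f : config N n -> R) A :
  (forall A, 0 <= f A) -> 0 <= lift_shift k c f A.
Proof. by rewrite /lift_shift => f0; case: ifP. Qed.

(** Finiteness is what lets the exchange sums, common to deposits and pickups, be cancelled. *)
Lemma esum_exchange_term_lty k i c : (Sm (exchange_term k i c) < +oo)%E.
Proof.
have [/and4P[mc ci Dc Bi]|cond] :=
  boolP [&& (m <= c)%N, (c < i)%N, (0 < D (prev k) c)%N & (0 < B k i)%N]; last first.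
  by rewrite esum1// => A _; rewrite /exchange_term (negbTE cond).
have mi : (m < i)%N by exact: leq_ltn_trans ci.
pose B' := upd B k (cdec (B k) i); pose D' := upd D (prev k) (cdec (D (prev k)) c).
have [K K0 HK] := ring_weight_le B' D' qr r_gt0 r_lt1.
pose co := s ^+ 2 / U k * emit (B k) i.
have co_ge0 : 0 <= co.
  by rewrite mulr_ge0 ?emit_ge0// divr_ge0 ?sqr_ge0 ?ltW.
pose X' X := upd X k (cinc (X k) i).
pose C' X := upd (ring_shift X) (prev k) (cincm m (X k) c).
have eE X : exchange_term k i c X = co * beta (cincm m (X k) c) c * ring_weight (X' X) B' (C' X) D'.
  by rewrite /exchange_term mc ci Dc Bi.
have X'free X : free_config X -> free_config (X' X).
  move=> X0 j c' cm; rewrite ffunE; case: eqVneq => _; last exact: X0.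
  by rewrite ffunE -val_eqE/= ltn_eqF ?addn0 ?X0// (leq_ltn_trans cm).
have beta_le1 a : beta a c <= 1.
  rewrite mulr_ile1 ?qgt_ge0//.
  - by rewrite /qinf; case: ifP; rewrite ?subr0// subr_ge0 exprn_ile1// ltW.
  - by rewrite /qinf; case: ifP; rewrite ?subr0// gerBl exprn_ge0.
  - by apply: prodr_ile1 => j _; rewrite exprn_ge0//= exprn_ile1// ltW.
(* If c != m, row [l] still emits color m and provides the decay. If c = m, that exit may be the
   very particle removed, but then [beta] at row k equals q^|X_k| and decays by itself. *)
pose l' := if c == m then k else l.
apply: (esum_free_lty (B := B) (D := D) (K := co * K) (r := r) (l := l')).
- by rewrite r_lt1 ltW.
- by rewrite mulr_ge0.
- exact: exchange_term_ge0.
- move=> X X0; rewrite eE -[leLHS]mulrA -[leRHS]mulrA ler_wpM2l//.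
  have rw0 := ring_weight_ge0 (X' X) B' (C' X) D'.
  rewrite /l'; case: (eqVneq c m) => [cm|cm].
    rewrite mulrC ler_pM ?qbeta_ge0//.
      apply: le_trans (HK _ (C' X) k (X'free _ X0)) _; rewrite ler_piMr//.
      by case: ifP => // _; rewrite exprn_ile1 ?(ltW r_gt0) ?(ltW r_lt1).
    rewrite cm /cincm eqxx /qbeta /qinf eqxx subr0 mul1r.
    have -> : qgt (X k) m = q ^+ csum (X k).
      rewrite (qcsum q (X k) m) X0// expr0 mulr1 /qlt big1 ?mul1r// => j jm.
      by rewrite X0 ?expr0// ltnW.
    by rewrite lerXn2r// nnegrE ltW.
  apply: (@le_trans _ _ (ring_weight (X' X) B' (C' X) D')).
    by rewrite ler_piMl.
  apply: le_trans (HK _ (C' X) l (X'free _ X0)) _.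
  have -> : (0 < D' l m)%N.
    rewrite /D' ffunE; case: eqVneq => // lk.
    by rewrite ffunE eq_sym (negbTE cm) subn0 -lk.
  rewrite ler_wpM2l// ler_wiXn2l ?(ltW r_gt0) ?(ltW r_lt1)//.
  rewrite /X' ffunE; case: eqVneq => [->|//].
  by rewrite csum_cinc.
- move=> X X0; rewrite eE mulf_eq0 negb_or => /andP[_ /ring_weight_neq0 cons] j i' im.
  have /conservedP[/(_ i' im) + _] := cons j.
  rewrite /X' /B' /C' /D' !ffunE.
  have -> : (if j == k then cinc (X k) i else X j) i' = (X j i' + ((j == k) && (i' == i)))%N.
    by case: eqVneq => [->|_]; rewrite ?ffunE ?addn0.
  have -> : (if j == k then cdec (B k) i else B j) i' = (B j i' - ((j == k) && (i' == i)))%N.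
    by case: eqVneq => [->|_]; rewrite ?ffunE ?subn0.
  have -> : (if j == prev k then cdec (D (prev k)) c else D j) i'
      = (D j i' - ((j == prev k) && (i' == c)))%N.
    by case: eqVneq => [->|_]; rewrite ?ffunE ?subn0.
  have -> : (if j == prev k then cincm m (X k) c else X (ordS j)) i'
      = (X (ordS j) i' + ((j == prev k) && (i' == c)))%N.
    case: eqVneq => [->|_]; rewrite ?addn0//= ord_predK /cincm.
    by case: (eqVneq c m) => [cm|_]; rewrite ?ffunE// cm (negbTE im) addn0.
  have b1 : ((j == k) && (i' == i) <= B j i')%N by case: (eqVneq j k) => // ->; case: eqVneq => // ->.
  have b2 : ((j == prev k) && (i' == c) <= D j i')%N.
    by case: (eqVneq j (prev k)) => // ->; case: eqVneq => // ->.
  by rewrite -addnA subnKC// -addnA subnKC.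
Qed.

Lemma hop_right_exit k c : (0 < D (prev k) c)%N -> exists j, (0 < hop_right D k c j m)%N.
Proof.
move=> Dc; have kk := ord_pred_neq N_gt1 k.
have [cm|cm] := eqVneq c m.
  by exists k; rewrite /hop_right upd_neq 1?eq_sym// upd_same cm cincE.
exists l; rewrite /hop_right; have [lk|lk] := eqVneq l (prev k).
  by rewrite lk upd_same ffunE eq_sym (negbTE cm) subn0 -lk.
rewrite upd_neq//; have [lk'|lk'] := eqVneq l k; last by rewrite upd_neq.
by rewrite lk' upd_same ffunE ltn_addr// -lk'.
Qed.

Lemma esum_lift_shift' k c (f : config N n -> R) :
  (m <= c)%N \/ (forall A, f A = 0) -> (Sm (lift_shift k c f) = Sm f)%E.
Proof.
case=> [mc|f0]; first exact: esum_lift_shift.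
by rewrite !esum1// => A _; rewrite ?f0// /lift_shift f0 if_same.
Qed.

Lemma esum_hop_deposit k i :
  (Sm (left_hop_term k i) + \sum_(c < n) Sm (exchange_term k i c) = Sm (lift_term k i) + Sm (pass_term k i))%E.
Proof.
have small f : (forall A, B k i = 0%N -> f A = 0 :> R) -> (m <= i)%N \/ (forall A, f A = 0).
  move=> f0; case: (leqP m i) => [|im]; [by left|right=> A].
  by rewrite f0// B0// ltnW.
rewrite -(@esum_lift_shift' k i (lift_term k i)); last first.
  by apply: small => A Bi; rewrite /lift_term emit0// !mul0r.
rewrite -esumD; [|by move=> A _; rewrite lee_fin lift_shift_ge0// => ?; exact: lift_term_ge0
  |by move=> A _; rewrite lee_fin pass_term_ge0].
rewrite (eq_bigr (fun c => Sm (lift_shift k i (exchange_term k i c)))); last first.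
  move=> c _; rewrite (@esum_lift_shift' k i (exchange_term k i c))//.
  by apply: small => A Bi; rewrite /exchange_term Bi !andbF.
rewrite -esum_sum; last first.
  by move=> A c _ _; rewrite lee_fin lift_shift_ge0// => ?; exact: exchange_term_ge0.
rewrite -esumD; last 2 first.
- by move=> A _; rewrite lee_fin left_hop_term_ge0.
- by move=> A _; apply: sume_ge0 => c _; rewrite lee_fin lift_shift_ge0// => ?; exact: exchange_term_ge0.
by apply: eq_esum => A _; rewrite sumEFin -!EFinD hop_deposit.
Qed.

Lemma esum_hop_pickup k c :
  (Sm (right_hop_term k c) + \sum_(i < n) Sm (exchange_term k i c) = Sm (drop_term k c) + Sm (pass_term k c))%E.
Proof.
have small f : (forall A, D (prev k) c = 0%N -> f A = 0 :> R) ->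
    (m <= c)%N \/ (forall A, f A = 0).
  move=> f0; case: (leqP m c) => [|im]; [by left|right=> A].
  by rewrite f0// D0.
rewrite -(@esum_lift_shift' k c (drop_term k c)); last first.
  by apply: small => A Di; rewrite /drop_term Di andbF.
rewrite -esumD; [|by move=> A _; rewrite lee_fin lift_shift_ge0// => ?; exact: drop_term_ge0
  |by move=> A _; rewrite lee_fin pass_term_ge0].
rewrite (eq_bigr (fun i => Sm (lift_shift k c (exchange_term k i c)))); last first.
  move=> i _; rewrite (@esum_lift_shift' k c (exchange_term k i c))//.
  by apply: small => A Di; rewrite /exchange_term Di !andbF.
rewrite -esum_sum; last first.
  by move=> A i _ _; rewrite lee_fin lift_shift_ge0// => ?; exact: exchange_term_ge0.
rewrite -esumD; last 2 first.
- by move=> A _; rewrite lee_fin right_hop_term_ge0.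
- by move=> A _; apply: sume_ge0 => i _; rewrite lee_fin lift_shift_ge0// => ?; exact: exchange_term_ge0.
by apply: eq_esum => A A0; rewrite sumEFin -!EFinD hop_pickup.
Qed.

Lemma esum_hop_flux k :
  ((q ^+ csum (B k) / U k)%:E * column B D + \sum_(i < n) Sm (lift_term k i)
   = (q ^+ csum (D k) / U k)%:E * column B D + \sum_(c < n) Sm (drop_term (ordS k) c))%E.
Proof.
have qU (a : color_counts n) : 0 <= q ^+ csum a / U k by rewrite divr_ge0 ?exprn_ge0// ltW.
have om A : (0 <= (ring_weight A B (ring_shift A) D)%:E)%E by rewrite lee_fin ring_weight_ge0.
rewrite /column -!ge0_esumZl ?lee_fin//.
rewrite -!esum_sum; try by move=> A c _ _; rewrite lee_fin ?lift_term_ge0 ?drop_term_ge0.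
rewrite -!esumD; try by move=> A _; rewrite mule_ge0 ?lee_fin ?qU ?ring_weight_ge0.
all: try by move=> A _; apply: sume_ge0 => c _; rewrite lee_fin ?lift_term_ge0 ?drop_term_ge0.
by apply: eq_esum => A _; rewrite !sumEFin -!EFinM -!EFinD hop_flux.
Qed.

Lemma esum_left_hop_term k i : (Sm (left_hop_term k i) = (emit (B k) i / U k)%:E * column (hop_left B k i) D)%E.
Proof.
rewrite /column -ge0_esumZl.
- by apply: eq_esum => A _; rewrite -EFinM.
- by rewrite lee_fin divr_ge0 ?emit_ge0// ltW.
- by move=> A; rewrite lee_fin ring_weight_ge0.
Qed.

Lemma esum_right_hop_term k c : (Sm (right_hop_term k c) = if (0 < D (prev k) c)%N then
   ((1 - q ^+ (D k c).+1) * qgt (D k) c / U k)%:E * column B (hop_right D k c) else 0)%E.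
Proof.
case: posnP => Dc; first by rewrite esum1// => A _; rewrite /right_hop_term Dc.
rewrite /column -ge0_esumZl.
- by apply: eq_esum => A _; rewrite -EFinM /right_hop_term Dc.
- rewrite lee_fin divr_ge0 ?(ltW (U_gt0 _))// mulr_ge0 ?qgt_ge0//.
  by rewrite subr_ge0 exprn_ile1// ltW.
- by move=> A; rewrite lee_fin ring_weight_ge0.
Qed.

(** The exchange and pass sums occur identically in the deposit and pickup identities, and the flux
    identity relates the lift and drop sums; eliminating all four leaves the balance. *)
Lemma column_balance :
  \sum_(k < N) \sum_(i < n) emit (B k) i / U k * fine (column (hop_left B k i) D)
  + \sum_(k < N) q ^+ csum (B k) / U k * fine (column B D)
  = \sum_(k < N) \sum_(c < n) (if (0 < D (prev k) c)%N then
      (1 - q ^+ (D k c).+1) * qgt (D k) c / U k * fine (column B (hop_right D k c)) else 0)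
  + \sum_(k < N) q ^+ csum (D k) / U k * fine (column B D).
Proof.
have finN (x : \bar R) : (0 <= x)%E -> (x < +oo)%E -> (fine x)%:E = x.
  by move=> x0 xoo; rewrite fineK// ge0_fin_numE.
have Sm_ge0 (f : config N n -> R) : (forall A, 0 <= f A) -> (0 <= Sm f)%E.
  by move=> f0; apply: esum_ge0 => A _; rewrite lee_fin.
have colE B' : (fine (column B' D))%:E = column B' D.
  by apply: finN; [exact: column_ge0|exact: column_lty Dl].
have hE k i : Sm (left_hop_term k i) = (emit (B k) i / U k * fine (column (hop_left B k i) D))%:E.
  by rewrite esum_left_hop_term [in RHS]EFinM colE.
have gE k c : Sm (right_hop_term k c) = (if (0 < D (prev k) c)%N then
      (1 - q ^+ (D k c).+1) * qgt (D k) c / U k * fine (column B (hop_right D k c)) else 0)%:E.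
  rewrite esum_right_hop_term; case: ifP => // Dc; rewrite [in RHS]EFinM finN ?column_ge0//.
  by have [j Dj] := hop_right_exit Dc; exact: column_lty Dj.
have eE k i c : (fine (Sm (exchange_term k i c)))%:E = Sm (exchange_term k i c).
  by apply: finN; [apply: Sm_ge0 => A; exact: exchange_term_ge0|exact: esum_exchange_term_lty].
pose e k i c := fine (Sm (exchange_term k i c)).
(* Finiteness of the hop and exchange sums passes to the lift and pass sums through the deposit
   identity, and below to the drop sums through the pickup identity. *)
have xp k i : (Sm (lift_term k i) + Sm (pass_term k i) < +oo)%E.
  rewrite -esum_hop_deposit hE; under eq_bigr do rewrite -eE.
  by rewrite sumEFin -EFinD ltry.
have x0 k i : (0 <= Sm (lift_term k i))%E by apply: Sm_ge0 => A; exact: lift_term_ge0.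
have p0 k i : (0 <= Sm (pass_term k i))%E by apply: Sm_ge0 => A; exact: pass_term_ge0.
have y0 k i : (0 <= Sm (drop_term k i))%E by apply: Sm_ge0 => A; exact: drop_term_ge0.
have xE k i : (fine (Sm (lift_term k i)))%:E = Sm (lift_term k i).
  by apply: finN => //; apply: le_lt_trans (xp k i); rewrite leeDl.
have pE k i : (fine (Sm (pass_term k i)))%:E = Sm (pass_term k i).
  by apply: finN => //; apply: le_lt_trans (xp k i); rewrite leeDr.
have yE k i : (fine (Sm (drop_term k i)))%:E = Sm (drop_term k i).
  apply: finN => //; apply: (@le_lt_trans _ _ (Sm (drop_term k i) + Sm (pass_term k i))%E).
    by rewrite leeDl.
  rewrite -esum_hop_pickup gE; under eq_bigr do rewrite -eE.
  by rewrite sumEFin -EFinD ltry.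
have eq1 k i : emit (B k) i / U k * fine (column (hop_left B k i) D)
    + \sum_(c < n) e k i c = fine (Sm (lift_term k i)) + fine (Sm (pass_term k i)).
  have := esum_hop_deposit k i; rewrite hE -xE -pE.
  under eq_bigr do rewrite -eE.
  by rewrite sumEFin -!EFinD => -[].
have eq2 k c : (if (0 < D (prev k) c)%N then
      (1 - q ^+ (D k c).+1) * qgt (D k) c / U k * fine (column B (hop_right D k c)) else 0)
    + \sum_(i < n) e k i c = fine (Sm (drop_term k c)) + fine (Sm (pass_term k c)).
  have := esum_hop_pickup k c; rewrite gE -yE -pE.
  under eq_bigr do rewrite -eE.
  by rewrite sumEFin -!EFinD => -[].
have eq3 k : q ^+ csum (B k) / U k * fine (column B D) + \sum_(i < n) fine (Sm (lift_term k i))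
   = q ^+ csum (D k) / U k * fine (column B D)
     + \sum_(c < n) fine (Sm (drop_term (ordS k) c)).
  have := esum_hop_flux k; rewrite -colE.
  under eq_bigr do rewrite -xE.
  under [X in _ = (_ + X)%E -> _]eq_bigr do rewrite -yE.
  by rewrite !sumEFin -!EFinM -!EFinD => -[].
pose S1 := \sum_(k < N) \sum_(i < n) emit (B k) i / U k * fine (column (hop_left B k i) D).
pose S2 := \sum_(k < N) q ^+ csum (B k) / U k * fine (column B D).
pose S3 := \sum_(k < N) \sum_(c < n) (if (0 < D (prev k) c)%N then
      (1 - q ^+ (D k c).+1) * qgt (D k) c / U k * fine (column B (hop_right D k c)) else 0).
pose S4 := \sum_(k < N) q ^+ csum (D k) / U k * fine (column B D).
rewrite -/S1 -/S2 -/S3 -/S4.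
pose X := \sum_(k < N) \sum_(i < n) fine (Sm (lift_term k i)).
pose Y := \sum_(k < N) \sum_(i < n) fine (Sm (drop_term k i)).
pose P := \sum_(k < N) \sum_(i < n) fine (Sm (pass_term k i)).
pose E := \sum_(k < N) \sum_(i < n) \sum_(c < n) e k i c.
have s1 : S1 + E = X + P.
  rewrite /S1 /E /X /P -!big_split; apply: eq_bigr => k _ /=.
  by rewrite -!big_split; apply: eq_bigr => i _ /=.
have s2 : S3 + E = Y + P.
  rewrite /S3 /E /Y /P -!big_split; apply: eq_bigr => k _ /=.
  by rewrite exchange_big -!big_split; apply: eq_bigr => c _ /=.
have s3 : S2 + X = S4 + Y.
  (* [drop_term k] modifies row k - 1, so the flux identity at row k involves it at k + 1; summing
     over the ring removes the offset. *)
  have -> : Y = \sum_(k < N) \sum_(c < n) fine (Sm (drop_term (ordS k) c)).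
    by rewrite /Y (reindex_inj (@ordS_inj N)).
  rewrite /S2 /S4 /X -!big_split; apply: eq_bigr => k _ /=; exact: eq3.
lra.
Qed.

End Boundary.
End Column.

(** * The partition function as a product of column kernels *)

Section LayerSum.
Variables (R : realType) (T T' : choiceType) (Z : set T).
Local Open Scope ereal_scope.

(** The kernel with index 0 is the rightmost column, applied last; [Z] holds the states allowed at
    the far left. *)
Fixpoint layer_sum p : ('I_p -> T -> T -> \bar R) -> T -> \bar R :=
  match p with
  | 0 => fun _ V => (V \in Z)%:R%:E
  | p'.+1 => fun K V => \esum_(V' in [set: T])
      (layer_sum (fun m => K (lift ord0 m)) V' * K ord0 V' V)
  end.

Lemma layer_sum_ge0 p (K : 'I_p -> T -> T -> \bar R) V :
  (forall m V' V, 0 <= K m V' V) -> 0 <= layer_sum K V.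
Proof.
elim: p K V => [|p IH] K V K0 /=; first by rewrite lee_fin ler0n.
by apply: esum_ge0 => V' _; rewrite mule_ge0// IH.
Qed.

Definition ffcons p (X : choiceType) (x : X) (f : {ffun 'I_p -> X}) : {ffun 'I_p.+1 -> X} :=
  [ffun m => oapp f x (unlift ord0 m)].

Lemma ffcons0 p (X : choiceType) (x : X) (f : {ffun 'I_p -> X}) : ffcons x f ord0 = x.
Proof. by rewrite ffunE unlift_none. Qed.

Lemma ffconsS p (X : choiceType) (x : X) (f : {ffun 'I_p -> X}) m :
  ffcons x f (lift ord0 m) = f m.
Proof. by rewrite ffunE liftK. Qed.

Definition behead_ff p (X : choiceType) (f : {ffun 'I_p.+1 -> X}) : {ffun 'I_p -> X} :=
  [ffun m => f (lift ord0 m)].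

Lemma ffcons_behead p (X : choiceType) (f : {ffun 'I_p.+1 -> X}) :
  ffcons (f ord0) (behead_ff f) = f.
Proof.
apply/ffunP => m; case: (unliftP ord0 m) => [m' ->|->]; last by rewrite ffcons0.
by rewrite ffconsS ffunE.
Qed.

Lemma behead_ffcons p (X : choiceType) (x : X) (f : {ffun 'I_p -> X}) :
  behead_ff (ffcons x f) = f.
Proof. by apply/ffunP => m; rewrite ffunE ffconsS. Qed.

Definition layered p (D : 'I_p -> set T') (V : T) :
    set ({ffun 'I_p.+1 -> T} * {ffun 'I_p -> T'}) :=
  [set HA : {ffun 'I_p.+1 -> T} * {ffun 'I_p -> T'} | [/\ Z (HA.1 ord_max), HA.1 ord0 = V & forall m, D m (HA.2 m)]].

Lemma esum_layered p (D : 'I_p -> set T') (w : 'I_p -> T' -> T -> T -> R) V :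
  (forall m a V' V, (0 <= w m a V' V)%R) ->
  \esum_(HA in layered D V)
    (\prod_(m < p) w m (HA.2 m) (HA.1 (lift ord0 m)) (HA.1 (widen_ord (leqnSn p) m)))%:E
  = layer_sum (fun m V' V => \esum_(a in D m) (w m a V' V)%:E) V.
Proof.
elim: p D w V => [|p IH] D w V w0 /=.
  have [VZ|VZ] := boolP (V \in Z); last first.
    rewrite esum1// => -[H A] [/= HZ HV _]; exfalso.
    move/negP: VZ; apply; rewrite inE -HV.
    by have -> : ord0 = ord_max :> 'I_1 by apply: val_inj.
  have -> : layered D V = [set ([ffun=> V], ffun0 (card_ord 0))].
    apply/seteqP; split=> [[H A]|_ ->] /=.
      move=> [/= _ HV _]; congr pair; apply/ffunP => m; last by case: m.
      by rewrite ffunE -HV; congr (H _); apply: val_inj; case: m => -[].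
    by split=> /=; rewrite ?ffunE//; [rewrite inE in VZ|case].
  by rewrite esum_set1 ?big_ord0// lee_fin.
(* Peels off column 0: [e] prepends the boundary [V] and the vertical labels of column 0 to a
   labelling of the remaining columns, whose right boundary is the first component of [x]. *)
pose e (x : (T * T') * ({ffun 'I_p.+1 -> T} * {ffun 'I_p -> T'})) :=
  (ffcons V x.2.1, ffcons x.1.2 x.2.2).
pose D' (m : 'I_p) := D (lift ord0 m).
pose P := [set x : T * T' | D ord0 x.2] `*`` (fun x => layered D' x.1).
have lift_max : lift ord0 ord_max = ord_max :> 'I_p.+2 by apply: val_inj.
have bije : set_bij P (layered D V) e.
  split=> /=.
  - move=> [[V' a] [H A]] [/= Da [/= HZ HV HA]]; split=> /=.
    + by rewrite -lift_max ffconsS.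
    + by rewrite ffcons0.
    + move=> m; case: (unliftP ord0 m) => [m' ->|->]; last by rewrite ffcons0.
      by rewrite ffconsS; exact: HA.
  - move=> [[V1 a1] [H1 A1]] [[V2 a2] [H2 A2]]; rewrite !inE.
    move=> [/= _ [/= _ HV1 _]] [/= _ [/= _ HV2 _]] [E1 E2].
    have EH : H1 = H2 by rewrite -(behead_ffcons V H1) E1 behead_ffcons.
    have EA : A1 = A2 by rewrite -(behead_ffcons a1 A1) E2 behead_ffcons.
    have Ea : a1 = a2 by rewrite -(ffcons0 a1 A1) E2 ffcons0.
    by rewrite -HV1 -HV2 EH EA Ea.
  - move=> [H A] [/= HZ HV HA].
    exists ((H (lift ord0 ord0), A ord0), (behead_ff H, behead_ff A)).
      split=> /=; first exact: HA.
      split=> /=; rewrite ?ffunE//; first by rewrite lift_max.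
      by move=> m; rewrite ffunE; exact: HA.
    by rewrite /e /= -HV !ffcons_behead.
rewrite (@reindex_esum R _ _ P _ e)//.
pose W (HA : {ffun 'I_p.+1 -> T} * {ffun 'I_p -> T'}) :=
  (\prod_(m < p) w (lift ord0 m) (HA.2 m) (HA.1 (lift ord0 m))
     (HA.1 (widen_ord (leqnSn p) m)))%R.
have W0 HA : (0 <= W HA)%R by exact: prodr_ge0.
transitivity (\esum_(x in P) ((w ord0 x.1.2 x.1.1 V)%:E * (W x.2)%:E)).
  apply: eq_esum => -[[V' a] [H A]] [/= _ [/= _ HV _]].
  rewrite -EFinM; congr EFin; rewrite big_ord_recl; congr (_ * _)%R.
    rewrite !ffcons0 ffconsS HV; congr (w _ _ _ _).
    have -> : widen_ord (leqnSn p.+1) ord0 = ord0 by exact: val_inj.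
    exact: ffcons0.
  apply: eq_bigr => m _; rewrite !ffconsS; congr (w _ _ _ _).
  have -> : widen_ord (leqnSn p.+1) (lift ord0 m) = lift ord0 (widen_ord (leqnSn p) m).
    exact: val_inj.
  by rewrite ffconsS.
rewrite /P -(@esum_esum R _ _ _ _ (fun x y => (w ord0 x.2 x.1 V)%:E * (W y)%:E)); last first.
  by move=> x y _ _; rewrite -EFinM lee_fin mulr_ge0.
have -> : [set x : T * T' | D ord0 x.2] = [set: T] `*`` (fun=> D ord0).
  by apply/seteqP; split=> x //= [].
transitivity (\esum_(x in [set: T] `*`` (fun=> D ord0))
    ((w ord0 x.2 x.1 V)%:E * layer_sum (fun m V' V => \esum_(a in D' m)
       (w (lift ord0 m) a V' V)%:E) x.1)).
  apply: eq_esum => x _; rewrite ge0_esumZl ?lee_fin//; congr (_ * _).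
  exact: (IH D' (fun m => w (lift ord0 m))).
pose L V' := layer_sum (fun m V' V => \esum_(a in D' m) (w (lift ord0 m) a V' V)%:E) V'.
have L0 V' : 0 <= L V'.
  by apply: layer_sum_ge0 => m V1 V2; apply: esum_ge0 => a _; rewrite lee_fin.
rewrite -(@esum_esum R _ _ _ _ (fun V' a => (w ord0 a V' V)%:E * L V')); last first.
  by move=> V' a _ _; rewrite mule_ge0// lee_fin.
apply: eq_esum => V' _; under eq_esum do rewrite muleC.
by rewrite ge0_esumZl// => a; rewrite lee_fin.
Qed.

End LayerSum.

(** * Stationarity and uniqueness *)

Section Sectors.
Variables (n N : nat).
Implicit Types (V W : config N n) (cnt : 'I_n -> nat) (j k : 'I_N) (i c : 'I_n).

Lemma finite_sector cnt : finite_set (@sector N n cnt).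
Proof.
pose M := csum cnt.
pose f (g : {ffun 'I_N -> {ffun 'I_n -> 'I_M.+1}}) : config N n :=
  [ffun j => [ffun i => val (g j i)]].
apply: (@sub_finite_set _ _ (f @` setT)); last exact/finite_image/finite_finset.
move=> V SV; exists [ffun j => [ffun i => inord (V j i)]] => //.
apply/ffunP => j; apply/ffunP => i; rewrite !ffunE /= inordK// ltnS.
apply: (@leq_trans (cnt i)); last by rewrite /M /csum (bigD1 i)//= leq_addr.
by rewrite -(SV i) (bigD1 j)//= leq_addr.
Qed.

Lemma sum_upd V k (a : color_counts n) i :
  (\sum_(j < N) upd V k a j i + V k i = \sum_(j < N) V j i + a i)%N.
Proof.
rewrite (bigD1 k)//= upd_same [in RHS](bigD1 k)//=.
rewrite (eq_bigr (fun j => V j i)) => [|j jk]; last by rewrite upd_neq.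
by lia.
Qed.

Section Hop.
Hypothesis N_gt1 : (1 < N)%N.

Lemma hop_leftE V k i : hop V k i = hop_left V k i.
Proof.
have kk := ord_pred_neq N_gt1 k; rewrite eq_sym in kk.
apply/ffunP => l; apply/ffunP => c; rewrite /hop_left !ffunE.
case: (eqVneq l (ord_pred k)) => [->|_].
  by rewrite eq_sym (negbTE kk) subn0 ffunE.
by case: (eqVneq l k) => [->|_] /=; rewrite ?ffunE addn0 ?subn0.
Qed.

Lemma hop_rightK V k i : (0 < V (ord_pred k) i)%N -> hop_left (hop_right V k i) k i = V.
Proof.
have kk := ord_pred_neq N_gt1 k; move=> Vi.
have Xk : hop_right V k i k = cinc (V k) i.
  by rewrite /hop_right upd_neq 1?eq_sym// upd_same.
have Xp : hop_right V k i (ord_pred k) = cdec (V (ord_pred k)) i by exact: upd_same.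
rewrite /hop_left Xk Xp cincK cdecK//; apply/ffunP => j; rewrite !ffunE.
by case: (eqVneq j (ord_pred k)) => [->//|_]; case: eqVneq => [->|].
Qed.

Lemma hop_leftK V k i : (0 < V k i)%N -> hop_right (hop_left V k i) k i = V.
Proof.
have kk := ord_pred_neq N_gt1 k; move=> Vi.
have Xk : hop_left V k i k = cdec (V k) i.
  by rewrite /hop_left upd_neq 1?eq_sym// upd_same.
have Xp : hop_left V k i (ord_pred k) = cinc (V (ord_pred k)) i by exact: upd_same.
rewrite /hop_right Xk Xp cincK cdecK//; apply/ffunP => j; rewrite !ffunE.
by case: (eqVneq j (ord_pred k)) => [->//|_]; case: eqVneq => [->|].
Qed.

Lemma sector_hop_left cnt V k i : sector cnt V -> (0 < V k i)%N ->
  sector cnt (hop_left V k i).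
Proof.
move=> SV Vk c; have kk := ord_pred_neq N_gt1 k.
have := sum_upd (upd V k (cdec (V k) i)) (ord_pred k) (cinc (V (ord_pred k)) i) c.
have := sum_upd V k (cdec (V k) i) c; rewrite -/(hop_left V k i) SV.
rewrite [upd V _ _ (ord_pred k)]upd_neq// !ffunE.
by case: (eqVneq c i) => [->|_]; lia.
Qed.

Lemma sector_hop_right cnt V k i : sector cnt V -> (0 < V (ord_pred k) i)%N ->
  sector cnt (hop_right V k i).
Proof.
move=> SV Vk c; have kk := ord_pred_neq N_gt1 k.
have := sum_upd (upd V k (cinc (V k) i)) (ord_pred k) (cdec (V (ord_pred k)) i) c.
have := sum_upd V k (cinc (V k) i) c; rewrite -/(hop_right V k i) SV.
rewrite [upd V _ _ (ord_pred k)]upd_neq// !ffunE.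
by case: (eqVneq c i) => [->|_]; lia.
Qed.

End Hop.

(** * The generator acting on functions and on measures *)

Section Generator.
Variables (R : realType) (q : R) (u : 'I_N -> R).
Local Notation gen := (generator q u).
Local Notation rate := (hop_rate q u).

Lemma hop_rateE V k i : rate V k i = emit q (V k) i / u k.
Proof. by rewrite /hop_rate /emit expr_sum -/(qgt q (V k) i); ring. Qed.

Lemma sum_rate V k : \sum_(i < n) rate V k i = (1 - q ^+ csum (V k)) / u k.
Proof.
rewrite -telescope_qgt mulr_suml; apply: eq_bigr => i _.
by rewrite hop_rateE /emit; ring.
Qed.

Lemma rate0 V k i : V k i = 0%N -> rate V k i = 0.
Proof. by move=> Vk; rewrite hop_rateE emit0// mul0r. Qed.

Lemma fsum_delta (S : set (config N n)) V (F : config N n -> R) :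
  finite_set S -> S V -> \sum_(V' \in S) (V == V')%:R * F V' = F V.
Proof.
move=> Sfin SV; rewrite (fsbigD1 V)//= eqxx mul1r fsbig1 ?addr0// => V' [_ /eqP].
by rewrite eq_sym => /negbTE ->; rewrite mul0r.
Qed.

Lemma generator_forward cnt V (F : config N n -> R) : (1 < N)%N -> sector cnt V ->
  \sum_(V' \in sector cnt) gen V V' * F V'
  = \sum_(k < N) \sum_(i < n) rate V k i * F (hop_left V k i)
    - \sum_(k < N) (1 - q ^+ csum (V k)) / u k * F V.
Proof.
move=> N_gt1 SV; have Sfin := finite_sector cnt.
rewrite -sumrB.
under eq_fsbigr => V' _ do rewrite mulr_suml.
rewrite fsbig_finite//= exchange_big/=; apply: eq_bigr => k _.
rewrite -sum_rate mulr_suml -sumrB.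
under eq_bigr => V' _ do rewrite mulr_suml.
rewrite exchange_big/=; apply: eq_bigr => i _; rewrite -fsbig_finite//=.
have [Vk|Vk] := posnP (V k i).
  by rewrite rate0// fsbig1 => [|V' _]; rewrite !mul0r ?subr0.
rewrite -mulrBr; under eq_fsbigr => V' _ do rewrite -mulrA mulrBl.
rewrite -mulr_fsumr; congr (_ * _).
have SH := sector_hop_left N_gt1 SV Vk.
under eq_fsbigr => V' _ do rewrite hop_leftE//.
transitivity (\sum_(V' \in sector cnt) ((hop_left V k i == V')%:R * F V'
   + - 1 * ((V == V')%:R * F V'))).
  by apply: eq_fsbigr => V' _; ring.
rewrite fsbig_split//=.
rewrite -(mulr_fsumr (-1) (sector cnt) (fun V' => (V == V')%:R * F V')).
by rewrite (fsum_delta F Sfin SH) (fsum_delta F Sfin SV) mulN1r.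
Qed.

(** For each k and i the only configuration that can enter W by such a hop is [hop_right W k i], and
    it exists only if W has color i at k - 1. *)
Lemma generator_backward cnt W (F : config N n -> R) : (1 < N)%N -> sector cnt W ->
  \sum_(V \in sector cnt) F V * gen V W
  = \sum_(k < N) \sum_(i < n) (if (0 < W (ord_pred k) i)%N then
        rate (hop_right W k i) k i * F (hop_right W k i) else 0)
    - \sum_(k < N) (1 - q ^+ csum (W k)) / u k * F W.
Proof.
move=> N_gt1 SW; have Sfin := finite_sector cnt.
rewrite -sumrB.
under eq_fsbigr => V' _ do rewrite mulr_sumr.
rewrite fsbig_finite//= exchange_big/=; apply: eq_bigr => k _.
rewrite -sum_rate mulr_suml -sumrB.
under eq_bigr => V' _ do rewrite mulr_sumr.
rewrite exchange_big/=; apply: eq_bigr => i _; rewrite -fsbig_finite//=.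
transitivity (\sum_(V \in sector cnt) (rate V k i * F V * (hop V k i == W)%:R
   + - 1 * ((W == V)%:R * (rate V k i * F V)))).
  by apply: eq_fsbigr => V _; rewrite (eq_sym W V); ring.
rewrite fsbig_split//=.
rewrite -(mulr_fsumr (-1) (sector cnt) (fun V => (W == V)%:R * (rate V k i * F V))).
rewrite (fsum_delta (fun V => rate V k i * F V) Sfin SW) mulN1r; congr (_ - _).
have hopW V : V k i != 0%N -> hop V k i = W ->
    (0 < W (ord_pred k) i)%N /\ V = hop_right W k i.
  rewrite -lt0n hop_leftE// => Vk <-; rewrite hop_leftK//; split=> //.
  by rewrite /hop_left upd_same cincE.
case: posnP => [Wk|Wk].
  rewrite fsbig1// => V _; case: (eqVneq (hop V k i) W) => [hV|]; last by rewrite mulr0.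
  have [Vk|/hopW/(_ hV)[]] := eqVneq (V k i) 0%N; last by rewrite Wk.
  by rewrite rate0// !mul0r.
rewrite (fsbigD1 (hop_right W k i))//=; last exact: sector_hop_right.
rewrite hop_leftE// hop_rightK// eqxx mulr1 fsbig1 ?addr0// => V [_ /= VW].
case: (eqVneq (hop V k i) W) => [hV|]; last by rewrite mulr0.
have [Vk|/hopW/(_ hV)[_ /VW//]] := eqVneq (V k i) 0%N.
by rewrite rate0// !mul0r.
Qed.

Lemma generator_ring1 cnt V W : N = 1%N -> sector cnt V -> gen V W = 0.
Proof.
move=> N1 SV; rewrite /generator big1// => k _; rewrite big1// => i _.
have [Vk|Vk] := posnP (V k i); first by rewrite rate0// mul0r.
have kE (j : 'I_N) : j = k.
  have jN : (j < 1)%N by rewrite -N1.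
  have kN : (k < 1)%N by rewrite -N1.
  by apply: val_inj => /=; move: jN kN; rewrite !ltnS !leqn0 => /eqP -> /eqP ->.
have -> : hop V k i = V; last by rewrite subrr mulr0.
apply/ffunP => l; apply/ffunP => c; rewrite !ffunE (kE l) (kE (ord_pred k)) eqxx/=.
by case: eqVneq => [->|_]; rewrite ?subn0 ?addn0// subnK.
Qed.

End Generator.
End Sectors.

(** * Stationarity of the partition function *)

Section Stationarity.
Variables (R : realType) (n N : nat) (q : R) (u : 'I_N -> R).
Variables (cnt : 'I_n -> nat) (y s : 'I_n -> R).
Hypotheses (N_ge1 : (1 <= N)%N) (q_ge0 : 0 <= q) (q_lt1 : q < 1).
Hypothesis u_gt0 : forall j, 0 < u j.
Hypothesis cnt_ge1 : forall i, (1 <= cnt i)%N.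
Hypothesis s2_lt : forall (j : 'I_N) (m : 'I_n), 0 <= s m ^+ 2 < u j * y m.
Implicit Types (V W B D : config N n) (j k : 'I_N) (i c m : 'I_n).

Local Notation gen := (generator q u).

Definition spectral m j : R := u j * y m.

Lemma spectral_gt0 m j : 0 < spectral m j.
Proof. by have /andP[] := s2_lt j m; exact: le_lt_trans. Qed.

Lemma spectral_gt_s2 m j : s m ^+ 2 < spectral m j.
Proof. by have /andP[] := s2_lt j m. Qed.

Definition column_kernel m V' V : \bar R := column q (spectral m) m (s m) V' V.

Definition counts_from (l : nat) i : nat := if (l <= i)%N then cnt i else 0%N.

(** The possible outputs of column [l]: the colors from [l] on have entered with their final counts,
    and the lower ones are still absent. *)
Definition level l : set (config N n) := sector (counts_from l).

Lemma level_below l V j i : level l V -> (i < l)%N -> V j i = 0%N.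
Proof.
move=> /(_ i); rewrite /counts_from => + il; rewrite leqNgt il/= => /eqP.
by rewrite sum_nat_eq0 => /forallP/(_ j)/eqP.
Qed.

Lemma level_exit m V : level m V -> exists j, (0 < V j m)%N.
Proof.
move=> /(_ m); rewrite /counts_from leqnn => Vm; apply: contrapT => /forallNP V0.
have := cnt_ge1 m; rewrite -Vm big1// => j _.
by apply/eqP; rewrite -leqn0 leqNgt; apply/negP/V0.
Qed.

Lemma intertwining m B D : (1 < N)%N -> level m.+1 B -> level m D ->
  \sum_(V \in level m) fine (column_kernel m B V) * gen V D
  = \sum_(V \in level m.+1) gen B V * fine (column_kernel m V D).
Proof.
move=> N_gt1 LB LD.
have y0 : y m != 0.
  have := spectral_gt0 m (Ordinal N_ge1); rewrite /spectral; apply: contraTneq => ->.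
  by rewrite mulr0 ltxx.
have u0 k : u k != 0 by rewrite gt_eqF.
have [l Dl] := level_exit LD.
have B0 j i : (i <= m)%N -> B j i = 0%N by move=> im; exact: level_below LB _.
have D0 j i : (i < m)%N -> D j i = 0%N by move=> im; exact: level_below LD _.
have := column_balance q_ge0 q_lt1 (spectral_gt0 m) (spectral_gt_s2 m) N_gt1 B0 D0 Dl.
(* The balance has denominators u_k y_m; the factor y_m turns its coefficients into the hop rates,
   which are the same for all columns. *)
move=> /(congr1 ( *%R (y m))); rewrite !mulrDr !mulr_sumr.
rewrite (generator_backward q u (fun V => fine (column_kernel m B V)) N_gt1 LD).
rewrite (generator_forward q u (fun V => fine (column_kernel m V D)) N_gt1 LB).
rewrite (eq_bigr (fun k => \sum_(i < n) hop_rate q u B k i * fine (column_kernel m (hop_left B k i) D))); last first.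
  move=> k _; rewrite mulr_sumr; apply: eq_bigr => i _.
  by rewrite hop_rateE /spectral /column_kernel; field; rewrite u0 y0.
rewrite [X in _ = X + _ -> _](eq_bigr (fun k => \sum_(i < n) (if (0 < D (ord_pred k) i)%N then
        hop_rate q u (hop_right D k i) k i * fine (column_kernel m B (hop_right D k i)) else 0))); last first.
  move=> k _; rewrite mulr_sumr; apply: eq_bigr => i _; case: ifP => _; last by rewrite mulr0.
  rewrite hop_rateE /emit.
  have -> : hop_right D k i k = cinc (D k) i.
    by rewrite /hop_right upd_neq ?upd_same// eq_sym ord_pred_neq.
  by rewrite cincE qgt_cinc_same /spectral /column_kernel; field; rewrite u0 y0.
set S1 := \sum_(k < N) \sum_(i < n) _ * fine _; set S3 := \sum_(k < N) \sum_(i < n) (if _ then _ else _).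
(* The exit rates of B and D both contain the sum of the 1/u_k, which cancels and leaves the flux
   terms of [column_balance]. *)
have E (X : config N n) : \sum_(k < N) (1 - q ^+ csum (X k)) / u k * fine (column_kernel m B D)
   = \sum_(k < N) fine (column_kernel m B D) / u k
     - \sum_(k < N) y m * (q ^+ csum (X k) / spectral m k * fine (column q (spectral m) m (s m) B D)).
  rewrite -sumrB; apply: eq_bigr => k _; rewrite /spectral /column_kernel; field.
  by rewrite u0 y0.
by rewrite !E; lra.
Qed.

Lemma column_conserved m B D : column_kernel m B D != 0%E ->
  (forall i, i != m -> (\sum_(j < N) B j i = \sum_(j < N) D j i)%N)
  /\ (forall j i, (i < m)%N -> D j i = 0%N).
Proof.
move=> K0; have [A cons] : exists A : config N n,
    forall j, conserved m (A j) (B j) (ring_shift A j) (D j).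
  apply: contrapT => /forallNP H; move/negP: K0; apply; apply/eqP; apply: esum1 => A _.
  congr EFin; apply/eqP; apply: contrapT => /negP w0; apply: (H A) => j.
  exact: (ring_weight_neq0 q_ge0 q_lt1 (spectral_gt0 m) w0 j).
split=> [i im|j i im]; last first.
  by have /conservedP[_ ->] := cons j.
apply/eqP; rewrite -(eqn_add2l (\sum_(j < N) (A j : color_counts n) i)%N) -big_split/=.
rewrite (eq_bigr (fun j : 'I_N => (A (ordS j) i + D j i)%N)); last first.
  by move=> j _; have /conservedP[/(_ i im) -> _] := cons j; rewrite ring_shiftE.
by rewrite big_split/= [X in (_ == X + _)%N](reindex_inj (@ordS_inj N)).
Qed.

Definition empty_config : set (config N n) :=
  [set V : config N n | forall j i, V j i = 0%N].

(** Stationarity is proved together with the support and finiteness statements: the support confines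
    the sum over V' to the finite set [level l.+1], and finiteness allows it to be computed in the
    reals. *)
Lemma layer_stationary p (l : nat) (idx : 'I_p -> 'I_n)
    (G := layer_sum empty_config (fun h => column_kernel (idx h))) :
  (forall h : 'I_p, idx h = (l + h)%N :> nat) -> (l + p = n)%N ->
  [/\ forall V, G V != 0%E -> forall j i, (i < l)%N -> V j i = 0%N,
      forall V, level l V -> G V \is a fin_num
    & forall W, level l W -> \sum_(V \in level l) fine (G V) * gen V W = 0].
Proof.
elim: p l idx @G => [|p IH] l idx G idxE lpn.
  rewrite addn0 in lpn; split=> //.
  - move=> V; rewrite /G /=; case: (boolP (V \in _)) => [|_]; last by rewrite eqxx.
    by rewrite inE => V0 _ j i _; exact: V0.
  - move=> W _; apply: fsbig1 => V LV; rewrite /generator big1 ?mulr0// => k _.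
    rewrite big1// => i _; rewrite rate0 ?mul0r//; apply: (level_below _ LV).
    by rewrite lpn.
pose m := idx ord0; have mE : m = l :> nat by rewrite /m idxE addn0.
have [] := IH l.+1 (fun h => idx (lift ord0 h)).
- by move=> k; rewrite idxE /= /bump /= add1n addnS addSn.
- by rewrite addSnnS.
set G' := layer_sum _ _ => supp' fin' stat'.
have G'0 V : (0 <= G' V)%E.
  by apply: layer_sum_ge0 => k V' V''; exact: (column_ge0 q_ge0 q_lt1 _ (spectral_gt0 _) (spectral_gt_s2 _)).
have K0 V' V : (0 <= column_kernel m V' V)%E by exact: (column_ge0 q_ge0 q_lt1 _ (spectral_gt0 _) (spectral_gt_s2 _)).
have lev V' V : level l V -> (G' V' * column_kernel m V' V != 0)%E -> level l.+1 V'.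
  move=> LV; rewrite mule_eq0 negb_or => /andP[/supp' V'0 /column_conserved[cons _]] i.
  rewrite /counts_from; case: (ltngtP l i) => [li|il|li].
  - rewrite cons; first by rewrite (LV i) /counts_from ltnW.
    by rewrite -val_eqE/= mE gtn_eqF.
  - by rewrite big1// => j _; rewrite V'0// ltnW.
  - by rewrite big1// => j _; rewrite V'0// -li.
have Lfin := @finite_sector n N.
have GE V : level l V ->
    G V = (\sum_(V' \in level l.+1) fine (G' V') * fine (column_kernel m V' V))%:E.
  move=> LV; have [j Vj] : exists j, (0 < V j m)%N by apply: level_exit; rewrite mE.
  transitivity (\esum_(V' in level l.+1) (G' V' * column_kernel m V' V))%E.
    rewrite [RHS]esum_mkcond; apply: eq_esum => V' _; case: ifPn => //.
    by rewrite notin_setE => LV'; apply/eqP; apply: contra_notT LV'; exact: lev.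
  rewrite esum_fset; [|exact: Lfin|by move=> V' _; rewrite mule_ge0].
  rewrite -fsumEFin; last exact: Lfin.
  apply: eq_fsbigr => V'; rewrite inE => LV'; rewrite EFinM !fineK//; last exact: fin'.
  rewrite ge0_fin_numE//.
  exact: (column_lty q_ge0 q_lt1 (spectral_gt0 _) (spectral_gt_s2 _) _ Vj).
split.
- move=> V GV j i il; have [V' V'K] : exists V', column_kernel m V' V != 0%E.
    apply: contrapT => /forallNP H; move/negP: GV; apply; apply/eqP; apply: esum1 => V' _.
    by have /negP := H V'; rewrite negbK => /eqP ->; rewrite mule0.
  by have [_ ->//] := column_conserved V'K; rewrite mE.
- by move=> V LV; rewrite GE.
- move=> W LW.
  have [N1|N_gt1] : N = 1%N \/ (1 < N)%N by case: (N) N_ge1 => [|[|]]; auto.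
    by apply: fsbig1 => V LV; rewrite (generator_ring1 q u W N1 LV) mulr0.
  have LmE : level l = level m by rewrite mE.
  have LmE' : level l.+1 = level m.+1 by rewrite mE.
  (* In matrix form, G = G' K and the intertwining give G gen = G' K gen = (G' gen) K = 0. *)
  transitivity (\sum_(V \in level l) \sum_(V' \in level l.+1)
      fine (G' V') * (fine (column_kernel m V' V) * gen V W)).
    apply: eq_fsbigr => V; rewrite inE => LV; rewrite GE//= mulr_fsuml.
    by apply: eq_fsbigr => V' _; rewrite mulrA.
  rewrite exchange_fsbig; [|exact: Lfin|exact: Lfin].
  transitivity (\sum_(V' \in level l.+1) \sum_(V \in level l.+1)
      fine (G' V') * (gen V' V * fine (column_kernel m V W))).
    apply: eq_fsbigr => V'; rewrite inE => LV'.
    rewrite -(mulr_fsumr (fine (G' V')) _ (fun V => fine (column_kernel m V' V) * gen V W)).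
    rewrite -(mulr_fsumr (fine (G' V')) _ (fun V => gen V' V * fine (column_kernel m V W))).
    congr (_ * _).
    by rewrite LmE LmE' intertwining// -?LmE -?LmE'.
  rewrite exchange_fsbig; [|exact: Lfin|exact: Lfin].
  apply: fsbig1 => V LV.
  transitivity (\sum_(V' \in level l.+1) (fine (G' V') * gen V' V) * fine (column_kernel m V W)).
    by apply: eq_fsbigr => V' _; rewrite mulrA.
  by rewrite -mulr_fsuml stat'// mul0r.
Qed.

Lemma cylinder_layer_sum V : cylinder_partition_function q u y s V
  = layer_sum empty_config column_kernel V.
Proof.
rewrite /column_kernel /column.
rewrite -(@esum_layered R (config N n) (config N n) empty_config n (@free_config n N)
  (fun m A V' V => ring_weight q (spectral m) m (s m) A V' (ring_shift A) V)); last first.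
  by move=> m A V' V'' /=; exact: (ring_weight_ge0 q_ge0 q_lt1 _ (spectral_gt0 _) (spectral_gt_s2 _)).
apply: eq_esum => HA _; congr EFin; apply: eq_bigr => m _; apply: eq_bigr => j _.
by rewrite ring_shiftE.
Qed.

Lemma cylinder_stationary :
  (forall V, sector cnt V -> cylinder_partition_function q u y s V \is a fin_num) /\
  (forall W, sector cnt W -> \sum_(V \in sector cnt)
     fine (cylinder_partition_function q u y s V) * gen V W = 0).
Proof.
have [_ fin stat] := @layer_stationary n 0 id (fun m => erefl) (erefl n).
by split=> [V SV|W SW]; [rewrite cylinder_layer_sum fin|
  under eq_fsbigr do rewrite cylinder_layer_sum; exact: stat].
Qed.

Definition site0 : 'I_N := Ordinal N_ge1.

Definition pile (l : nat) : config N n :=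
  [ffun j => [ffun i => if j == site0 then counts_from l i else 0%N]].

Lemma pile_sector : sector cnt (pile 0).
Proof.
move=> i; rewrite (bigD1 site0)//= !ffunE eqxx big1 ?addn0// => j /negbTE j0.
by rewrite !ffunE j0.
Qed.

Lemma cylinder_pile_gt0 : (0 < cylinder_partition_function q u y s (pile 0))%E.
Proof.
(* All horizontal particles travel in row 0, and in every row the vertical line of column m carries
   all particles of the colors above m. Then at row 0 the lower label and D agree above m, while
   elsewhere D = 0, as [qbos_weight_gt0] asks. *)
pose HA : labelling N n :=
  ([ffun h : 'I_n.+1 => pile h], [ffun m : 'I_n => [ffun=> [ffun i => counts_from m.+1 i]]]).
apply: (@lt_le_trans _ _ (labelling_weight q u y s HA)%:E); last first.
  apply: esum_ge; exists [set HA]; last by rewrite fsbig_set1.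
  split; [exact: finite_set1|move=> _ -> /=].
  rewrite /cylinder_labellings /=; split=> [j i||m j i im].
  - rewrite !ffunE; case: ifP => // _.
    by rewrite /counts_from leqNgt ltn_ord.
  - by rewrite ffunE.
  - by rewrite !ffunE /counts_from leqNgt ltnS im.
rewrite lte_fin.
suff W_gt0 (m : 'I_n) (j : 'I_N) : 0 < qbos_weight q m (s m) (u j * y m)
    (HA.2 m j) (HA.1 (lift ord0 m) j) (HA.2 m (ordS j)) (HA.1 (widen_ord (leqnSn n) m) j).
  by apply: prodr_gt0 => m _; apply: prodr_gt0 => j _; exact: W_gt0.
rewrite /HA /= !ffunE.
apply: (qbos_weight_gt0 q_ge0 q_lt1 (spectral_gt0 m j) (spectral_gt_s2 m j)).
- by move=> i im; rewrite !ffunE /counts_from /= leqNgt ltnS im; case: ifP.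
- by move=> i im; rewrite !ffunE /counts_from /= leqNgt im; case: ifP.
- move=> i mi; rewrite !ffunE /counts_from /= /bump /= add1n.
  by rewrite mi (ltnW mi).
- move=> i; rewrite !ffunE /counts_from /= /bump /= add1n.
  by case: ifP => // _; rewrite leqnn.
- have [_|_] := eqVneq j site0.
    by right=> i mi; rewrite !ffunE /counts_from /= mi (ltnW mi).
  by left=> i; rewrite !ffunE.
Qed.

Lemma hop_rate_ge0 V k i : 0 <= hop_rate q u V k i.
Proof.
rewrite hop_rateE divr_ge0 ?(ltW (u_gt0 _))// /emit mulr_ge0//.
  by rewrite subr_ge0 exprn_ile1// ltW.
by apply: prodr_ge0 => j _; rewrite exprn_ge0.
Qed.

Lemma gen_offdiag_ge0 V W : V != W -> 0 <= gen V W.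
Proof.
move=> /negbTE VW; apply: sumr_ge0 => k _; apply: sumr_ge0 => i _.
by rewrite mulr_ge0 ?hop_rate_ge0// VW subr0 ler0n.
Qed.

Lemma gen_diag_le0 V : gen V V <= 0.
Proof.
apply: sumr_le0 => k _; apply: sumr_le0 => i _; rewrite eqxx.
by rewrite mulr_ge0_le0 ?hop_rate_ge0// subr_le0; case: eqP.
Qed.

Lemma gen_row_sum V : sector cnt V -> \sum_(W \in sector cnt) gen V W = 0.
Proof.
move=> SV; have [N1|N_gt1] : N = 1%N \/ (1 < N)%N by case: (N) N_ge1 => [|[|]]; auto.
  by apply: fsbig1 => W _; exact: (generator_ring1 q u W N1 SV).
transitivity (\sum_(W \in sector cnt) gen V W * (fun=> 1) W).
  by apply: eq_fsbigr => W _; rewrite mulr1.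
rewrite (generator_forward q u (fun=> 1) N_gt1 SV).
apply/eqP; rewrite subr_eq0; apply/eqP; apply: eq_bigr => k _.
by rewrite mulr1 -sum_rate; apply: eq_bigr => i _; rewrite mulr1.
Qed.

(** * Uniqueness of the stationary distribution *)

Definition stationary_vector (r : config N n -> R) :=
  forall W, sector cnt W -> \sum_(V \in sector cnt) r V * gen V W = 0.

Let Sfin := @finite_sector n N cnt.

(** Stationarity at W makes a sum of nonnegative inflows equal to 0, so zeros of r propagate
    backwards along jumps. *)
Lemma stationary_vanish_pred r V W : stationary_vector r ->
  (forall V, sector cnt V -> 0 <= r V) -> sector cnt V -> sector cnt W ->
  r W = 0 -> V != W -> 0 < gen V W -> r V = 0.
Proof.
move=> stat r0 SV SW rW VW VWgt0.
have term0 V' : sector cnt V' -> 0 <= r V' * gen V' W.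
  move=> SV'; have [->|V'W] := eqVneq V' W; first by rewrite rW mul0r.
  by rewrite mulr_ge0 ?r0 ?gen_offdiag_ge0.
have := pfsumr_eq0 Sfin term0 (stat W SW) SV => /eqP.
by rewrite mulf_eq0 (gt_eqF VWgt0) orbF => /eqP.
Qed.

Definition height V : nat := (\sum_(k < N) k * csum (V k))%N.

(* Away from site 0, the highest color present at a site hops towards 0 at a
   positive rate even when q = 0, so every configuration reaches the pile. *)
Lemma stationary_vanish r : stationary_vector r ->
  (forall V, sector cnt V -> 0 <= r V) -> r (pile 0) = 0 ->
  forall V, sector cnt V -> r V = 0.
Proof.
move=> stat r0 rpile V; have [h] := ubnP (height V).
elim: h V => // h IH V hV SV.
have [VP|[k [k0 Vk]]] : V = pile 0 \/ exists k : 'I_N, k != site0 /\ (0 < csum (V k))%N.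
  have [H|/existsNP[k /not_implyP[k0 Vk]]] :=
      pselect (forall k : 'I_N, k != site0 -> csum (V k) = 0%N); last first.
    by right; exists k; split=> //; rewrite lt0n; apply/eqP.
  left; have V0 j i : j != site0 -> V j i = 0%N.
    by move=> /H/eqP; rewrite sum_nat_eq0 => /forallP/(_ i)/eqP.
  apply/ffunP => j; apply/ffunP => i; rewrite !ffunE.
  case: eqVneq => [->|/V0//]; rewrite /counts_from leq0n -(SV i).
  by rewrite (bigD1 site0)//= big1 ?addn0// => j' /V0.
  by rewrite VP.
have N_gt1 : (1 < N)%N.
  have := ltn_ord k; move: k0; rewrite -val_eqE/= -lt0n; exact: leq_ltn_trans.
have [i0 Vi0] : exists i, (0 < V k i)%N.
  apply: contrapT => /forallNP H; move: Vk; rewrite /csum big1// => i _.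
  by apply/eqP; rewrite -leqn0 leqNgt; apply/negP/H.
have [i Vi imax] := @arg_maxnP _ i0 (fun i => 0 < V k i)%N val Vi0.
have Vj c : (i < c)%N -> V k c = 0%N.
  move=> ic; apply/eqP; rewrite -leqn0 leqNgt; apply: contraTN ic => /imax ci.
  by rewrite -leqNgt.
pose W := hop_left V k i.
have SW : sector cnt W by exact: sector_hop_left.
have hW : (height W < height V)%N.
  have kk := ord_pred_neq N_gt1 k.
  rewrite /height (bigD1 k)//= (bigD1 (ord_pred k))//=.
  rewrite [ltnRHS](bigD1 k)//= [X in (_ < _ + X)%N](bigD1 (ord_pred k))//=.
  rewrite (eq_bigr (fun j : 'I_N => j * csum (V j))%N); last first.
    by move=> j /andP[jk jk']; rewrite /W /hop_left !upd_neq.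
  rewrite !addnA ltn_add2r /W /hop_left upd_same upd_neq 1?eq_sym// upd_same.
  rewrite -[in X in (_ < X)%N](cdecK Vi) !csum_cinc.
  have -> : ((k + N).-1 %% N = k.-1)%N.
    have := ltn_ord k; move: k0; rewrite -val_eqE/=; case: (val k) => // k' _ kN.
    by rewrite addSn/= modnDr modn_small// ltnW.
  by move: k0; rewrite -val_eqE/= -lt0n => kgt0; nia.
have VW : V != W by apply: contraTneq hW => <-; rewrite ltnn.
apply: (stationary_vanish_pred stat r0 SV SW _ VW).
  by apply: IH => //; exact: leq_trans hW _.
rewrite /generator (negbTE VW); under eq_bigr do under eq_bigr do rewrite subr0.
rewrite (bigD1 k)//= ltr_pwDl//; last first.
  by apply: sumr_ge0 => j _; apply: sumr_ge0 => c _; rewrite mulr_ge0 ?hop_rate_ge0.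
rewrite (bigD1 i)//= ltr_pwDl//; last first.
  by apply: sumr_ge0 => c _; rewrite mulr_ge0 ?hop_rate_ge0.
rewrite hop_leftE// eqxx mulr1 hop_rateE divr_gt0// /emit mulr_gt0//.
  by case: (V k i) Vi => // v _; rewrite subr_gt0 expr_lt1.
by apply: prodr_gt0 => j ij; rewrite Vj// expr0.
Qed.

(** By the triangle inequality every component of |r| gen is nonnegative; since the rows of the
    generator sum to 0, so do these components, and each is 0. *)
Lemma stationary_abs r : stationary_vector r -> stationary_vector (fun V => `|r V|).
Proof.
move=> stat.
have ge0 W : sector cnt W -> 0 <= \sum_(V \in sector cnt) `|r V| * gen V W.
  move=> SW; have := stat W SW; rewrite !(fsbigD1 W _ _ Sfin SW)/= => /eqP.
  rewrite addr_eq0 => /eqP E.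
  have -> : `|r W| * gen W W = - `|r W * gen W W|.
    by rewrite normrM (ler0_norm (gen_diag_le0 W)); ring.
  rewrite addrC subr_ge0 E normrN.
  have fin1 : finite_set (sector cnt `\ W) by exact: finite_setD.
  rewrite !fsbig_finite//; apply: le_trans (ler_norm_sum _ _ _) _.
  rewrite -!fsbig_finite//= le_eqVlt; apply/orP; left; apply/eqP.
  apply: eq_fsbigr => V; rewrite inE => -[_ /= /eqP VW].
  by rewrite normrM [X in _ * X]ger0_norm ?gen_offdiag_ge0.
apply: pfsumr_eq0 => //.
rewrite exchange_fsbig//; apply: fsbig1 => V SV.
by rewrite -mulr_fsumr gen_row_sum// mulr0.
Qed.

(** Replacing r by -r if necessary, r is nonnegative at the pile. Then |r| - r is a nonnegative
    stationary vector that is 0 at the pile, hence 0 everywhere, and a nonnegative r of total mass 0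
    vanishes. *)
Lemma stationary_unique r : stationary_vector r ->
  \sum_(V \in sector cnt) r V = 0 -> forall V, sector cnt V -> r V = 0.
Proof.
wlog : r / 0 <= r (pile 0) => [th|rP] stat rsum.
  have [/th|/ltW rP V SV] := leP 0 (r (pile 0)); first exact.
  apply/eqP; rewrite -oppr_eq0; apply/eqP; move: V SV; apply: (th (fun V => - r V)).
  - by rewrite oppr_ge0.
  - move=> W SW; transitivity (\sum_(V \in sector cnt) -1 * (r V * gen V W)).
      by apply: eq_fsbigr => V _; ring.
    by rewrite -mulr_fsumr stat// mulr0.
  - transitivity (\sum_(V \in sector cnt) -1 * r V).
      by apply: eq_fsbigr => V _; rewrite mulN1r.
    by rewrite -mulr_fsumr rsum mulr0.
have absE V : sector cnt V -> `|r V| - r V = 0.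
  move: V; apply: (@stationary_vanish (fun V => `|r V| - r V)).
  - move=> W SW; transitivity (\sum_(V \in sector cnt)
        (`|r V| * gen V W + -1 * (r V * gen V W))).
      by apply: eq_fsbigr => V _; ring.
    rewrite fsbig_split//= -(mulr_fsumr (-1) _ (fun V => r V * gen V W)).
    by rewrite (stationary_abs stat)// stat// mulr0 addr0.
  - by move=> V _; rewrite subr_ge0 ler_norm.
  - by rewrite ger0_norm// subrr.
apply: pfsumr_eq0 => // V SV.
by have /eqP := absE V SV; rewrite subr_eq0 => /eqP <-.
Qed.

End Stationarity.

Unset Implicit Arguments.

Theorem proposition5p5 (R : realType) (n N : nat) (q : R) (u : 'I_N -> R)
    (cnt : 'I_n -> nat) (y s : 'I_n -> R)
    (n_ge1 : (1 <= n)%N) (N_ge1 : (1 <= N)%N)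
    (q_ge0 : 0 <= q) (q_lt1 : q < 1)
    (u_gt0 : forall j : 'I_N, 0 < u j)
    (cnt_ge1 : forall i : 'I_n, (1 <= cnt i)%N)
    (s2_lt : forall (j : 'I_N) (m : 'I_n), 0 <= s m ^+ 2 < u j * y m) :
  exists Z : R,
    (forall V : config N n, sector cnt V ->
       cylinder_partition_function q u y s V \is a fin_num) /\
    unique_stationary_distribution q u cnt
      (fun V : config N n => fine (cylinder_partition_function q u y s V) / Z).
Proof.
have [fin stat] := cylinder_stationary N_ge1 q_ge0 q_lt1 u_gt0 cnt_ge1 s2_lt.
pose F V := fine (cylinder_partition_function q u y s V).
have F_ge0 V : 0 <= F V.
  apply: fine_ge0; apply: esum_ge0 => HA _; rewrite lee_fin.
  apply: prodr_ge0 => m _; apply: prodr_ge0 => j _.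
  exact: (qbos_weight_ge0 q_ge0 q_lt1 _ (spectral_gt0 s2_lt m j) (spectral_gt_s2 s2_lt m j)).
(* The total mass of F on the sector, positive because of its value at [pile 0]. *)
pose Z := \sum_(V \in sector cnt) F V.
have Sfin := @finite_sector n N cnt.
have SP := pile_sector cnt N_ge1.
have Z_gt0 : 0 < Z.
  rewrite /Z (fsbigD1 _ _ _ Sfin SP)/= ltr_pwDl//; last exact: fsumr_ge0.
  apply: fine_gt0; rewrite (cylinder_pile_gt0 cnt N_ge1 q_ge0 q_lt1 s2_lt)/=.
  by rewrite -ge0_fin_numE ?fin// ltW// (cylinder_pile_gt0 cnt N_ge1 q_ge0 q_lt1 s2_lt).
have Z_neq0 : Z != 0 by rewrite gt_eqF.
have sumF : \sum_(V \in sector cnt) F V / Z = 1.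
  by rewrite -mulr_fsuml divff.
have statF W : sector cnt W -> \sum_(V \in sector cnt) F V / Z * generator q u V W = 0.
  move=> SW; transitivity (\sum_(V \in sector cnt) Z^-1 * (F V * generator q u V W)).
    by apply: eq_fsbigr => V _; ring.
  by rewrite -mulr_fsumr stat ?mulr0.
exists Z; split=> //; split; first by split=> // V _; apply: divr_ge0 (F_ge0 V) (ltW Z_gt0).
move=> p [_ p1 pstat] V SV; apply/eqP; rewrite -subr_eq0; apply/eqP.
move: V SV.
apply: (stationary_unique N_ge1 q_ge0 q_lt1 u_gt0 (r := fun V => p V - F V / Z)).
  move=> W SW; transitivity (\sum_(V \in sector cnt)
      (p V * generator q u V W + -1 * (F V / Z * generator q u V W))).
    by apply: eq_fsbigr => V _; ring.
  rewrite fsbig_split//= pstat// add0r.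
  by rewrite -(mulr_fsumr (-1) _ (fun V => F V / Z * generator q u V W)) statF// mulr0.
transitivity (\sum_(V \in sector cnt) (p V + -1 * (F V / Z))).
  by apply: eq_fsbigr => V _; ring.
by rewrite fsbig_split//= p1 -(mulr_fsumr (-1) _ (fun V => F V / Z)) sumF mulr1 subrr.
Qed.
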